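(* Let $n\ge 1$, $Q=2n+2$, $\gamma\in(0,1)$, $p_1>1$, $p_2>1$. Set $$p_1^*=\max\left\{\frac1\gamma,\;1+\frac{2(2-\gamma)}{Q-2+2\gamma}\right\},\qquad p_2^{**}=\max\left\{\frac{\gamma-\gamma^2+1}{\gamma(2-\gamma)},\;1+\frac{2}{Q-2+2\gamma}\right\},$$ $\tilde p_2=\dfrac{p_1+1-\gamma}{2-\gamma}$, and $$q_{\mathrm{sc}}=\begin{cases}\dfrac{Q(p_1-1)}{2(2-\gamma)}, & \text{if } p_2\ge \tilde p_2,\\[2mm] \dfrac{Q(p_2-1)}{2}, & \text{if } p_2\le\tilde p_2\end{cases}$$ (the two formulas agree when $p_2=\tilde p_2$). Assume that $$p_1>p_1^*\qquad\text{and}\qquad p_2>p_2^{**}.$$ Then there exists $\varepsilon_0>0$ (depending only on $n,\gamma,p_1,p_2$) such that for every nonnegative $u_0\in C_0(\mathbb{H}^n)\cap L^{q_{\mathrm{sc}}}(\mathbb{H}^n)$ with $\|u_0\|_{L^\infty}\le\varepsilon_0$ and $\|u_0\|_{L^{q_{\mathrm{sc}}}}\le \varepsilon_0$, the problem $$\partial_t u-\Delta_{\mathbb{H}}u=\int_0^t(t-s)^{-\gamma}|u|^{p_1-1}u(s)\,ds+|u|^{p_2-1}u\quad(\eta\in\mathbb{H}^n,\ t>0),\qquad u(\eta,0)=u_0(\eta)\quad (\eta\in\mathbb{H}^n),$$ admits a unique global-in-time mild solution $u\in C([0,\infty);C_0(\mathbb{H}^n)\cap L^{q_{\mathrm{s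c}}}(\mathbb{H}^n))$.
   Context: Heisenberg group: $\mathbb{H}^n=\mathbb{R}^n\times\mathbb{R}^n\times\mathbb{R}$ with group law $(x,y,\tau)\circ(x',y',\tau')=(x+x',y+y',\tau+\tau'+2(x\cdot y'-x'\cdot y))$; $Q=2n+2$ is its homogeneous dimension. The sub-Laplacian is $\Delta_{\mathbb{H}}=\sum_{i=1}^n(X_i^2+Y_i^2)$ with $X_i=\partial_{x_i}-2y_i\partial_\tau$, $Y_i=\partial_{y_i}+2x_i\partial_\tau$. $L^p(\mathbb{H}^n)$ is taken with respect to Lebesgue measure on $\mathbb{R}^{2n+1}$ (the Haar measure), and $C_0(\mathbb{H}^n)$ is the space of continuous functions vanishing at infinity, with the sup norm. Heat semigroup: $(S_{\mathbb{H}}(t))_{t\ge0}$ is the heat semigroup generated by $\Delta_{\mathbb{H}}$; for $t>0$, $(S_{\mathbb{H}}(t)\varphi)(\eta)=\int_{\mathbb{H}^n}\varphi(\xi)\,h_t(\xi^{-1}\circ\eta)\,d\xi$, where $h_t>0$ is the heat kernel of $\Delta_{\mathbb{H}}$, of the form $h_t(x,y,\tau)=t^{-(n+1)}h(x/\sqrt t,y/\sqrt t,\tau/t)$ with $h$ a Schwartz function, $\int h_t=1$ and $h_t(\eta)=h_t(\eta^{-1})$. It is a contraction semigroup on $L^p(\mathbb{H}^n)$, $1\le p\le\infty$, strongly continuous for $p<\infty$ and on $C_0(\mathbb{H}^n)$. Mild solution: for $T>0$, $u\in C([0,T],C_0(\mathbb{H}^n))$ is a mild solution on $[0,T]$ if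 for all $t\in[0,T]$ $$u(t)=S_{\mathbb{H}}(t)u_0+\int_0^tS_{\mathbb{H}}(t-s)\int_0^s(s-\sigma)^{-\gamma}|u|^{p_1-1}u(\sigma)\,d\sigma\,ds+\int_0^tS_{\mathbb{H}}(t-s)|u|^{p_2-1}u(s)\,ds .$$ A global-in-time mild solution is a function that is a mild solution on $[0,T]$ for every $T>0$. *)

(* Defs.v *)
From HB Require Import structures.
From mathcomp Require Import all_boot all_order all_algebra.
From mathcomp Require Import all_classical all_reals all_analysis.

Set Implicit Arguments.
Unset Strict Implicit.
Unset Printing Implicit Defensive.

Import Order.TTheory GRing.Theory Num.Theory.
Import numFieldNormedType.Exports.

Local Open Scope classical_set_scope.
Local Open Scope ring_scope.

(* The sigma-algebra on row vectors generated by the coordinates; for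
   T := R : realType it is the Borel sigma-algebra of R^n. *)
Section measurable_rV.
Context {d : measure_display} {T : measurableType d}.
Variable n : nat.

Definition rV_coord (i : 'I_n) (v : 'rV[T]_n) : T := v ord0 i.

Let rV_set0 : g_sigma_preimage rV_coord set0.
Proof. exact: sigma_algebra0. Qed.

Let rV_setC A : g_sigma_preimage rV_coord A -> g_sigma_preimage rV_coord (~` A).
Proof. exact: sigma_algebraC. Qed.

Let rV_bigcup (F : (set 'rV[T]_n)^nat) :
  (forall i, g_sigma_preimage rV_coord (F i)) ->
  g_sigma_preimage rV_coord (\bigcup_i (F i)).
Proof. exact: sigma_algebra_bigcup. Qed.

HB.instance Definition _ := @isMeasurable.Build (measure_tuple_display d)
  'rV[T]_n (g_sigma_preimage rV_coord) rV_set0 rV_setC rV_bigcup.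

Lemma measurable_rV_coord (i : 'I_n) : measurable_fun setT (rV_coord i).
Proof.
move=> _ Y mY; rewrite setTI; apply: sub_sigma_algebra => /=.
rewrite -bigcup_seq/=; exists i => /=; first by rewrite mem_index_enum.
by exists Y => //; rewrite setTI.
Qed.

Lemma measurable_fun_rV {d' : measure_display} {U : measurableType d'}
    (f : U -> 'rV[T]_n) :
  (forall i, measurable_fun setT (rV_coord i \o f)) -> measurable_fun setT f.
Proof.
move=> mf.
have H : g_sigma_preimage (fun i => rV_coord i \o f) `<=` measurable.
  apply: smallest_sub; first exact: sigma_algebra_measurable.
  move=> A; rewrite -bigcup_seq => -[i _ [B mB <-]].
  exact: mf.
rewrite g_sigma_preimage_comp in H.
by move=> _ A mA; apply: H; exists A.
Qed.

End measurable_rV.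

(* The library's canonical sigma-finite structure on m1 \x m2 only applies to
   subprobabilities. *)
Lemma sigma_finite_product (d1 d2 : measure_display) (T1 : measurableType d1)
    (T2 : measurableType d2) (R : realType)
    (m1 : {measure set T1 -> \bar R})
    (m2 : {sigma_finite_measure set T2 -> \bar R}) :
  sigma_finite setT m1 -> sigma_finite setT (m1 \x m2)%E.
Proof.
move=> /sigma_finiteP[F [TF ndF Foo]].
have /sigma_finiteP[G [TG ndG Goo]] := sigma_finiteT m2.
exists (fun n => F n `*` G n).
  rewrite -setXTT TF TG predeqE => -[x y]; split.
    move=> [/= [n _ Fnx] [k _ Gky]]; exists (maxn n k) => //; split.
    - by move: x Fnx; exact/subsetPset/ndF/leq_maxl.
    - by move: y Gky; exact/subsetPset/ndG/leq_maxr.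
  by move=> [n _ []/= ? ?]; split; exists n.
move=> k; have [? ?] := Foo k; have [? ?] := Goo k.
split; first exact: measurableX.
by rewrite product_measure1E// lte_mul_pinfty// ge0_fin_numE.
Qed.

Section lebesgue_rV.
Context {R : realType}.

Definition rV_cons n (p : R * 'rV[R]_n) : 'rV[R]_n.+1 :=
  row_mx (const_mx p.1 : 'M[R]_(1, 1)) p.2.

Definition rV_uncons n (v : 'rV[R]_n.+1) : R * 'rV[R]_n :=
  (v ord0 ord0, @rsubmx R 1 1 n v).

Lemma rV_consK n : cancel (@rV_cons n) (@rV_uncons n).
Proof.
move=> [a v]; rewrite /rV_uncons /rV_cons /=; congr pair.
  have -> : ord0 = @lshift 1 n ord0 by exact: val_inj.
  by apply: (etrans (@row_mxEl R 1 1 n _ _ ord0 ord0)); rewrite mxE.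
exact: (@row_mxKr R 1 1 n).
Qed.

Lemma rV_unconsK n : cancel (@rV_uncons n) (@rV_cons n).
Proof.
move=> v; rewrite /rV_uncons /rV_cons /=.
apply: (etrans _ (@hsubmxK _ 1 1 n v)).
congr (@row_mx R 1 1 n _ _); apply/matrixP => i j; rewrite !mxE !ord1.
by congr (v _ _); exact: val_inj.
Qed.

Lemma measurable_rV_cons n : measurable_fun setT (@rV_cons n).
Proof.
apply: measurable_fun_rV => i; case: (@split_ordP 1 n i) => j ->.
  rewrite (_ : _ \o _ = fst) //.
  apply/funext => p; rewrite /rV_coord /= /rV_cons.
  by apply: (etrans (@row_mxEl R 1 1 n _ _ ord0 j)); rewrite mxE.
rewrite (_ : _ \o _ = rV_coord j \o snd).
  by apply: measurableT_comp => //; exact: measurable_rV_coord.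
by apply/funext => p; exact: (@row_mxEr R 1 1 n _ _ ord0 j).
Qed.

Lemma measurable_rV_uncons n : measurable_fun setT (@rV_uncons n).
Proof.
apply/measurable_fun_pairP; split.
  exact: (@measurable_rV_coord _ R n.+1 ord0).
apply: measurable_fun_rV => i.
rewrite (_ : _ \o _ = @rV_coord _ R n.+1 (@rshift 1 n i)).
  exact: measurable_rV_coord.
by apply/funext => v; rewrite /rV_coord /= mxE.
Qed.

Section step.
Variables (n : nat) (m : {sigma_finite_measure set 'rV[R]_n -> \bar R}).

Definition lebesgue_rV_step : set 'rV[R]_n.+1 -> \bar R :=
  pushforward (@lebesgue_measure R \x m)%E (@rV_cons n).

Let mcons := @measurable_rV_cons n.

Let step0 : lebesgue_rV_step set0 = 0%E.
Proof. exact: measure0. Qed.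

Let step_ge0 A : (0 <= lebesgue_rV_step A)%E.
Proof. exact: measure_ge0. Qed.

Let step_sigma_additive : semi_sigma_additive lebesgue_rV_step.
Proof. exact: measure_semi_sigma_additive. Qed.

HB.instance Definition _ := isMeasure.Build _ _ _ lebesgue_rV_step
  step0 step_ge0 step_sigma_additive.

Lemma lebesgue_rV_step_sigma_finite : sigma_finite setT lebesgue_rV_step.
Proof.
have [F TF mF] := sigma_finite_product m
  (sigma_finiteT (@lebesgue_measure R)).
exists (fun i => @rV_uncons n @^-1` F i).
  by rewrite -preimage_bigcup -TF preimage_setT.
move=> i; have [mFi Fioo] := mF i; split.
  by rewrite -[X in measurable X]setTI; exact: measurable_rV_uncons.
rewrite /lebesgue_rV_step /pushforward -comp_preimage.
rewrite (_ : _ @^-1` _ = F i) //; apply/funext => p /=.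
by rewrite /preimage /= rV_consK.
Qed.

HB.instance Definition _ := @Measure_isSigmaFinite.Build _ _ _
  lebesgue_rV_step lebesgue_rV_step_sigma_finite.
End step.

(* Lebesgue measure on R^n, by induction on n: the Dirac mass on the point R^0,
   and the image of the product measure of R * R^n under rV_cons. *)
Fixpoint lebesgue_rV (n : nat) : {sigma_finite_measure set 'rV[R]_n -> \bar R} :=
  match n with
  | 0 => [the {sigma_finite_measure set 'rV[R]_0 -> \bar R} of
           @dirac _ 'rV[R]_0 0 R]
  | n'.+1 => [the {sigma_finite_measure set 'rV[R]_n'.+1 -> \bar R} of
           lebesgue_rV_step (lebesgue_rV n')]
  end.

End lebesgue_rV.

(* Points ((x, y), tau) of the Heisenberg group of dimension 2n+1; as a normed
   space this carries the maximum norm of the coordinates. *)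
Notation heis R n := ('rV[R]_n * 'rV[R]_n * (R : realType))%type.

Section heisenberg.
Context {R : realType} {n : nat}.
Local Notation H := (heis R n).
Implicit Types (f g : H -> R) (eta xi : H).

Definition dot (x y : 'rV[R]_n) : R := \sum_(i < n) x ord0 i * y ord0 i.

Definition heis_mul xi eta : H :=
  (xi.1.1 + eta.1.1, xi.1.2 + eta.1.2,
   xi.2 + eta.2 + 2 * (dot xi.1.1 eta.1.2 - dot eta.1.1 xi.1.2)).

Definition heis_inv xi : H := (- xi.1.1, - xi.1.2, - xi.2).

Definition heis_dilate (r : R) eta : H :=
  (r *: eta.1.1, r *: eta.1.2, r ^+ 2 * eta.2).

(* measurableTypeR R is R with its Borel sigma-algebra. *)
Definition haar : set ('rV[R]_n * 'rV[R]_n * measurableTypeR R) -> \bar R :=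
  (lebesgue_rV n \x lebesgue_rV n \x @lebesgue_measure R)%E.

HB.instance Definition _ := Measure.on haar.

Lemma haar_sigma_finite : sigma_finite setT haar.
Proof. by do 2! apply: sigma_finite_product; exact: sigma_finiteT. Qed.

HB.instance Definition _ := @Measure_isSigmaFinite.Build _ _ _ haar
  haar_sigma_finite.

Definition dir_x (i : 'I_n) : H := (delta_mx ord0 i, 0, 0).
Definition dir_y (i : 'I_n) : H := (0, delta_mx ord0 i, 0).
Definition dir_tau : H := (0, 0, 1).

Definition field_X (i : 'I_n) f eta : R :=
  'D_(dir_x i) f eta - 2 * eta.1.2 ord0 i * 'D_dir_tau f eta.
Definition field_Y (i : 'I_n) f eta : R :=
  'D_(dir_y i) f eta + 2 * eta.1.1 ord0 i * 'D_dir_tau f eta.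

Definition sublaplacian f eta : R :=
  \sum_(i < n) (field_X i (field_X i f) eta + field_Y i (field_Y i f) eta).

Definition coordinate_dir (v : H) : Prop :=
  (exists i, v = dir_x i) \/ (exists i, v = dir_y i) \/ v = dir_tau.

Definition partials (vs : seq H) f : H -> R :=
  foldr (fun v g eta => 'D_v g eta) f vs.

Definition schwartz f : Prop :=
  forall vs : seq H, (forall v, v \in vs -> coordinate_dir v) ->
    (forall eta v, coordinate_dir v -> derivable (partials vs f) eta v) /\
    (forall k : nat, exists C : R, forall eta,
      (1 + `|eta|) ^+ k * `|partials vs f eta| <= C).

(* The heat kernel of the sub-Laplacian: the convolution semigroup solving
   the heat equation.  The heat equation together with the scaling of an
   integrable profile of mass 1 (an approximate identity as t -> 0+)
   determines h t for t > 0; h t is unconstrained for t <= 0. *)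
Record is_heat_kernel (h : R -> H -> R) : Prop := IsHeatKernel {
  heat_kernel_gt0 : forall (t : R) eta, 0 < t -> 0 < h t eta;
  heat_kernel_heat : forall (t : R) eta, 0 < t ->
    is_derive t 1 (h ^~ eta) (sublaplacian (h t) eta);
  heat_kernel_scaling : exists2 g : H -> R, schwartz g &
    forall (t : R) eta, 0 < t ->
      h t eta = (t ^+ n.+1)^-1 * g (heis_dilate (Num.sqrt t)^-1 eta);
  heat_kernel_mass : forall t : R, 0 < t -> \int[haar]_eta h t eta = 1;
  heat_kernel_sym : forall (t : R) eta, 0 < t -> h t (heis_inv eta) = h t eta;
  heat_kernel_semigroup : forall (s t : R) eta, 0 < s -> 0 < t ->
    \int[haar]_xi (h s xi * h t (heis_mul (heis_inv xi) eta)) = h (s + t) eta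
}.

Definition heat_semigroup (h : R -> H -> R) (t : R) f eta : R :=
  if t == 0 then f eta
  else \int[haar]_xi (f xi * h t (heis_mul (heis_inv xi) eta)).

Definition C0 : set (H -> R) := [set f | continuous f /\
  forall e : R, 0 < e ->
    exists2 K : set H, compact K & forall eta, ~ K eta -> `|f eta| < e].

Definition sup_norm f : \bar R := ereal_sup (range (fun eta => `|f eta|%:E)).

Definition Lq (q : R) : set (H -> R) := [set f | f \in Lfun haar q%:E].

Definition Lq_norm (q : \bar R) f : \bar R := ('N[haar]_q [EFin \o f])%E.

(* C(D, X) for a time set D and a function space X with norm N. *)
Definition continuous_curve (D : set R) (X : set (H -> R))
    (N : (H -> R) -> \bar R) (u : R -> H -> R) : Prop :=
  (forall t, D t -> X (u t)) /\
  (forall t, D t ->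
    N (u s \- u t) @[s --> within D (nbhs t)] --> (0 : \bar R)%E).

Definition power_nl (p a : R) : R := `|a| `^ (p - 1) * a.

(* The C_0-valued time integrals are evaluated pointwise. *)
Definition mild_solution (h : R -> H -> R) (gamma p1 p2 : R) (u0 : H -> R)
    (T : R) (u : R -> H -> R) : Prop :=
  continuous_curve `[0, T] C0 sup_norm u /\
  forall (t : R) eta, t \in `[0, T] ->
    u t eta =
      heat_semigroup h t u0 eta
      + \int[lebesgue_measure]_(s in `[0, t])
          heat_semigroup h (t - s)
            (fun xi => \int[lebesgue_measure]_(sigma in `[0, s])
               ((s - sigma) `^ (- gamma) * power_nl p1 (u sigma xi))) eta
      + \int[lebesgue_measure]_(s in `[0, t])
          heat_semigroup h (t - s) (fun xi => power_nl p2 (u s xi)) eta.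

Definition global_mild_solution (h : R -> H -> R) (gamma p1 p2 : R)
    (u0 : H -> R) (u : R -> H -> R) : Prop :=
  forall T, 0 < T -> mild_solution h gamma p1 p2 u0 T u.

(* C([0, +oo[, C_0 \cap L^q), the intersection being normed by the sum
   (or the maximum) of the two norms. *)
Definition global_curve (q : R) (u : R -> H -> R) : Prop :=
  continuous_curve `[0, +oo[ C0 sup_norm u /\
  continuous_curve `[0, +oo[ (Lq q) (Lq_norm q%:E) u.

End heisenberg.

Section exponents.
Context {R : realType}.
Implicit Type gamma : R.

Definition homdim (n : nat) : R := (2 * n + 2)%:R.

Definition p1_star n gamma : R :=
  Num.max (1 / gamma)
    (1 + 2 * (2 - gamma) / (homdim n - 2 + 2 * gamma)).

Definition p2_star2 n gamma : R :=
  Num.max ((gamma - gamma ^+ 2 + 1) / (gamma * (2 - gamma)))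
    (1 + 2 / (homdim n - 2 + 2 * gamma)).

Definition p2_tilde gamma (p1 : R) : R := (p1 + 1 - gamma) / (2 - gamma).

Definition q_sc n gamma (p1 p2 : R) : R :=
  if p2_tilde gamma p1 <= p2 then homdim n * (p1 - 1) / (2 * (2 - gamma))
  else homdim n * (p2 - 1) / 2.

End exponents.

(* Main.v *)
(* With d = n + 1 = Q / 2, replace (p1, p2) by a scale-invariant pair e1 <= p1,
   e2 = 1 + (e1 - 1) / (2 - gamma) <= p2, one of the two inequalities being an
   equality; for a bounded u the powers u ^ p and u ^ e compare.  Put
   alpha = (2 - gamma) / (e1 - 1), so that q_sc = d / alpha.  For a suitable
   beta and r = d / (alpha - beta), Jensen, Minkowski and h_t <= C t ^ (- d)
   show that the Duhamel map preserves the set of all u with 0 <= u <= delta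
   and |u(t)|_r <= delta t ^ (- beta), and that it bounds u in L ^ q_sc.
   As everything is nonnegative, the iterates starting from 0 increase to a
   fixed point, and no contraction estimate is needed.

   In time, u(t + s) = S(s) u(t) + O(s) in C_0 and in L ^ q, so continuity
   follows from the strong continuity of S; the latter comes from the
   concentration of h_t and uniform continuity for the sup norm, and from the
   Riesz-Scheffe lemma in L ^ q.  For uniqueness, the difference of two
   solutions is at most 2 ^ (- j) B exp (lambda t) for every j. *)

Require Import Defs.
From HB Require Import structures.
From mathcomp Require Import all_boot all_order all_algebra.
From mathcomp Require Import all_classical all_reals all_analysis.
From mathcomp Require Import measurable_realfun.
From mathcomp Require Import ring lra zify.

Set Implicit Arguments.
Unset Strict Implicit.
Unset Printing Implicit Defensive.

Import Order.TTheory GRing.Theory Num.Theory.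
Import numFieldNormedType.Exports.

Local Open Scope classical_set_scope.
Local Open Scope ring_scope.

(** * Jensen, Minkowski and Riesz-Scheffe *)

(** The thresholds are the conditions under which a suitable [beta] exists. It must exceed
    [(1 - gamma) / (e1 - 1)], so that the sup estimate of the memory term closes, and
    [alpha - dim / e1], so that [r >= e1]; it must stay below [1 / e1], so that [u ^ e1] is
    integrable in time near 0. For [e1 = p1] this amounts to [p1 > p1_star], for [e2 = p2] to
    [p2 > p2_star2]. In particular [beta > 0]: the critical norm does not carry the iteration, and
    its bound is read off the fixed point.

    The sup norm does not have the critical scaling: estimated through [u ^ e], a Duhamel term would
    only be [O(t ^ (- alpha))] there. Spending one more power of [u] on its sup bound and using
    [u ^ (e - 1)] gives exactly [t ^ 0].

    The memory makes the equation nonautonomous, so a solution cannot be restarted from its value at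
    a later time. Only the linear flow is restarted, with the right-hand side of the fixed point
    frozen as a given source. The estimates run in the extended reals for an abstract kernel;
    membership in [C_0] comes at the end, from the smoothing of the heat flow. *)

Section powR.
Context {R : realType}.
Implicit Types x r s : R.

Lemma gt0_powRD x r s : 0 < x -> x `^ (r + s) = x `^ r * x `^ s.
Proof. by move=> x0; rewrite powRD// (gt_eqF x0) implybT. Qed.

Lemma gt0_powRB x r s : 0 < x -> x `^ (r - s) = x `^ r / x `^ s.
Proof. by move=> x0; rewrite powRB// (gt_eqF x0) implybT. Qed.

End powR.

Section jensen.
Local Open Scope ereal_scope.
Context {R : realType}.

(** Young's inequality for the product of [x / l] and 1, with conjugate exponents [p] and
    [(1 - p^-1)^-1], rescaled by [l]. It is an equality at [x = l]. *)
Lemma le_tangent_poweR (x : \bar R) (l p : R) : (1 <= p)%R -> (0 < l)%R ->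
  0 <= x ->
  x <= (l `^ (1 - p) / p)%:E * x `^ p + (l * (1 - p^-1))%:E.
Proof.
move=> p1 l0; have p0 : (0 < p)%R by exact: lt_le_trans p1.
have c0 : (0 < l `^ (1 - p) / p)%R by rewrite divr_gt0// powR_gt0.
case: x => [x| |//]; last first.
  by move=> _; rewrite poweRyr ?gt_eqF// gt0_muley ?lte_fin.
rewrite lee_fin => x0; rewrite poweR_EFin -EFinM -EFinD lee_fin.
have : (x / l <= (x / l) `^ p / p + (1 - p^-1))%R.
  (* At [p = 1] the conjugate exponent is infinite, so this case is computed directly. *)
  move: p1; rewrite le_eqVlt => /predU1P[<-|p1].
    by rewrite powRr1 ?divr_ge0 ?(ltW l0)// invr1 subrr mulr1 addr0.
  have q0 : (0 < (1 - p^-1)^-1)%R by rewrite invr_gt0 subr_gt0 invf_lt1.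
  have := @conjugate_powR R (x / l)%R 1%R p (1 - p^-1)^-1%R.
  rewrite powR1 mulr1 invrK mul1r; apply => //.
    by rewrite divr_ge0// ltW.
  by rewrite addrC subrK.
move=> /(ler_wpM2l (ltW l0)); rewrite [in X in (X <= _)%R -> _]mulrC divfK ?gt_eqF//.
move=> /le_trans; apply.
rewrite mulrDr lerD2r.
have -> : ((x / l) `^ p = x `^ p * l `^ (- p))%R.
  rewrite powRM ?invr_ge0 ?(ltW l0)//; congr (_ * _)%R.
  by rewrite -(powR_inv1 (ltW l0)) -powRrM mulN1r.
have -> : (l `^ (1 - p) = l * l `^ (- p))%R.
  by rewrite gt0_powRD// powRr1 ?(ltW l0).
by rewrite [leLHS](_ : _ = l * l `^ (- p) / p * x `^ p)%R//; ring.
Qed.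

(* Integrate the tangent line of [x ^ p] at [l = (j / W) ^ p^-1] for [j] slightly above the right-hand integral. *)
Lemma jensen_powR d (T : measurableType d) (mu : {measure set T -> \bar R})
    (D : set T) (w : T -> R) (f : T -> \bar R) (p W : R) :
  measurable D -> (1 <= p)%R -> (0 < W)%R ->
  measurable_fun D w -> measurable_fun D f ->
  (forall x, D x -> (0 <= w x)%R) -> (forall x, D x -> 0 <= f x) ->
  \int[mu]_(x in D) (w x)%:E <= W%:E ->
  (\int[mu]_(x in D) ((w x)%:E * f x)) `^ p <=
    (W `^ (p - 1))%:E * \int[mu]_(x in D) ((w x)%:E * f x `^ p).
Proof.
move=> mD p1 W0 mw mf w0 f0 wW.
have p0 : (0 < p)%R by exact: lt_le_trans p1.
set I := integral _ _ _; set J := integral _ _ _.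
have mfp : measurable_fun D (fun x => f x `^ p).
  by apply: (measurableT_comp (measurable_poweR p)).
have mwf : measurable_fun D (fun x => (w x)%:E * f x `^ p).
  by apply: emeasurable_funM => //; exact/measurable_EFinP.
have J0 : 0 <= J.
  by apply: integral_ge0 => x Dx; rewrite mule_ge0 ?lee_fin ?w0 ?poweR_ge0.
have I0 : 0 <= I.
  by apply: integral_ge0 => x Dx; rewrite mule_ge0 ?lee_fin ?w0 ?f0.
have [Jy|Jfin] := eqVneq J +oo.
  by rewrite Jy gt0_muley ?leey// lte_fin powR_gt0.
have {}Jfin : J \is a fin_num by rewrite ge0_fin_numE// lt_neqAle Jfin leey.
(* A positive [j] stands in for [J], because the tangency point [l] must be positive even when
   [J = 0]. *)
have key (j : R) : (0 < j)%R -> J <= j%:E -> I `^ p <= (W `^ (p - 1) * j)%:E.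
  move=> j0 Jj; set l := ((j / W) `^ p^-1)%R.
  have l0 : (0 < l)%R by apply: powR_gt0; exact: divr_gt0.
  have lp : (l `^ p = j / W)%R.
    by rewrite -powRrM mulVf ?gt_eqF// powRr1// divr_ge0 ?ltW.
  have IlW : I <= (l * W)%:E.
    have c0 : (0 <= l `^ (1 - p) / p)%R by rewrite divr_ge0 ?powR_ge0 ?ltW.
    have e0 : (0 <= l * (1 - p^-1))%R.
      by rewrite mulr_ge0 ?(ltW l0)// subr_ge0 invf_le1.
    apply: (@le_trans _ _ (\int[mu]_(x in D)
      ((l `^ (1 - p) / p)%:E * ((w x)%:E * f x `^ p)
        + (l * (1 - p^-1))%:E * (w x)%:E))).
      apply: ge0_le_integral => //.
      - by move=> x Dx; rewrite mule_ge0 ?lee_fin ?w0 ?f0.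
      - by apply: emeasurable_funM => //; exact/measurable_EFinP.
      - apply: emeasurable_funD; apply: emeasurable_funM => //.
        exact/measurable_EFinP.
      - move=> x Dx; rewrite muleCA [_ * (w x)%:E]muleC -ge0_muleDr.
        + by apply: lee_wpmul2l; [rewrite lee_fin w0|rewrite le_tangent_poweR// f0].
        + by rewrite mule_ge0 ?lee_fin ?poweR_ge0.
        + by rewrite lee_fin.
    rewrite ge0_integralD//; last 4 first.
    - by move=> x Dx; rewrite !mule_ge0 ?lee_fin ?w0 ?poweR_ge0.
    - by apply: emeasurable_funM.
    - by move=> x Dx; rewrite mule_ge0 ?lee_fin ?w0.
    - by apply: emeasurable_funM => //; exact/measurable_EFinP.
    rewrite ge0_integralZl//; last first.
      by move=> x Dx; rewrite mule_ge0 ?lee_fin ?w0 ?poweR_ge0.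
    rewrite ge0_integralZl//; last exact/measurable_EFinP.
    apply: (@le_trans _ _ ((l `^ (1 - p) / p)%:E * j%:E +
                           (l * (1 - p^-1))%:E * W%:E)).
      by apply: leeD; apply: lee_wpmul2l => //; rewrite lee_fin.
    (* Since [l ^ p = j / W], the two terms are the fractions [1 / p] and [1 - 1 / p] of [l * W]. *)
    rewrite -!EFinM -EFinD lee_fin gt0_powRB// powRr1 ?(ltW l0)// lp.
    have jn0 : j != 0%R by rewrite gt_eqF.
    have Wn0 : W != 0%R by rewrite gt_eqF.
    have pn0 : p != 0%R by rewrite gt_eqF.
    rewrite [leLHS](_ : _ = l * W)%R//.
    by field; rewrite jn0 Wn0 pn0.
  apply: (@le_trans _ _ ((l * W)%:E `^ p)).
    apply: gt0_ler_poweR => //; first exact: ltW.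
      by rewrite in_itv/= I0 leey.
    by rewrite in_itv/= leey lee_fin mulr_ge0 ?ltW.
  rewrite poweR_EFin lee_fin (powRM _ (ltW l0) (ltW W0)) lp gt0_powRB//.
  rewrite (powRr1 (ltW W0)) [leLHS](_ : _ = W `^ p / W * j)%R//.
  by field; rewrite gt_eqF.
apply/lee_addgt0Pr => e e0.
have c0 : (0 < W `^ (p - 1))%R by rewrite powR_gt0.
have /key : (0 < fine J + e / W `^ (p - 1))%R.
  by rewrite ltr_wpDl ?fine_ge0// divr_gt0.
have -> : (W `^ (p - 1) * (fine J + e / W `^ (p - 1)) =
           W `^ (p - 1) * fine J + e)%R by field; rewrite gt_eqF.
have -> : (W `^ (p - 1))%:E * J + e%:E = (W `^ (p - 1) * fine J + e)%:E.
  by rewrite EFinD EFinM fineK.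
by apply; rewrite EFinD fineK// leeDl// lee_fin divr_ge0 ?ltW.
Qed.

End jensen.

Section minkowski.
Local Open Scope ereal_scope.
Context {R : realType} {d1 d2 : measure_display} {Z : measurableType d1}
  {X : measurableType d2}.
Variables (nu : {sigma_finite_measure set Z -> \bar R})
  (mu : {sigma_finite_measure set X -> \bar R}).

Lemma measurable_integral_fst (F : Z * X -> \bar R) (D : set Z) :
  measurable D -> measurable_fun setT F -> (forall z, 0 <= F z) ->
  measurable_fun setT (fun x => \int[nu]_(z in D) F (z, x)).
Proof.
move=> mD mF F0.
under eq_fun do rewrite integral_mkcond.
rewrite (_ : (fun _ => _) = fubini_G nu (fun p => (\1_D p.1)%:E * F p)).
  apply: measurable_fun_fubini_tonelli_G.
    apply: emeasurable_funM => //; apply/measurable_EFinP.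
    by apply: (measurableT_comp (measurable_indic mD)); exact: measurable_fst.
  by move=> z; rewrite mule_ge0 ?lee_fin.
apply/funext => x; apply: eq_integral => z _.
by rewrite patchE indicE; case: ifPn; rewrite ?mul1e ?mul0e.
Qed.

Lemma measurable_integral_snd (F : Z * X -> \bar R) :
  measurable_fun setT F -> (forall z, 0 <= F z) ->
  measurable_fun setT (fun z => \int[mu]_x F (z, x)).
Proof. by move=> mF F0; exact: (measurable_fun_fubini_tonelli_F F). Qed.

(** For nonnegative [f] and [c] and [N > 0] this bounds the [L ^ N] norm by [c]. Stated without the
    root, it passes through Jensen, Tonelli and monotone convergence as it stands. *)
Definition Lbound (N : R) (f : X -> \bar R) (c : R) : Prop :=
  \int[mu]_x (f x `^ N) <= (c `^ N)%:E.

(* Jensen for the weight [c] applied to [F / c], followed by Tonelli. *)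
Lemma Lbound_integral (D : set Z) (F : Z * X -> \bar R) (c : Z -> R) (C N : R) :
  measurable D -> (1 <= N)%R -> measurable_fun setT F -> (forall z, 0 <= F z) ->
  measurable_fun setT c -> (forall z, D z -> (0 < c z)%R) ->
  (forall z, D z -> Lbound N (fun x => F (z, x)) (c z)) ->
  (0 < C)%R -> \int[nu]_(z in D) (c z)%:E <= C%:E ->
  Lbound N (fun x => \int[nu]_(z in D) F (z, x)) C.
Proof.
move=> mD N1 mF F0 mc c0 Fc C0 cC; rewrite /Lbound.
have N0 : (0 < N)%R by exact: lt_le_trans N1.
(* The factor left by Jensen for [F / c] with weight [c]:
   [c * (F / c) ^ N = c ^ (1 - N) * F ^ N]. *)
pose b z := ((c z) `^ (1 - N))%R.
have mFN : measurable_fun setT (fun p => F p `^ N).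
  exact: (measurableT_comp (measurable_poweR N)).
have mb : measurable_fun setT b.
  exact: (measurableT_comp (measurable_powR _) mc).
pose G (p : Z * X) := (\1_D p.1)%:E * ((b p.1)%:E * F p `^ N).
have mG : measurable_fun setT G.
  apply: emeasurable_funM.
    apply/measurable_EFinP; apply: measurableT_comp; last exact: measurable_fst.
    exact: measurable_indic.
  apply: emeasurable_funM => //; apply/measurable_EFinP.
  by apply: (measurableT_comp mb); exact: measurable_fst.
have G0 p : 0 <= G p by rewrite /G !mule_ge0 ?lee_fin ?powR_ge0 ?poweR_ge0.
have mFx x : measurable_fun setT (fun z => F (z, x)).
  by apply: measurableT_comp mF _; exact: measurable_pair2.
have mGx x : measurable_fun setT (fun z => G (z, x)).
  by apply: measurableT_comp mG _; exact: measurable_pair2.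
have mGz z : measurable_fun setT (fun x => G (z, x)).
  by apply: measurableT_comp mG _; exact: measurable_pair1.
apply: (@le_trans _ _ (\int[mu]_x ((C `^ (N - 1))%:E * \int[nu]_z G (z, x)))).
  apply: ge0_le_integral => //.
  - by move=> x _; exact: poweR_ge0.
  - apply: (measurableT_comp (measurable_poweR N)).
    exact: measurable_integral_fst.
  - by apply: emeasurable_funM => //; exact: measurable_integral_fst.
  move=> x _.
  have -> : \int[nu]_(z in D) F (z, x) =
      \int[nu]_(z in D) ((c z)%:E * ((c z `^ (- 1))%:E * F (z, x))).
    apply: eq_integral => z; rewrite inE => Dz.
    by rewrite muleA -EFinM powR_inv1 ?ltW ?c0// divff ?mul1e// gt_eqF// c0.
  apply: le_trans (jensen_powR mD N1 C0 _ _ _ _ cC) _.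
  - exact: measurable_funTS.
  - apply: emeasurable_funM; last exact: measurable_funTS.
    apply/measurable_EFinP; apply: measurable_funTS.
    exact: (measurableT_comp (measurable_powR _) mc).
  - by move=> z Dz; exact/ltW/c0.
  - by move=> z Dz; rewrite mule_ge0// lee_fin powR_ge0.
  rewrite le_eqVlt; apply/orP; left; apply/eqP; congr (_ * _).
  rewrite [RHS](_ : _ = \int[nu]_(z in D) ((b z)%:E * F (z, x) `^ N)).
    apply: eq_integral => z; rewrite inE => Dz.
    rewrite poweRM// ?lee_fin ?powR_ge0// poweR_EFin muleA -EFinM.
    congr ((_)%:E * _); rewrite /b gt0_powRB ?c0// powRr1 ?ltW ?c0//.
    by rewrite -powRrM mulN1r powRN.
  rewrite [RHS]integral_mkcond; apply: eq_integral => z _.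
  by rewrite /G patchE indicE; case: ifPn; rewrite ?mul1e ?mul0e.
have mGI : measurable_fun setT (fun x => \int[nu]_z G (z, x)).
  exact: measurable_integral_fst.
rewrite ge0_integralZl//; last 2 first.
- by move=> x _; exact: integral_ge0.
- by rewrite lee_fin powR_ge0.
rewrite -(fubini_tonelli G)//.
apply: (@le_trans _ _ ((C `^ (N - 1))%:E * C%:E)).
  apply: lee_wpmul2l; first by rewrite lee_fin powR_ge0.
  apply: le_trans cC; rewrite [leRHS]integral_mkcond.
  apply: ge0_le_integral => //.
  - by move=> z _; exact: integral_ge0.
  - exact: measurable_integral_snd.
  - by apply/measurable_restrict => //; apply/measurable_EFinP; exact: measurable_funTS.
  move=> z _; rewrite patchE /G; case: ifPn => [|nD]; last first.
    by rewrite integral0_eq// => x _; rewrite indicE (negbTE nD) mul0e.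
  move=> zD; move: (zD); rewrite inE => Dz.
  under eq_integral do rewrite /= indicE zD mul1e.
  rewrite ge0_integralZl//.
  - apply: (@le_trans _ _ ((b z)%:E * (c z `^ N)%:E)).
      by apply: lee_wpmul2l; [rewrite lee_fin powR_ge0|exact: Fc].
    by rewrite -EFinM lee_fin /b -(gt0_powRD _ _ (c0 _ Dz)) subrK (powRr1 (ltW (c0 _ Dz))).
  - by apply: measurableT_comp mFN _; exact: measurable_pair1.
  - by move=> x _; exact: poweR_ge0.
  - by rewrite lee_fin powR_ge0.
by rewrite -EFinM lee_fin mulrC mulr_powRB1 ?lexx //; exact: ltW.
Qed.

End minkowski.

Section powR_inequalities.
Context {R : realType}.
Implicit Types a b q M : R.

(** Write each power as [x ^ q = x * x ^ (q - 1)]; the second factor is monotone in [x]. *)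
Lemma powR_superadditive a b q : 1 <= q -> 0 <= a -> 0 <= b ->
  a `^ q + b `^ q <= (a + b) `^ q.
Proof.
move=> q1 a0 b0; have q0 : 0 < q by exact: lt_le_trans q1.
rewrite -(mulr_powRB1 a0 q0) -(mulr_powRB1 b0 q0).
rewrite -(mulr_powRB1 (addr_ge0 a0 b0) q0) mulrDl.
by apply: lerD; apply: ler_wpM2l => //; apply: ge0_ler_powR;
  rewrite ?subr_ge0 ?nnegrE ?addr_ge0// ?lerDl ?lerDr.
Qed.

(** By convexity: the tangent inequality at the larger point, say [a], gives [a ^ q - b ^ q <= q * a
    ^ (q - 1) * (a - b)]. *)
Lemma powR_lipschitz a b q M : 1 <= q -> 0 <= a <= M -> 0 <= b <= M ->
  `|a `^ q - b `^ q| <= q * M `^ (q - 1) * `|a - b|.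
Proof.
move=> q1; have q0 : 0 < q by exact: lt_le_trans q1.
wlog ba : a b / b <= a.
  move=> H aM bM; have [ba|/ltW ab] := leP b a; first exact: H.
  by rewrite distrC (distrC a); exact: H.
move=> /andP[a0 aM] /andP[b0 bM].
have [a_eq0|aN0] := eqVneq a 0.
  have -> : b = a by apply/eqP; rewrite eq_le ba a_eq0 b0.
  by rewrite !subrr normr0 mulr0.
have a_gt0 : 0 < a by rewrite lt_neqAle eq_sym aN0.
have T : q * (b * a `^ (q - 1)) <= b `^ q + (q - 1) * a `^ q.
  have := @le_tangent_poweR R b%:E a q q1 a_gt0 b0.
  rewrite poweR_EFin -EFinM -EFinD lee_fin => /(ler_wpM2r (powR_ge0 a (q - 1))).
  move=> /(ler_wpM2l (ltW q0)) /le_trans; apply.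
  rewrite -(mulr_powRB1 a0 q0) le_eqVlt; apply/orP; left; apply/eqP.
  have -> : a `^ (1 - q) = (a `^ (q - 1))^-1 by rewrite -powRN opprB.
  by field; rewrite gt_eqF// gt_eqF// powR_gt0.
have P : 0 <= a `^ q - b `^ q by rewrite subr_ge0 ge0_ler_powR// ltW.
rewrite (ger0_norm P) ger0_norm ?subr_ge0//.
apply: (@le_trans _ _ (q * a `^ (q - 1) * (a - b))); last first.
  apply: ler_wpM2r; rewrite ?subr_ge0//; apply: ler_wpM2l; first exact: ltW.
  by apply: ge0_ler_powR; rewrite ?subr_ge0 ?nnegrE ?(le_trans a0 aM).
have E : a * a `^ (q - 1) = a `^ q by rewrite mulr_powRB1.
nra.
Qed.

Lemma cvg_powR (I : Type) (F : set_system I) {FF : Filter F} (f : I -> R) a q :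
  1 <= q -> (forall i, 0 <= f i) -> 0 <= a -> f i @[i --> F] --> a ->
  (f i) `^ q @[i --> F] --> a `^ q.
Proof.
move=> q1 f0 a0 fa; pose L := q * (a + 1) `^ (q - 1) + 1.
have q0 : 0 < q by exact: lt_le_trans q1.
have L0 : 0 < L by rewrite ltr_wpDl// mulr_ge0 ?powR_ge0 ?ltW.
apply/cvgrPdist_le => e e0.
have e'0 : 0 < Num.min 1 (e / L) by rewrite lt_min ltr01 divr_gt0.
move/cvgrPdist_le : fa => /(_ _ e'0); apply: filterS => i.
rewrite le_min => /andP[fi1 fie].
have fia : f i <= a + 1.
  by rewrite -lerBlDl (le_trans (ler_norm _))// distrC.
apply: le_trans (@powR_lipschitz a (f i) q (a + 1) q1 _ _) _.
- by rewrite a0 lerDl ler01.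
- by rewrite f0.
apply: (@le_trans _ _ (L * `|a - f i|)).
  by apply: ler_wpM2r => //; rewrite lerDl ler01.
by rewrite mulrC -ler_pdivlMr.
Qed.

End powR_inequalities.

Section convergence.
Local Open Scope ereal_scope.
Context {R : realType} {d : measure_display} {T : measurableType d}.
Variable mu : {measure set T -> \bar R}.

(** The norms of curves are extended reals; this trades their topology for the epsilon form in which
    the estimates come. *)
Lemma ereal_cvg0_near (I : Type) (F : set_system I) {FF : Filter F} (u : I -> \bar R) :
  (u i @[i --> F] --> 0) <->
  (forall e : R, (0 < e)%R -> \forall i \near F, `|u i| <= e%:E).
Proof.
split=> [/fine_cvgP[fu /cvgrPdist_le u0] e e0|H].
  near=> i; have ui : u i \is a fin_num by near: i.
  have : (`|0 - (fine \o u) i| <= e)%R by near: i; exact: u0.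
  by move: ui; rewrite /=; case: (u i) => //= r _; rewrite sub0r normrN lee_fin.
apply/fine_cvgP; split.
  apply: filterS (H 1%R ltr01) => i ui.
  rewrite -abse_fin_num ge0_fin_numE; last exact: abse_ge0.
  exact: le_lt_trans ui (ltry _).
apply/cvgrPdist_le => e e0; apply: filterS (H e e0) => i /=.
rewrite sub0r normrN; case: (u i) => [r| |] //=; rewrite ?lee_fin//.
Unshelve. all: by end_near. Qed.

Lemma dominated_cvg0 (f_ : nat -> T -> R) (g : T -> R) :
  (forall k, measurable_fun setT (f_ k)) -> measurable_fun setT g ->
  (forall k x, 0 <= f_ k x <= g x)%R ->
  \int[mu]_x (g x)%:E < +oo ->
  (forall x, f_ k x @[k --> \oo] --> (0 : R)%R) ->
  forall e : R, (0 < e)%R -> \forall k \near \oo, \int[mu]_x (f_ k x)%:E <= e%:E.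
Proof.
move=> mf mg fg ig f0 e e0.
have g0 x : (0 <= g x)%R by have /andP[] := fg 0%N x; exact: le_trans.
have ge : mu.-integrable setT (EFin \o g).
  apply/integrableP; split; first exact/measurable_EFinP.
  by under eq_integral do rewrite /= ger0_norm//.
have [] := @dominated_convergence _ _ _ mu setT measurableT
  (fun k x => (f_ k x)%:E) (cst 0) (EFin \o g) _ _ _ ge _.
- by move=> k; exact/measurable_EFinP.
- exact: measurable_cst.
- apply: aeW => x _; apply: cvg_EFin; last exact: f0.
  by apply: nearW.
- apply: aeW => x k _; have /andP[fk0 fkg] := fg k x.
  by rewrite /= lee_fin ger0_norm.
move=> _ _; rewrite integral0 => /ereal_cvg0_near /(_ e e0).
apply: filterS => k; apply: le_trans; exact: lee_abs.
Qed.

(* Pointwise, [|a - b|^q + b^q <= a^q + 2 (b^q - a^q)^+]; integrated, the norm bound leaves only the last term, which is dominated by [2 f^q]. *)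
Lemma riesz_scheffe (f_ : nat -> T -> R) (f : T -> R) (q : R) : (1 <= q)%R ->
  (forall k, measurable_fun setT (f_ k)) -> measurable_fun setT f ->
  (forall k x, 0 <= f_ k x)%R -> (forall x, 0 <= f x)%R ->
  \int[mu]_x (f x `^ q)%:E < +oo ->
  (forall k, \int[mu]_x (f_ k x `^ q)%:E <= \int[mu]_x (f x `^ q)%:E) ->
  (forall x, f_ k x @[k --> \oo] --> f x) ->
  forall e : R, (0 < e)%R ->
  \forall k \near \oo, \int[mu]_x (`|f_ k x - f x| `^ q)%:E <= e%:E.
Proof.
move=> q1 mf_ mf f_0 f0 iq fq fcvg e e0.
have q0 : (0 < q)%R by exact: lt_le_trans q1.
pose p k x := Num.max (f x `^ q - f_ k x `^ q)%R 0%R.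
have mpow (g : T -> R) : measurable_fun setT g -> measurable_fun setT (fun x => g x `^ q)%R.
  by move=> mg; exact: (measurableT_comp (measurable_powR q) mg).
have mp k : measurable_fun setT (p k).
  apply: measurable_maxr; last exact: measurable_cst.
  by apply: measurable_funB; exact: mpow.
have p0 k x : (0 <= p k x)%R by rewrite le_max lexx orbT.
have pf k x : (p k x <= f x `^ q)%R.
  by rewrite ge_max powR_ge0 andbT gerBl powR_ge0.
have e20 : (0 < e / 2)%R by rewrite divr_gt0.
have H : \forall k \near \oo, \int[mu]_x (p k x)%:E <= (e / 2)%:E.
  apply: (dominated_cvg0 mp (mpow _ mf)) => // [k x|x]; first by rewrite p0 pf.
  have /cvgrPdist_le C : (f_ k x `^ q)%R @[k --> \oo] --> (f x `^ q)%R.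
    exact: cvg_powR.
  apply/cvgrPdist_le => r r0; apply: filterS (C r r0) => k.
  move=> fr; rewrite sub0r normrN (ger0_norm (p0 _ _)).
  by rewrite ge_max (le_trans (ler_norm _) fr) ltW.
(* Superadditivity is applied to the larger of [f_ k x] and [f x], split as the smaller one plus the
   gap. *)
have key k x : (`|f_ k x - f x| `^ q + f x `^ q <= f_ k x `^ q + 2 * p k x)%R.
  have [fle|flt] := leP (f x) (f_ k x).
    rewrite ger0_norm ?subr_ge0//.
    apply: (@le_trans _ _ (f_ k x `^ q)%R); last by rewrite lerDl mulr_ge0.
    by apply: le_trans (powR_superadditive q1 _ _) _; rewrite ?subr_ge0// subrK.
  rewrite ler0_norm ?subr_le0 ?(ltW flt)// opprB.
  have S : ((f x - f_ k x) `^ q + f_ k x `^ q <= f x `^ q)%R.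
    by apply: le_trans (powR_superadditive q1 _ _) _; rewrite ?subr_ge0 ?(ltW flt)// subrK.
  have P : (f x `^ q - f_ k x `^ q <= p k x)%R by rewrite le_max lexx.
  lra.
move: H; apply: filterS => k pk.
have mabs : measurable_fun setT (fun x => `|f_ k x - f x| `^ q)%R.
  apply: mpow; apply: measurableT_comp => //.
  by apply: measurable_funB.
have I : \int[mu]_x (`|f_ k x - f x| `^ q + f x `^ q)%:E <=
    \int[mu]_x (f_ k x `^ q + 2 * p k x)%:E.
  apply: ge0_le_integral => //.
  - by move=> x _; rewrite lee_fin addr_ge0// powR_ge0.
  - by apply/measurable_EFinP; apply: measurable_funD => //; exact: mpow.
  - apply/measurable_EFinP; apply: measurable_funD; first exact: mpow.
    by apply: measurable_funM => //; exact: measurable_cst.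
  - by move=> x _; rewrite lee_fin.
(* The integral of [f ^ q] is finite, so adding it to both sides is reversible and no subtraction of
   extended reals occurs. *)
rewrite -(@leeD2rE _ (\int[mu]_x (f x `^ q)%:E)); last first.
  by rewrite ge0_fin_numE//; apply: integral_ge0 => x _; rewrite lee_fin powR_ge0.
have -> : \int[mu]_x (`|f_ k x - f x| `^ q)%:E + \int[mu]_x (f x `^ q)%:E =
    \int[mu]_x (`|f_ k x - f x| `^ q + f x `^ q)%:E.
  under [RHS]eq_integral do rewrite EFinD.
  rewrite ge0_integralD//.
  - exact/measurable_EFinP.
  - by move=> x _; rewrite lee_fin powR_ge0.
  - by apply/measurable_EFinP; exact: mpow.
apply: le_trans I _.
under eq_integral do rewrite EFinD EFinM.
rewrite ge0_integralD//; last 4 first.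
- by move=> x _; rewrite lee_fin powR_ge0.
- by apply/measurable_EFinP; exact: mpow.
- by move=> x _; rewrite mule_ge0 ?lee_fin.
- by apply: emeasurable_funM; [exact: measurable_cst|exact/measurable_EFinP].
rewrite addeC; apply: leeD => //.
rewrite ge0_integralZl_EFin//; last 2 first.
- by move=> x _; rewrite lee_fin.
- exact/measurable_EFinP.
apply: (@le_trans _ _ (2%:E * (e / 2)%:E)).
  by apply: lee_wpmul2l; rewrite ?lee_fin.
by rewrite -EFinM lee_fin mulrC divfK.
Qed.

End convergence.

(** * Haar measure on the Heisenberg group *)

Section affine.
Local Open Scope ereal_scope.
Context {R : realType}.

Lemma ge0_integral_image d1 d2 (X : measurableType d1) (Y : measurableType d2)
    (phi : X -> Y) (mu : {measure set X -> \bar R}) (m : {measure set Y -> \bar R})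
    (f : Y -> \bar R) :
  measurable_fun setT phi ->
  (forall A, measurable A -> m A = mu (phi @^-1` A)) ->
  measurable_fun setT f -> (forall y, 0 <= f y) ->
  \int[m]_y f y = \int[mu]_x f (phi x).
Proof.
move=> mphi mE mf f0.
have H := ge0_integral_pushforward mphi mu measurableT mf (fun y _ => f0 y).
rewrite preimage_setT in H; rewrite -[RHS]H.
by apply: eq_measure_integral => A mA _; rewrite mE.
Qed.

(** Both sides are measures in [A], and Lebesgue measure is determined by half-open intervals, where
    this is the scaling of lengths. *)
Lemma lebesgue_measure_preimage_affine (a b : R) (A : set (measurableTypeR R)) :
  a != 0%R ->
  measurable A ->
  lebesgue_measure A =
  `|a|%:E * lebesgue_measure ((fun x : R => a * x + b)%R @^-1` A).
Proof.
move=> a0 mA; pose phi (x : measurableTypeR R) : measurableTypeR R := (a * x + b)%R.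
have mphi : measurable_fun setT phi.
  by apply: measurable_funD => //; exact: measurable_funM.
pose pm : {measure set (measurableTypeR R) -> \bar R} :=
  measure_function_pushforward__canonical__measure_function_Measure
    (@lebesgue_measure R) mphi.
pose m : {measure set (measurableTypeR R) -> \bar R} := mscale (NngNum (normr_ge0 a)) pm.
suff U (X : set (measurableTypeR R)) : ocitv X -> lebesgue_measure X = m X.
  exact: (@lebesgue_measure_unique R m U A mA).
move=> /ocitvP[->|[[c d] /= cd ->]]; first by rewrite !measure0.
  rewrite lebesgue_measure_itv/= lte_fin cd /m /mscale/= /pushforward.
  have [a_gt0|a_lt0|a_eq0] := ltgtP 0%R a; last by rewrite a_eq0 eqxx in a0.
    rewrite (_ : _ @^-1` _ = `]((c - b) / a)%R, ((d - b) / a)%R]%classic).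
      rewrite lebesgue_measure_itv/= lte_fin ltr_pM2r ?invr_gt0// ltrD2r cd.
      rewrite gtr0_norm// -!EFinB -EFinM; congr EFin; field.
      by rewrite gt_eqF.
    apply/seteqP; split => x /=; rewrite !in_itv/= /phi.
      by rewrite ltr_pdivrMr// ler_pdivlMr// ltrBlDr lerBrDr mulrC.
    by rewrite ltr_pdivrMr// ler_pdivlMr// ltrBlDr lerBrDr mulrC.
  (* A negative slope reverses the interval and moves its closed end to the left. *)
  rewrite (_ : _ @^-1` _ = `[((d - b) / a)%R, ((c - b) / a)%R[%classic).
    rewrite lebesgue_measure_itv/= lte_fin ltr_nM2r ?invr_lt0// ltrD2r cd.
    rewrite ltr0_norm// -!EFinB -EFinM; congr EFin; field.
    by rewrite lt_eqF.
  apply/seteqP; split => x /=; rewrite !in_itv/= /phi.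
    by rewrite ltr_ndivlMr// ler_ndivrMr// ltrBlDr lerBrDr mulrC andbC.
  by rewrite ltr_ndivlMr// ler_ndivrMr// ltrBlDr lerBrDr mulrC andbC.
Qed.

Lemma ge0_integral_affine (a b : R) (f : measurableTypeR R -> \bar R) : a != 0%R ->
  measurable_fun setT f -> (forall x, 0 <= f x) ->
  \int[lebesgue_measure]_x f (a * x + b)%R =
  (`|a|^-1)%:E * \int[lebesgue_measure]_x f x.
Proof.
move=> a0 mf f0; pose phi (x : measurableTypeR R) : measurableTypeR R := (a * x + b)%R.
have mphi : measurable_fun setT phi.
  by apply: measurable_funD => //; exact: measurable_funM.
have aN0 : (`|a| != 0)%R by rewrite normr_eq0.
have a'0 : (0 <= `|a|^-1)%R by [].
pose m : {measure set (measurableTypeR R) -> \bar R} := mscale (NngNum a'0) (@lebesgue_measure R).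
have mE (A : set (measurableTypeR R)) : measurable A -> m A = lebesgue_measure (phi @^-1` A).
  move=> mA.
  apply: (etrans (congr1 (fun z => (`|a|^-1)%:E * z)
    (lebesgue_measure_preimage_affine b a0 mA))).
  by rewrite muleA -EFinM mulVf// mul1e.
have H : \int[m]_x f x = \int[lebesgue_measure]_x f (a * x + b)%R.
  exact: (ge0_integral_image (phi := phi) (mu := @lebesgue_measure R) (m := m)
    mphi mE mf f0).
apply: (etrans (esym H)).
exact: (ge0_integral_mscale (@lebesgue_measure R) measurableT _ mf).
Qed.

End affine.

Section lebesgue_rV.
Local Open Scope ereal_scope.
Context {R : realType}.

Lemma ge0_integral_rVS n (f : 'rV[R]_n.+1 -> \bar R) :
  measurable_fun setT f -> (forall v, 0 <= f v) ->
  \int[lebesgue_rV n.+1]_v f v =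
  \int[lebesgue_measure]_a \int[lebesgue_rV n]_v f (rV_cons (a, v)).
Proof.
move=> mf f0.
have mfc : measurable_fun [set: measurableTypeR R * 'rV[R]_n] (f \o @rV_cons R n).
  by apply: measurableT_comp => //; exact: measurable_rV_cons.
rewrite (ge0_integral_image (X := (measurableTypeR R * 'rV[R]_n)%type)
  (phi := @rV_cons R n)
  (mu := (@lebesgue_measure R \x lebesgue_rV n)%E) (m := lebesgue_rV n.+1)
  (@measurable_rV_cons R n) (fun _ _ => erefl) mf f0).
exact: (fubini_tonelli1 (m1 := @lebesgue_measure R) (m2 := lebesgue_rV n)
  (f \o @rV_cons R n) mfc (fun=> f0 _)).
Qed.

Lemma rV_consD n (a b : R) (v w : 'rV[R]_n) :
  (rV_cons (a, v) + rV_cons (b, w) = rV_cons (a + b, v + w))%R.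
Proof.
apply: (etrans (@add_row_mx R 1 1 n _ _ _ _)); rewrite /rV_cons/=; congr row_mx.
by apply/matrixP => i j; rewrite !mxE.
Qed.

Lemma rV_consZ n (r a : R) (v : 'rV[R]_n) :
  (r *: rV_cons (a, v) = rV_cons (r * a, r *: v))%R.
Proof.
apply: (etrans (@scale_row_mx R 1 1 n _ _ _)); rewrite /rV_cons/=; congr row_mx.
by apply/matrixP => i j; rewrite !mxE.
Qed.

Lemma measurable_affine_rV n (r : R) (w : 'rV[R]_n) :
  measurable_fun setT (fun v : 'rV[R]_n => r *: v + w)%R.
Proof.
apply: measurable_fun_rV => i.
rewrite (_ : _ \o _ = fun v => r * rV_coord i v + w ord0 i)%R; last first.
  by apply/funext => v; rewrite /rV_coord/= !mxE.
apply: measurable_funD => //; apply: measurable_funM => //.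
exact: measurable_rV_coord.
Qed.

(** Induction on the dimension: Tonelli along [rV_cons] splits off one coordinate, which contributes
    one factor [r^-1]. *)
Lemma ge0_integral_affine_rV n (r : R) (w : 'rV[R]_n) (f : 'rV[R]_n -> \bar R) :
  (0 < r)%R -> measurable_fun setT f -> (forall v, 0 <= f v) ->
  \int[lebesgue_rV n]_v f (r *: v + w)%R =
  ((r ^+ n)^-1)%:E * \int[lebesgue_rV n]_v f v.
Proof.
move=> r0; elim: n w f => [|n IH] w f mf f0.
  rewrite expr0 invr1 mul1e; apply: eq_integral => v _; congr f.
  by apply/matrixP => i; case.
have mfr : measurable_fun setT (fun v : 'rV[R]_n.+1 => f (r *: v + w)%R).
  exact: measurableT_comp mf (measurable_affine_rV r w).
rewrite !ge0_integral_rVS//.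
have mfc : measurable_fun [set: measurableTypeR R * 'rV[R]_n] (f \o @rV_cons R n).
  by apply: measurableT_comp => //; exact: measurable_rV_cons.
have mfa a : measurable_fun setT (fun v : 'rV[R]_n => f (rV_cons (a, v))).
  by apply: measurableT_comp mfc _; exact: measurable_pair1.
have E a v : f (r *: rV_cons (a, v) + w)%R =
    f (rV_cons (r * a + (rV_uncons w).1, r *: v + (rV_uncons w).2)%R).
  by rewrite -{1}(rV_unconsK w) rV_consZ [rV_uncons w]surjective_pairing rV_consD.
under eq_integral => a _.
  under eq_integral do rewrite E.
  rewrite (IH _ (fun v => f (rV_cons (r * a + (rV_uncons w).1, v)%R)))//.
  over.
have mI : measurable_fun [set: measurableTypeR R]
    (fun a : measurableTypeR R => \int[lebesgue_rV n]_v f (rV_cons (a, v))).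
  exact: (measurable_fun_fubini_tonelli_F (m2 := lebesgue_rV n)
    (f \o @rV_cons R n) mfc (fun=> f0 _)).
have I0 a : 0 <= \int[lebesgue_rV n]_v f (rV_cons (a, v)).
  by apply: integral_ge0.
rewrite ge0_integralZl; [|exact: measurableT| | |]; last 3 first.
- by apply: (measurableT_comp mI); apply: measurable_funD.
- by move=> a _; exact: I0.
- by rewrite lee_fin invr_ge0 exprn_ge0// ltW.
have rN0 : r != 0%R by rewrite gt_eqF.
rewrite (ge0_integral_affine _ rN0 mI I0) muleA -EFinM; congr (_%:E * _).
by rewrite gtr0_norm// exprSr invfM.
Qed.

End lebesgue_rV.

Section haar_integral.
Context {R : realType} {n : nat}.
(* [R] itself carries another measurable structure than [measurableTypeR R],
   the Borel structure on which [lebesgue_measure] and [haar] live. *)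
Local Notation mH := ('rV[R]_n * 'rV[R]_n * measurableTypeR R)%type.
Implicit Types xi eta : heis R n.

Section measurability.
Context {d : measure_display} {T : measurableType d}.

Lemma measurable_heis (x y : T -> 'rV[R]_n) (tau : T -> measurableTypeR R) :
  measurable_fun setT x -> measurable_fun setT y -> measurable_fun setT tau ->
  measurable_fun setT (fun t => (x t, y t, tau t) : mH).
Proof.
by move=> mx my mt; apply: measurable_fun_pair => //; exact: measurable_fun_pair.
Qed.

Lemma measurable_heis_x (F : T -> mH) : measurable_fun setT F ->
  measurable_fun setT (fun t => (F t).1.1).
Proof.
move=> mF; apply: (measurableT_comp measurable_fst).
exact: (measurableT_comp measurable_fst).
Qed.

Lemma measurable_heis_y (F : T -> mH) : measurable_fun setT F ->
  measurable_fun setT (fun t => (F t).1.2).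
Proof.
move=> mF; apply: (measurableT_comp measurable_snd).
exact: (measurableT_comp measurable_fst).
Qed.

Lemma measurable_heis_tau (F : T -> mH) : measurable_fun setT F ->
  measurable_fun [set: T] (fun t => (F t).2 : measurableTypeR R).
Proof. by move=> mF; exact: (measurableT_comp measurable_snd). Qed.

Lemma measurable_coord (x : T -> 'rV[R]_n) i : measurable_fun setT x ->
  measurable_fun setT (fun t => x t ord0 i : R).
Proof.
by move=> mx; exact: (measurableT_comp (@measurable_rV_coord _ R n i) mx).
Qed.

Lemma measurable_rVD (x y : T -> 'rV[R]_n) :
  measurable_fun setT x -> measurable_fun setT y ->
  measurable_fun setT (fun t => x t + y t).
Proof.
move=> mx my; apply: measurable_fun_rV => i.
rewrite (_ : _ \o _ = fun t => x t ord0 i + y t ord0 i).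
  by apply: measurable_funD; exact: measurable_coord.
by apply/funext => t; rewrite /rV_coord/= mxE.
Qed.

Lemma measurable_rVZ (r : T -> R) (x : T -> 'rV[R]_n) :
  measurable_fun setT r -> measurable_fun setT x ->
  measurable_fun setT (fun t => r t *: x t).
Proof.
move=> mr mx; apply: measurable_fun_rV => i.
rewrite (_ : _ \o _ = fun t => r t * x t ord0 i).
  by apply: measurable_funM => //; exact: measurable_coord.
by apply/funext => t; rewrite /rV_coord/= mxE.
Qed.

Lemma measurable_dot (x y : T -> 'rV[R]_n) :
  measurable_fun setT x -> measurable_fun setT y ->
  measurable_fun setT (fun t => dot (x t) (y t)).
Proof.
move=> mx my; apply: measurable_sum => i.
by apply: measurable_funM; exact: measurable_coord.
Qed.

Lemma measurable_heis_mul (F G : T -> mH) :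
  measurable_fun setT F -> measurable_fun setT G ->
  measurable_fun setT (fun t => heis_mul (F t) (G t) : mH).
Proof.
move=> mF mG.
have mFx := measurable_heis_x mF; have mFy := measurable_heis_y mF.
have mGx := measurable_heis_x mG; have mGy := measurable_heis_y mG.
have mFt := measurable_heis_tau mF; have mGt := measurable_heis_tau mG.
apply: measurable_heis; [exact: measurable_rVD|exact: measurable_rVD|].
apply: measurable_funD; first exact: measurable_funD.
apply: measurable_funM => //.
by apply: measurable_funB; exact: measurable_dot.
Qed.

Lemma measurable_heis_inv (F : T -> mH) : measurable_fun setT F ->
  measurable_fun setT (fun t => heis_inv (F t) : mH).
Proof.
move=> mF; apply: measurable_heis.
- under eq_fun do rewrite -scaleN1r.
  by apply: measurable_rVZ => //; exact: measurable_heis_x.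
- under eq_fun do rewrite -scaleN1r.
  by apply: measurable_rVZ => //; exact: measurable_heis_y.
- by apply: measurable_funN; exact: measurable_heis_tau.
Qed.

Lemma measurable_heis_dilate (r : T -> R) (F : T -> mH) :
  measurable_fun setT r -> measurable_fun setT F ->
  measurable_fun setT (fun t => heis_dilate (r t) (F t) : mH).
Proof.
move=> mr mF; apply: measurable_heis.
- by apply: measurable_rVZ => //; exact: measurable_heis_x.
- by apply: measurable_rVZ => //; exact: measurable_heis_y.
- apply: measurable_funM; last exact: measurable_heis_tau.
  exact: measurable_funX.
Qed.

End measurability.

Local Open Scope ereal_scope.

(** Naming the product lets it carry a sigma-finite structure, which Tonelli's theorem asks of the
    left factor of [haar]. *)
Let lebesgue_xy : set ('rV[R]_n * 'rV[R]_n) -> \bar R :=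
  (lebesgue_rV n \x lebesgue_rV n).

HB.instance Definition _ := Measure.on lebesgue_xy.

Let lebesgue_xy_sigma_finite : sigma_finite setT lebesgue_xy.
Proof. by apply: sigma_finite_product; exact: sigma_finiteT. Qed.

HB.instance Definition _ := @Measure_isSigmaFinite.Build _ _ _ lebesgue_xy
  lebesgue_xy_sigma_finite.

Lemma haar_integralE (f : mH -> \bar R) : measurable_fun setT f ->
  (forall eta, 0 <= f eta) ->
  \int[haar]_eta f eta =
  \int[lebesgue_rV n]_x \int[lebesgue_rV n]_y
    \int[@lebesgue_measure R]_tau f (x, y, tau).
Proof.
move=> mf f0.
transitivity (\int[lebesgue_xy]_xy \int[@lebesgue_measure R]_tau f (xy, tau)).
  exact: (fubini_tonelli1 (m1 := lebesgue_xy) (m2 := @lebesgue_measure R) f mf f0).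
pose F xy := \int[@lebesgue_measure R]_tau f (xy, tau).
have mF : measurable_fun setT F.
  exact: (measurable_fun_fubini_tonelli_F (m2 := @lebesgue_measure R) f mf f0).
have F0 xy : 0 <= F xy by apply: integral_ge0.
exact: (fubini_tonelli1 (m1 := lebesgue_rV n) (m2 := lebesgue_rV n) F mF F0).
Qed.

Lemma measurable_heis_section (f : mH -> \bar R) x y :
  measurable_fun setT f -> measurable_fun setT (fun tau => f (x, y, tau)).
Proof.
move=> mf; apply: (measurableT_comp mf).
apply: measurable_heis; [exact: measurable_cst|exact: measurable_cst|].
exact: measurable_id.
Qed.

Lemma measurable_heis_section2 (f : mH -> \bar R) x :
  measurable_fun setT f -> (forall eta, 0 <= f eta) ->
  measurable_fun setT
    (fun y => \int[@lebesgue_measure R]_tau f (x, y, tau)).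
Proof.
move=> mf f0.
apply: (measurable_fun_fubini_tonelli_F (m2 := @lebesgue_measure R)
  (fun p : 'rV[R]_n * measurableTypeR R => f (x, p.1, p.2))) => //.
apply: (measurableT_comp mf).
by apply: measurable_heis; [exact: measurable_cst|exact: measurable_fst|exact: measurable_snd].
Qed.

Lemma measurable_heis_section3 (f : mH -> \bar R) :
  measurable_fun setT f -> (forall eta, 0 <= f eta) ->
  measurable_fun setT
    (fun x => \int[lebesgue_rV n]_y \int[@lebesgue_measure R]_tau f (x, y, tau)).
Proof.
move=> mf f0; pose F xy := \int[@lebesgue_measure R]_tau f (xy, tau).
have mF : measurable_fun setT F.
  exact: (measurable_fun_fubini_tonelli_F (m2 := @lebesgue_measure R) f mf f0).
have F0 xy : 0 <= F xy by apply: integral_ge0.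
exact: (measurable_fun_fubini_tonelli_F (m2 := lebesgue_rV n) F mF F0).
Qed.

(** For fixed [x] and [y] a left translation shifts [tau] by an amount depending on [x] and [y].
    Integrating over [tau] first removes this shear, and plain translations in [y] and [x]
    remain. *)
Lemma haar_left_invariant xi (f : mH -> \bar R) : measurable_fun setT f ->
  (forall eta, 0 <= f eta) ->
  \int[haar]_eta f (heis_mul xi eta) = \int[haar]_eta f eta.
Proof.
move=> mf f0.
have mfx : measurable_fun [set: mH] (fun eta => f (heis_mul xi eta)).
  apply: (measurableT_comp mf).
  by apply: measurable_heis_mul; [exact: measurable_cst|exact: measurable_id].
rewrite (haar_integralE mf f0) (haar_integralE mfx (fun=> f0 _)).
transitivity (\int[lebesgue_rV n]_x \int[lebesgue_rV n]_y
    \int[@lebesgue_measure R]_tau f (xi.1.1 + x, xi.1.2 + y, tau)%R).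
  apply: eq_integral => x _; apply: eq_integral => y _.
  have := ge0_integral_affine (xi.2 + 2 * (dot xi.1.1 y - dot x xi.1.2))%R
    (oner_neq0 R) (measurable_heis_section (xi.1.1 + x)%R (xi.1.2 + y)%R mf)
    (fun tau => f0 _).
  rewrite normr1 invr1 mul1e => <-; apply: eq_integral => tau _.
  by rewrite /heis_mul/= mul1r addrCA addrA.
transitivity (\int[lebesgue_rV n]_x \int[lebesgue_rV n]_y
    \int[@lebesgue_measure R]_tau f (xi.1.1 + x, y, tau)%R).
  apply: eq_integral => x _.
  have := ge0_integral_affine_rV xi.1.2 ltr01
    (measurable_heis_section2 (xi.1.1 + x)%R mf f0)
    (fun y => integral_ge0 _ (fun tau _ => f0 _)).
  rewrite expr1n invr1 mul1e => <-; apply: eq_integral => y _.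
  by rewrite (_ : 1 *: y + xi.1.2 = xi.1.2 + y)%R// scale1r addrC.
have := ge0_integral_affine_rV xi.1.1 ltr01
  (measurable_heis_section3 mf f0)
  (fun x => integral_ge0 _ (fun y _ => integral_ge0 _ (fun tau _ => f0 _))).
rewrite expr1n invr1 mul1e => <-; apply: eq_integral => x _.
by rewrite (_ : 1 *: x + xi.1.1 = xi.1.1 + x)%R// scale1r addrC.
Qed.

(** The Jacobian collects [r ^ 2] from [tau] and [r ^ n] from each of [x] and [y]; the exponent
    [2 * n.+1] is the homogeneous dimension [Q]. *)
Lemma haar_dilate (r : R) (f : mH -> \bar R) : (0 < r)%R ->
  measurable_fun setT f -> (forall eta, 0 <= f eta) ->
  \int[haar]_eta f (heis_dilate r eta) =
  ((r ^+ (2 * n.+1))^-1)%:E * \int[haar]_eta f eta.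
Proof.
move=> r0 mf f0.
have mfx : measurable_fun [set: mH] (fun eta => f (heis_dilate r eta)).
  apply: (measurableT_comp mf).
  by apply: measurable_heis_dilate; [exact: measurable_cst|exact: measurable_id].
have r20 : (0 < r ^+ 2)%R by rewrite exprn_gt0.
have rn0 : (0 < r ^+ n)%R by rewrite exprn_gt0.
have r2N0 : (r ^+ 2 != 0)%R by rewrite gt_eqF.
rewrite (haar_integralE mf f0) (haar_integralE mfx (fun=> f0 _)).
pose F1 x y := \int[@lebesgue_measure R]_tau f (x, y, tau).
pose F2 x := \int[lebesgue_rV n]_y F1 x y.
have F10 x y : 0 <= F1 x y by apply: integral_ge0.
have F20 x : 0 <= F2 x by apply: integral_ge0.
transitivity (\int[lebesgue_rV n]_x \int[lebesgue_rV n]_y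
    (((r ^+ 2)^-1)%:E * F1 (r *: x)%R (r *: y)%R)).
  apply: eq_integral => x _; apply: eq_integral => y _.
  have := ge0_integral_affine 0%R r2N0
    (measurable_heis_section (r *: x)%R (r *: y)%R mf) (fun tau => f0 _).
  rewrite gtr0_norm// => <-; apply: eq_integral => tau _.
  by rewrite addr0.
transitivity (\int[lebesgue_rV n]_x
    (((r ^+ 2)^-1)%:E * (((r ^+ n)^-1)%:E * F2 (r *: x)%R))).
  apply: eq_integral => x _.
  have := ge0_integral_affine_rV 0%R r0
    (measurable_heis_section2 (r *: x)%R mf f0) (F10 _).
  move=> <-; rewrite -ge0_integralZl.
  - by apply: eq_integral => y _; rewrite addr0.
  - exact: measurableT.
  - apply: (measurableT_comp (measurable_heis_section2 (r *: x)%R mf f0)).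
    exact: measurable_affine_rV.
  - by move=> y _; exact: F10.
  - by rewrite lee_fin invr_ge0 ltW.
under eq_integral do rewrite muleA -EFinM.
have mF2 := measurable_heis_section3 mf f0.
rewrite ge0_integralZl; last 4 first.
- exact: measurableT.
- apply: (measurableT_comp mF2).
  by apply: measurable_rVZ; [exact: measurable_cst|exact: measurable_id].
- by move=> x _; exact: F20.
- by rewrite lee_fin mulr_ge0// invr_ge0 ltW.
have -> : \int[lebesgue_rV n]_x F2 (r *: x)%R =
    ((r ^+ n)^-1)%:E * \int[lebesgue_rV n]_x F2 x.
  rewrite -(ge0_integral_affine_rV 0%R r0 mF2 F20).
  by apply: eq_integral => x _; rewrite addr0.
rewrite muleA -EFinM; congr (_%:E * _).
by rewrite -!invfM -!exprD; congr ((r ^+ _)^-1)%R; lia.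
Qed.

End haar_integral.

(** * Sequential criteria and measurability of continuous functions *)

Section sequences.
Context {R : realType}.

(** A failure of [P] at every radius [1 / (k + 1)] would yield a convergent sequence avoiding [P].
    As [P] has to hold only once along each sequence, sequential limit theorems such as dominated
    convergence and Riesz-Scheffe can prove statements about filters. *)
Lemma near_seq (T : pseudoMetricType R) (x : T) (P : set T) :
  (forall u : nat -> T, u k @[k --> \oo] --> x -> exists k, P (u k)) ->
  nbhs x P.
Proof.
move=> H; apply: contrapT => nP.
have /choice[u uP] (k : nat) : exists y, ball x k.+1%:R^-1 y /\ ~ P y.
  apply: contrapT => /forallNP nk; apply: nP; apply/nbhs_ballP.
  exists k.+1%:R^-1 => /=; first by rewrite invr_gt0.
  by move=> y xy; apply: contrapT => nPy; exact: (nk y).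
have [|k Pk] := H u; last exact: (uP k).2.
apply/cvg_ballP => e e0.
have := near_infty_natSinv_lt (PosNum e0); apply: filterS => k ke.
by apply: le_ball (ltW ke) _ _; exact: (uP k).1.
Qed.

(** The counterpart of [near_seq] at infinity, for functions that vanish there. *)
Lemma bounded_seq (V : normedModType R) (P : set V) :
  (forall u : nat -> V, (forall k, k%:R < `|u k|) -> exists k, P (u k)) ->
  exists N : R, forall x, N < `|x| -> P x.
Proof.
move=> H; apply: contrapT => /forallNP nP.
have /choice[u uP] (k : nat) : exists y, k%:R < `|y| /\ ~ P y.
  apply: contrapT => /forallNP nk; apply: (nP k%:R) => x kx.
  by apply: contrapT => nPx; exact: (nk x).
have [|k Pk] := H u; last exact: (uP k).2.
by move=> k; exact: (uP k).1.
Qed.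

End sequences.

Lemma cvg_compose (T : Type) (U V : topologicalType) (h : U -> V)
    (F : set_system T) {FF : Filter F} (f : T -> U) (a : U) :
  continuous_at a h -> f @ F --> a -> h (f t) @[t --> F] --> h a.
Proof. by move=> ch fa; exact: (continuous_cvg FF ch fa). Qed.

Section rV_continuity.
Context {R : realType}.

Lemma cvg_rV n (T : Type) (F : set_system T) {FF : Filter F} (f : T -> 'rV[R]_n)
    (l : 'rV[R]_n) :
  (forall i, f t ord0 i @[t --> F] --> l ord0 i) -> f @ F --> l.
Proof.
move=> fl; apply/cvg_ballP => e e0; rewrite near_map.
have : \forall t \near F, forall i, ball (l ord0 i) e (f t ord0 i).
  by apply: filter_forall => i; move/cvg_ballP : (fl i); exact.
by apply: filterS => t H; split=> // i j; rewrite (ord1 i); exact: H.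
Qed.

Lemma cvg_rV_coord n (T : Type) (F : set_system T) {FF : Filter F}
    (f : T -> 'rV[R]_n) (l : 'rV[R]_n) i :
  f @ F --> l -> f t ord0 i @[t --> F] --> l ord0 i.
Proof.
move=> fl; exact: (cvg_compose (h := fun v : 'rV[R]_n => v ord0 i)
  (@coord_continuous _ _ _ _ _ _) fl).
Qed.

Lemma cvg_sum_seq (T I : Type) (F : set_system T) {FF : Filter F} (s : seq I)
    (f : T -> I -> R) (l : I -> R) :
  (forall i, f t i @[t --> F] --> l i) ->
  \sum_(i <- s) f t i @[t --> F] --> \sum_(i <- s) l i.
Proof.
move=> fl; elim: s => [|i s IH].
  by under eq_cvg do rewrite big_nil; rewrite big_nil; exact: cvg_cst.
by under eq_cvg do rewrite big_cons; rewrite big_cons; exact: cvgD.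
Qed.

Lemma cvg_dot n (T : Type) (F : set_system T) {FF : Filter F}
    (f g : T -> 'rV[R]_n) (x y : 'rV[R]_n) :
  f @ F --> x -> g @ F --> y -> dot (f t) (g t) @[t --> F] --> dot x y.
Proof.
move=> fx gy; apply: cvg_sum_seq => i.
by apply: cvgM; exact: cvg_rV_coord.
Qed.

Lemma rV_cons_coordE n (a : R) (v : 'rV[R]_n) i :
  rV_cons (a, v) ord0 i = if @fintype.split 1 n i is inr j then v ord0 j else a.
Proof.
rewrite /rV_cons; case: (@split_ordP 1 n i) => j ->.
  by apply: (etrans (@row_mxEl R 1 1 n _ _ ord0 j)); rewrite mxE.
exact: (@row_mxEr R 1 1 n _ _ ord0 j).
Qed.

Lemma rV_cons_continuousl n (v : 'rV[R]_n) :
  continuous (fun a : R => rV_cons (a, v)).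
Proof.
move=> a; apply: cvg_rV => i; under eq_cvg do rewrite rV_cons_coordE.
by rewrite rV_cons_coordE; case: (@fintype.split 1 n i) => j; [exact: cvg_id|exact: cvg_cst].
Qed.

Lemma rV_cons_continuousr n (a : R) :
  continuous (fun v : 'rV[R]_n => rV_cons (a, v)).
Proof.
move=> v; apply: (@cvg_rV _ _ (nbhs v) (nbhs_filter v)) => i; under eq_cvg do rewrite rV_cons_coordE.
rewrite rV_cons_coordE; case: (@fintype.split 1 n i) => j; first exact: cvg_cst.
exact: coord_continuous.
Qed.

End rV_continuity.

Section caratheodory.
Context {R : realType}.

Let grid (k : nat) (t : R) : R := (Num.floor (t * k.+1%:R))%:~R / k.+1%:R.

Let grid_cvg t : grid k t @[k --> \oo] --> t.
Proof.
apply/cvgrPdist_lt => e e0.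
have := near_infty_natSinv_lt (PosNum e0); apply: filterS => k /= ke.
have k0 : 0 < k.+1%:R :> R by [].
apply: le_lt_trans ke; rewrite /grid.
have -> : t - (Num.floor (t * k.+1%:R))%:~R / k.+1%:R =
    (t * k.+1%:R - (Num.floor (t * k.+1%:R))%:~R) / k.+1%:R.
  by field; rewrite gt_eqF.
have /andP[fl fu] := floor_itv (t * k.+1%:R).
rewrite ger0_norm; last by rewrite divr_ge0// subr_ge0.
by rewrite ler_pdivrMr// mulVf ?gt_eqF// lerBlDr addrC -intrD1 ltW.
Qed.

(** [f (t, x)] is the limit of its values at [t] rounded down to the grid of step [1 / (k + 1)], and
    each of these is, strip by strip in [t], a function of [x] alone. *)
Lemma caratheodory_measurable d (X : measurableType d)
    (f : measurableTypeR R * X -> R) :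
  (forall x, continuous ((fun t : R => f (t, x)) : R -> R)) ->
  (forall t, measurable_fun setT (fun x => f (t, x))) ->
  measurable_fun setT f.
Proof.
move=> cf mf.
apply: (@measurable_fun_cvg _ _ R _ (fun k p => f (grid k p.1, p.2))); last first.
  move=> [t x] _; exact: (cvg_compose (h := fun s : R => f (s, x)) (cf x t) (@grid_cvg t)).
move=> k _ Y mY; rewrite setTI.
rewrite (_ : _ @^-1` _ = \bigcup_(m : int)
  (((fun t : measurableTypeR R => Num.floor (t * k.+1%:R)) @^-1` [set m]) `*`
   ((fun x => f (m%:~R / k.+1%:R, x)) @^-1` Y))).
  apply: countable_bigcupT_measurable; first exact: countableP.
  move=> m; apply: measurableX; last by rewrite -[X in measurable X]setTI; exact: mf.
  have k0 : 0 < k.+1%:R :> R by [].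
  rewrite (_ : _ @^-1` _ = `[m%:~R / k.+1%:R, (m + 1)%:~R / k.+1%:R[%classic).
    exact: measurable_itv.
  apply/seteqP; split => t /=; rewrite in_itv/= ler_pdivrMr// ltr_pdivlMr//.
    by move=> <-; exact: floor_itv.
  exact: floor_def.
apply/seteqP; split => [[t x] /= Yf|[t x] [m _ [/= tm]]].
  by exists (Num.floor (t * k.+1%:R)).
by rewrite /grid tm.
Qed.

(** The first coordinate is handled by the one-dimensional case, with the other coordinates as part
    of the parameter; these are handled by induction. *)
Lemma caratheodory_rV_measurable n d (X : measurableType d)
    (f : 'rV[R]_n * X -> R) :
  (forall x, continuous (fun v => f (v, x))) ->
  (forall v, measurable_fun setT (fun x => f (v, x))) ->
  measurable_fun setT f.
Proof.
elim: n d X f => [|n IH] d X f cf mf.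
  rewrite (_ : f = (fun x => f (0, x)) \o snd).
    by apply: (measurableT_comp (mf 0)); exact: measurable_snd.
  by apply/funext => -[v x] /=; congr (f (_, x)); apply/matrixP => i; case.
pose g (p : measurableTypeR R * ('rV[R]_n * X)) := f (rV_cons (p.1, p.2.1), p.2.2).
have mg : measurable_fun setT g.
  apply: caratheodory_measurable.
    move=> [v x] a; rewrite /g/=.
    exact: (cvg_compose (h := fun w => f (w, x)) (cf x _) (@rV_cons_continuousl _ _ _ _)).
  move=> a; apply: (IH _ _ (fun p => g (a, p))).
    move=> x v; rewrite /g/=.
    exact: (cvg_compose (h := fun w => f (w, x)) (cf x _) (@rV_cons_continuousr _ _ _ _)).
  by move=> v; rewrite /g/=; exact: mf.
have mu := @measurable_rV_uncons R n.
rewrite (_ : f = g \o (fun p => ((rV_uncons p.1).1, ((rV_uncons p.1).2, p.2)))).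
  apply: (measurableT_comp mg).
  have mu1 : measurable_fun [set: 'rV[R]_n.+1 * X] (fun p => rV_uncons p.1).
    by apply: (measurableT_comp mu); exact: measurable_fst.
  apply: measurable_fun_pair.
    by apply: (measurableT_comp measurable_fst); exact: mu1.
  apply: measurable_fun_pair; last exact: measurable_snd.
  by apply: (measurableT_comp measurable_snd); exact: mu1.
apply/funext => -[v x]; rewrite /g/=; congr (f (_, x)).
exact: (esym (rV_unconsK v)).
Qed.

End caratheodory.

Section heis_continuity.
Context {R : realType} {n : nat}.
Local Notation mH := ('rV[R]_n * 'rV[R]_n * measurableTypeR R)%type.

Lemma cvg_heis (T : Type) (F : set_system T) {FF : Filter F} (f : T -> heis R n)
    (l : heis R n) :
  (f t).1.1 @[t --> F] --> l.1.1 -> (f t).1.2 @[t --> F] --> l.1.2 ->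
  (f t).2 @[t --> F] --> l.2 -> f @ F --> l.
Proof.
case: l => -[x y] tau /= fx fy ft.
rewrite (_ : f = fun t => (((f t).1.1, (f t).1.2), (f t).2)).
  apply: (cvg_pair (G := nbhs (x, y)) (H := nbhs tau)) => //.
  exact: (cvg_pair (G := nbhs x) (H := nbhs y)).
by apply/funext => t; case: (f t) => -[].
Qed.

Lemma cvg_heis_coord (T : Type) (F : set_system T) {FF : Filter F}
    (f : T -> heis R n) (l : heis R n) : f @ F --> l ->
  [/\ (f t).1.1 @[t --> F] --> l.1.1, (f t).1.2 @[t --> F] --> l.1.2 &
      (f t).2 @[t --> F] --> l.2].
Proof.
have cfst (U V : topologicalType) (p : U * V) : continuous_at p fst.
  by case: p => a b; exact: cvg_fst.
have csnd (U V : topologicalType) (p : U * V) : continuous_at p snd.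
  by case: p => a b; exact: cvg_snd.
move=> fl; have f1 : (f t).1 @[t --> F] --> l.1 by exact: (cvg_compose (cfst _ _ _) fl).
by split; [exact: (cvg_compose (cfst _ _ _) f1)|exact: (cvg_compose (csnd _ _ _) f1)|
  exact: (cvg_compose (csnd _ _ _) fl)].
Qed.

Lemma cvg_heis_mul (T : Type) (F : set_system T) {FF : Filter F}
    (f g : T -> heis R n) (xi eta : heis R n) :
  f @ F --> xi -> g @ F --> eta ->
  heis_mul (f t) (g t) @[t --> F] --> heis_mul xi eta.
Proof.
move=> fx ge.
have [f1 f2 f3] := cvg_heis_coord fx; have [g1 g2 g3] := cvg_heis_coord ge.
apply: cvg_heis; rewrite /heis_mul/=; [exact: cvgD|exact: cvgD|].
apply: cvgD; first exact: cvgD.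
by apply: cvgM; [exact: cvg_cst|apply: cvgB; exact: cvg_dot].
Qed.

Lemma cvg_heis_dilate (T : Type) (F : set_system T) {FF : Filter F} (r : R)
    (f : T -> heis R n) (xi : heis R n) :
  f @ F --> xi -> heis_dilate r (f t) @[t --> F] --> heis_dilate r xi.
Proof.
move=> fx.
have [f1 f2 f3] := cvg_heis_coord fx.
apply: cvg_heis; rewrite /heis_dilate/=; [exact: cvgZr|exact: cvgZr|].
by apply: cvgM => //; exact: cvg_cst.
Qed.

(** The sigma-algebra is generated by the coordinates, while continuity refers to the norm topology.
    The bridge is separate continuity in [x], in [y] and in [tau]: two Caratheodory arguments, then
    the one-dimensional case. *)
Lemma continuous_heis_measurable (f : heis R n -> R) :
  continuous f -> measurable_fun [set: mH] f.
Proof.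
move=> cf.
pose g (p : 'rV[R]_n * ('rV[R]_n * measurableTypeR R)) := f (p.1, p.2.1, p.2.2).
have mg : measurable_fun setT g.
  apply: caratheodory_rV_measurable.
    move=> [y tau] x; rewrite /g/=.
    have h : ((v, y, tau) : heis R n) @[v --> x] --> ((x, y, tau) : heis R n).
      by apply: (@cvg_heis _ (nbhs x) (nbhs_filter x)); [exact: cvg_id|exact: cvg_cst|exact: cvg_cst].
    exact: (cvg_compose (cf _) h).
  move=> x; apply: (caratheodory_rV_measurable (f := fun p => g (x, p))).
    move=> tau y; rewrite /g/=.
    have h : ((x, v, tau) : heis R n) @[v --> y] --> ((x, y, tau) : heis R n).
      by apply: (@cvg_heis _ (nbhs y) (nbhs_filter y)); [exact: cvg_cst|exact: cvg_id|exact: cvg_cst].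
    exact: (cvg_compose (cf _) h).
  move=> y; rewrite /g/=; apply: continuous_measurable_fun => tau.
  have h : ((x, y, v) : heis R n) @[v --> tau] --> ((x, y, tau) : heis R n).
    by apply: (@cvg_heis _ (nbhs tau) (nbhs_filter _)); [exact: cvg_cst|exact: cvg_cst|exact: cvg_id].
  exact: (cvg_compose (cf _) h).
rewrite (_ : f = g \o (fun p : mH => (p.1.1, (p.1.2, p.2)))).
  apply: (measurableT_comp mg); apply: measurable_fun_pair.
    by apply: (measurableT_comp measurable_fst); exact: measurable_fst.
  apply: measurable_fun_pair; last exact: measurable_snd.
  by apply: (measurableT_comp measurable_snd); exact: measurable_fst.
by apply/funext => -[[x y] tau].
Qed.

End heis_continuity.

(** * The group law and the dilations *)

Section heis_group.
Context {R : realType} {n : nat}.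
Implicit Types (x y z : 'rV[R]_n) (xi eta zeta : heis R n).

Lemma dotC x y : dot x y = dot y x.
Proof. by apply: eq_bigr => i _; rewrite mulrC. Qed.

Lemma dotDl x y z : dot (x + y) z = dot x z + dot y z.
Proof. by rewrite -big_split; apply: eq_bigr => i _; rewrite mxE mulrDl. Qed.

Lemma dotNl x y : dot (- x) y = - dot x y.
Proof. by rewrite -sumrN; apply: eq_bigr => i _; rewrite mxE mulNr. Qed.

Lemma dotDr x y z : dot x (y + z) = dot x y + dot x z.
Proof. by rewrite dotC dotDl !(dotC x). Qed.

Lemma dotNr x y : dot x (- y) = - dot x y.
Proof. by rewrite dotC dotNl dotC. Qed.

Lemma dot0l x : dot 0 x = 0.
Proof. by rewrite /dot big1// => i _; rewrite mxE mul0r. Qed.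

Lemma dot0r x : dot x 0 = 0. Proof. by rewrite dotC dot0l. Qed.

Lemma heis_mulA xi eta zeta :
  heis_mul xi (heis_mul eta zeta) = heis_mul (heis_mul xi eta) zeta.
Proof.
rewrite /heis_mul/=; congr (_, _, _); rewrite ?addrA//.
by rewrite !dotDl !dotDr; ring.
Qed.

Lemma heis_mul0 xi : heis_mul xi 0 = xi.
Proof.
case: xi => -[x y] tau; rewrite /heis_mul/= !addr0.
by rewrite dot0l dot0r subrr mulr0 addr0.
Qed.

Lemma heis_0mul xi : heis_mul 0 xi = xi.
Proof.
case: xi => -[x y] tau; rewrite /heis_mul/= !add0r.
by rewrite dot0l dot0r subrr mulr0 addr0.
Qed.

Lemma heis_mulVKl xi eta : heis_mul (heis_inv xi) (heis_mul xi eta) = eta.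
Proof.
rewrite heis_mulA -[RHS]heis_0mul; congr heis_mul.
rewrite /heis_mul/heis_inv/= !addNr dotNl dotNr (dotC xi.1.1).
by rewrite addrN mulr0 addr0.
Qed.

Lemma heis_mulKVl xi eta : heis_mul xi (heis_mul (heis_inv xi) eta) = eta.
Proof.
rewrite heis_mulA -[RHS]heis_0mul; congr heis_mul.
rewrite /heis_mul/heis_inv/= !addrN dotNl dotNr (dotC xi.1.1).
by rewrite addrN mulr0 addr0.
Qed.

Lemma heis_mulKVr xi eta : heis_mul (heis_mul xi eta) (heis_inv eta) = xi.
Proof.
rewrite -heis_mulA -[RHS]heis_mul0; congr heis_mul.
rewrite /heis_mul/heis_inv/= !addrN dotNl dotNr (dotC eta.1.1).
by rewrite addrN mulr0 addr0.
Qed.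

Lemma heis_invM xi eta :
  heis_inv (heis_mul xi eta) = heis_mul (heis_inv eta) (heis_inv xi).
Proof.
rewrite /heis_mul/heis_inv/=; congr (_, _, _); rewrite ?opprD 1?addrC//.
rewrite !dotNl !dotNr !opprK (dotC eta.1.1) (dotC xi.1.1 eta.1.2); ring.
Qed.

Lemma heis_invK xi : heis_inv (heis_inv xi) = xi.
Proof. by case: xi => -[x y] tau; rewrite /heis_inv/= !opprK. Qed.

Lemma heis_dilate1 xi : heis_dilate 1 xi = xi.
Proof.
by case: xi => -[x y] tau; rewrite /heis_dilate/= !scale1r expr1n mul1r.
Qed.

Lemma heis_dilateK (r : R) xi : r != 0 ->
  heis_dilate r^-1 (heis_dilate r xi) = xi.
Proof.
move=> r0; case: xi => -[x y] tau; rewrite /heis_dilate/=.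
by rewrite !scalerA mulrA -exprMn mulVf// !scale1r expr1n mul1r.
Qed.

End heis_group.

(** * Continuity of Schwartz functions *)

Section schwartz_continuity.
Context {R : realType} {n : nat}.
Implicit Types (xi eta zeta v : heis R n).

(** A bound on the derivative along [v] (the seminorm with [k = 0]) is a Lipschitz constant, by the
    mean value theorem on the line through [eta] in direction [v]. *)
Lemma schwartz_lipschitz (g : heis R n -> R) v : schwartz g ->
  coordinate_dir v ->
  exists C : R, forall eta s, `|g (eta + s *: v) - g eta| <= C * `|s|.
Proof.
move=> gS vc.
have [|dg _] := gS [::]; first by [].
have [|_ /(_ 0%N)[C gC]] := gS [:: v]; first by move=> w; rewrite inE => /eqP ->.
exists C => eta s.
have dC zeta : `|'D_v g zeta| <= C by have := gC zeta; rewrite expr0 mul1r.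
pose phi (r : R) := g (eta + r *: v).
have dphi (r : R) : is_derive r 1 phi ('D_v g (eta + r *: v)).
  have E : (fun h : R => h^-1 *: ((phi \o shift r) (h *: (1 : R)) - phi r)) =
      (fun h : R => h^-1 *: ((g \o shift (eta + r *: v)) (h *: v) - g (eta + r *: v))).
    apply/funext => h; rewrite /phi/=; congr (_ *: (g _ - _)).
    by rewrite scalerDl addrCA [h%:A]mulr1.
  have d1 : derivable phi r 1 by rewrite /derivable E; exact: dg.
  by apply: DeriveDef => //; rewrite /derive E.
have cphi : continuous phi.
  by move=> r; apply: differentiable_continuous; apply/derivable1_diffP.
have phi0 : phi 0 = g eta by rewrite /phi scale0r addr0.
rewrite -phi0 -/(phi s).
have [s0|s0|<-] := ltgtP 0 s; last by rewrite subrr !normr0 mulr0.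
- have [c _ ->] := MVT s0 (fun x _ => dphi x) (continuous_subspaceT cphi).
  by rewrite normrM subr0 ler_wpM2r.
- have [c _ E] := MVT s0 (fun x _ => dphi x) (continuous_subspaceT cphi).
  by rewrite distrC E normrM sub0r normrN ler_wpM2r.
Qed.

Lemma sum_lipschitz (g : heis R n -> R) (I : Type) (l : seq I)
    (v : I -> heis R n) (C a : I -> R) :
  (forall i eta s, `|g (eta + s *: v i) - g eta| <= C i * `|s|) ->
  forall eta, `|g (eta + \sum_(i <- l) a i *: v i) - g eta| <=
    \sum_(i <- l) C i * `|a i|.
Proof.
move=> gC eta; elim: l => [|i l IH]; first by rewrite !big_nil addr0 subrr normr0.
rewrite !big_cons; set S := \sum_(j <- l) _ in IH *.
have -> : eta + (a i *: v i + S) = eta + S + a i *: v i by rewrite addrCA addrC.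
set z := eta + S in IH *.
have -> : g (z + a i *: v i) - g eta = (g (z + a i *: v i) - g z) + (g z - g eta).
  by rewrite addrA subrK.
by apply: le_trans (ler_normD _ _) _; exact: lerD.
Qed.

(** [schwartz] provides directional derivatives, whose mere existence does not imply continuity;
    their boundedness does. The increment is split along a path that changes [x], then [y], then
    [tau]. *)
Lemma schwartz_continuous (g : heis R n -> R) : schwartz g -> continuous g.
Proof.
move=> gS eta.
have /choice[C1 gC1] (i : 'I_n) : exists c : R, forall eta s,
    `|g (eta + s *: dir_x i) - g eta| <= c * `|s|.
  by apply: schwartz_lipschitz => //; left; exists i.
have /choice[C2 gC2] (i : 'I_n) : exists c : R, forall eta s,
    `|g (eta + s *: dir_y i) - g eta| <= c * `|s|.
  by apply: schwartz_lipschitz => //; right; left; exists i.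
have [C3 gC3] : exists C3 : R, forall eta s,
    `|g (eta + s *: dir_tau) - g eta| <= C3 * `|s|.
  by apply: schwartz_lipschitz => //; right; right.
pose B zeta := \sum_i C1 i * `|(zeta.1.1 - eta.1.1) ord0 i| +
   \sum_i C2 i * `|(zeta.1.2 - eta.1.2) ord0 i| + C3 * `|zeta.2 - eta.2|.
have gB zeta : `|g eta - g zeta| <= B zeta.
  pose a1 i := (zeta.1.1 - eta.1.1) ord0 i.
  pose a2 i := (zeta.1.2 - eta.1.2) ord0 i.
  pose z1 := eta + \sum_i a1 i *: dir_x i.
  pose z2 := z1 + \sum_i a2 i *: dir_y i.
  have zE : zeta = z2 + (zeta.2 - eta.2) *: dir_tau.
    have S1 (x : 'rV[R]_n) : \sum_i x ord0 i *: dir_x i = ((x, 0, 0) : heis R n).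
      transitivity (((\sum_i x ord0 i *: delta_mx ord0 i : 'rV[R]_n), 0, 0) : heis R n).
        rewrite (big_morph (fun x : 'rV[R]_n => (x, 0, 0) : heis R n)
          (id1 := 0) (op1 := +%R))//.
          by apply: eq_bigr => i _; rewrite /dir_x; congr (_, _, _); rewrite ?scaler0.
        by move=> u w; congr (_, _, _); rewrite addr0.
      by rewrite -row_sum_delta.
    have S2 (x : 'rV[R]_n) : \sum_i x ord0 i *: dir_y i = ((0, x, 0) : heis R n).
      transitivity ((0, (\sum_i x ord0 i *: delta_mx ord0 i : 'rV[R]_n), 0) : heis R n).
        rewrite (big_morph (fun x : 'rV[R]_n => (0, x, 0) : heis R n)
          (id1 := 0) (op1 := +%R))//.
          by apply: eq_bigr => i _; rewrite /dir_y; congr (_, _, _); rewrite ?scaler0.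
        by move=> u w; congr (_, _, _); rewrite addr0.
      by rewrite -row_sum_delta.
    rewrite /z2 /z1 S1 S2; clear; case: zeta eta => -[x y] t [[x' y'] t'].
    congr (_, _, _) => /=; rewrite ?scaler0 ?addr0.
    - by rewrite addrC subrK.
    - by rewrite addrC subrK.
    - by rewrite [_%:A]mulr1 addrC subrK.
  rewrite distrC.
  have -> : g zeta - g eta = (g z1 - g eta) + (g z2 - g z1) + (g zeta - g z2).
    by ring.
  apply: le_trans (ler_normD _ _) _; apply: lerD; last by rewrite {1}zE.
  apply: le_trans (ler_normD _ _) _; apply: lerD; exact: sum_lipschitz.
have Bc : B zeta @[zeta --> eta] --> B eta.
  have [e1 e2 e3] : [/\ zeta.1.1 @[zeta --> eta] --> eta.1.1,
      zeta.1.2 @[zeta --> eta] --> eta.1.2 & zeta.2 @[zeta --> eta] --> eta.2].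
    by apply: (@cvg_heis_coord _ _ _ (nbhs eta) (nbhs_filter eta) id); exact: cvg_id.
  have c1 (i : 'I_n) : (zeta.1.1 - eta.1.1) ord0 i @[zeta --> eta] --> (eta.1.1 - eta.1.1) ord0 i.
    by apply: cvg_rV_coord; apply: cvgB => //; exact: cvg_cst.
  have c2 (i : 'I_n) : (zeta.1.2 - eta.1.2) ord0 i @[zeta --> eta] --> (eta.1.2 - eta.1.2) ord0 i.
    by apply: cvg_rV_coord; apply: cvgB => //; exact: cvg_cst.
  apply: cvgD; last first.
    by apply: cvgM; [exact: cvg_cst|apply: cvg_norm; apply: cvgB => //; exact: cvg_cst].
  apply: cvgD; apply: (@cvg_sum_seq _ _ _ (nbhs eta) (nbhs_filter eta)) => i.
    by apply: cvgM; [exact: cvg_cst|apply: cvg_norm].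
  by apply: cvgM; [exact: cvg_cst|apply: cvg_norm].
have B0 : B eta = 0.
  rewrite /B !subrr normr0 mulr0 addr0 !big1 ?addr0// => i _;
  by rewrite mxE normr0 mulr0.
rewrite B0 in Bc.
apply/cvgrPdist_lt => e e0.
move/cvgrPdist_lt : Bc => /(_ e e0); apply: filterS => zeta.
rewrite sub0r normrN => Be; apply: le_lt_trans (gB zeta) _.
exact: le_lt_trans (ler_norm _) Be.
Qed.

End schwartz_continuity.

(** * The heat kernel *)

Section heat_kernel.
Context {R : realType} {n : nat}.
Local Notation mH := ('rV[R]_n * 'rV[R]_n * measurableTypeR R)%type.
Variables (h : R -> heis R n -> R) (hh : is_heat_kernel h).
Implicit Types (xi eta zeta : heis R n) (s t : R).

(** The transition density of the heat flow, cut off for [t <= 0], where [h t] is unconstrained. *)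
Definition heat_trans t xi eta : R :=
  if 0 < t then h t (heis_mul (heis_inv xi) eta) else 0.

Let profile : exists2 g, schwartz g & forall t eta, 0 < t ->
  h t eta = (t ^+ n.+1)^-1 * g (heis_dilate (Num.sqrt t)^-1 eta).
Proof. exact: heat_kernel_scaling. Qed.

Lemma heat_kernel_profile t eta : 0 < t ->
  h t eta = (t ^+ n.+1)^-1 * h 1 (heis_dilate (Num.sqrt t)^-1 eta).
Proof.
have [g _ hg] := profile => t0.
by rewrite !hg// sqrtr1 invr1 heis_dilate1 expr1n invr1 mul1r.
Qed.

Lemma heat_kernel1_continuous : continuous (h 1).
Proof.
have [g gS hg] := profile.
rewrite (_ : h 1 = g); first exact: schwartz_continuous.
by apply/funext => eta; rewrite hg// sqrtr1 invr1 heis_dilate1 expr1n invr1 mul1r.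
Qed.

(** The Schwartz seminorm with weight [1 + |eta|] dominates both quantities, and it is positive
    because [h 1] is positive at 0. *)
Lemma heat_kernel1_decay : exists2 C : R, 0 < C & forall eta,
  h 1 eta <= C /\ `|eta| * h 1 eta <= C.
Proof.
have [g gS hg] := profile.
have g1 eta : h 1 eta = g eta.
  by rewrite hg// sqrtr1 invr1 heis_dilate1 expr1n invr1 mul1r.
have [|_ /(_ 1%N)[C gC]] := gS [::]; first by [].
have C0 : 0 < C.
  apply: lt_le_trans (gC 0); rewrite normr0 addr0 expr1n mul1r /= -g1.
  by rewrite normr_gt0 gt_eqF// heat_kernel_gt0.
exists C => // eta; have := gC eta; rewrite expr1 /= -g1.
rewrite gtr0_norm ?heat_kernel_gt0// mulrDl mul1r => gCe.
have h0 : 0 <= h 1 eta by rewrite ltW// heat_kernel_gt0.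
by split; apply: le_trans gCe; rewrite ?lerDl ?lerDr// mulr_ge0.
Qed.

Lemma heat_trans_ge0 t xi eta : 0 <= heat_trans t xi eta.
Proof. by rewrite /heat_trans; case: ifPn => // t0; rewrite ltW// heat_kernel_gt0. Qed.

Lemma heat_trans_sym t xi eta : heat_trans t xi eta = heat_trans t eta xi.
Proof.
rewrite /heat_trans; case: ifPn => // t0.
by rewrite -heat_kernel_sym// heis_invM heis_invK.
Qed.

Lemma heat_trans_bound : exists2 C : R, 0 < C & forall t xi eta, 0 < t ->
  heat_trans t xi eta <= C * t `^ (- n.+1%:R).
Proof.
have [C C0 hC] := heat_kernel1_decay; exists C => // t xi eta t0.
rewrite /heat_trans t0 heat_kernel_profile// (powR_invn _ (ltW t0)) mulrC.
by rewrite ler_pM2r ?invr_gt0 ?exprn_gt0//; exact: (hC _).1.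
Qed.

Lemma heat_trans_continuous t xi : continuous (heat_trans t xi).
Proof.
have [t0|t0] := boolP (0 < t); last first.
  rewrite (_ : heat_trans t xi = cst 0); first by move=> eta; exact: cvg_cst.
  by apply/funext => eta; rewrite /heat_trans (negbTE t0).
move=> eta.
have H : heis_mul (heis_inv xi) zeta @[zeta --> eta] --> heis_mul (heis_inv xi) eta.
  by apply: cvg_heis_mul; [exact: cvg_cst|exact: cvg_id].
have H' : heis_dilate (Num.sqrt t)^-1 (heis_mul (heis_inv xi) zeta) @[zeta --> eta]
    --> heis_dilate (Num.sqrt t)^-1 (heis_mul (heis_inv xi) eta).
  exact: cvg_heis_dilate.
rewrite (_ : heat_trans t xi = fun zeta => (t ^+ n.+1)^-1 *
    h 1 (heis_dilate (Num.sqrt t)^-1 (heis_mul (heis_inv xi) zeta))).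
  apply: cvgM; first exact: cvg_cst.
  exact: (@cvg_compose _ _ _ _ (nbhs eta) (nbhs_filter eta) _ _
    (@heat_kernel1_continuous _) H').
by apply/funext => zeta; rewrite /heat_trans t0 heat_kernel_profile.
Qed.

(** The scaling law reduces joint measurability, including in time, to the continuous profile [h 1]
    composed with a dilation whose ratio is a power of time. *)
Lemma measurable_heat_trans d (T : measurableType d) (t : T -> R) (F G : T -> mH) :
  measurable_fun setT t -> measurable_fun setT F -> measurable_fun setT G ->
  measurable_fun setT (fun x => heat_trans (t x) (F x) (G x)).
Proof.
move=> mt mF mG.
rewrite (_ : (fun _ => _) = fun x => if 0 < t x then
  (t x `^ (- n.+1%:R)) * h 1 (heis_dilate ((t x) `^ (- 2^-1))
     (heis_mul (heis_inv (F x)) (G x))) else 0); last first.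
  apply/funext => x; rewrite /heat_trans; case: ifPn => // t0.
  rewrite heat_kernel_profile// powR_invn ?ltW//; congr (_ * h 1 (heis_dilate _ _)).
  by rewrite powRN powR12_sqrt// ltW.
apply: measurable_fun_ifT.
- by apply: measurable_fun_ltr => //; exact: measurable_cst.
- apply: measurable_funM; first exact: (measurableT_comp (measurable_powR _) mt).
  apply: (measurableT_comp (continuous_heis_measurable heat_kernel1_continuous)).
  apply: measurable_heis_dilate; first exact: (measurableT_comp (measurable_powR _) mt).
  by apply: measurable_heis_mul => //; exact: measurable_heis_inv.
- exact: measurable_cst.
Qed.

Local Open Scope ereal_scope.

(** The integrals in [is_heat_kernel] are real-valued, and [fine] turns an infinite integral into 0;
    a nonzero value therefore certifies that the extended integral is finite. *)
Let fine_posE (x : \bar R) (r : R) : (r != 0)%R -> fine x = r -> x = r%:E.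
Proof. by case: x => [x| |] //= r0 E; rewrite ?E//; rewrite -E eqxx in r0. Qed.

Lemma heat_kernel_measurable t : (0 < t)%R -> measurable_fun [set: mH] (h t).
Proof.
move=> t0; rewrite (_ : h t = heat_trans t (0 : heis R n)%R); last first.
  apply/funext => eta; rewrite /heat_trans t0; congr h.
  by rewrite /heis_inv /= !oppr0 heis_0mul.
by apply: measurable_heat_trans; [exact: measurable_cst|exact: measurable_cst|exact: measurable_id].
Qed.

Lemma heat_kernel_integral t : (0 < t)%R -> \int[haar]_eta (h t eta)%:E = 1.
Proof.
by move=> t0; apply: fine_posE; [exact: oner_neq0|exact: heat_kernel_mass].
Qed.

Lemma heat_trans_mass t xi : (0 < t)%R ->
  \int[haar]_eta (heat_trans t xi eta)%:E = 1.
Proof.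
move=> t0; rewrite /heat_trans t0.
rewrite (haar_left_invariant (heis_inv xi) (f := fun eta => (h t eta)%:E)).
- exact: heat_kernel_integral.
- by apply/measurable_EFinP; exact: heat_kernel_measurable.
- by move=> eta; rewrite lee_fin ltW// heat_kernel_gt0.
Qed.

(** Left translation by [xi] turns the integral into the convolution of [h s] and [h t] at
    [xi^-1 eta]. The value is positive, so the extended integral equals it. *)
Lemma heat_trans_semigroup s t xi eta : (0 < s)%R -> (0 < t)%R ->
  \int[haar]_zeta (heat_trans s xi zeta * heat_trans t zeta eta)%:E =
  (heat_trans (s + t) xi eta)%:E.
Proof.
move=> s0 t0; rewrite /heat_trans s0 t0 addr_gt0//.
pose f zeta := (h s zeta *
   h t (heis_mul (heis_inv zeta) (heis_mul (heis_inv xi) eta)))%:E.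
transitivity (\int[haar]_zeta f (heis_mul (heis_inv xi) zeta)).
  apply: eq_integral => zeta _; rewrite /f; congr (_ * h t _)%:E.
  by rewrite heis_invM heis_invK -heis_mulA heis_mulKVl.
rewrite haar_left_invariant.
- apply: fine_posE; last exact: heat_kernel_semigroup.
  by rewrite gt_eqF// heat_kernel_gt0// addr_gt0.
- apply/measurable_EFinP; apply: measurable_funM.
    exact: heat_kernel_measurable.
  apply: (measurableT_comp (heat_kernel_measurable t0)).
  apply: measurable_heis_mul; last exact: measurable_cst.
  by apply: measurable_heis_inv; exact: measurable_id.
- by move=> zeta; rewrite lee_fin mulr_ge0// ltW// heat_kernel_gt0.
Qed.

(** The norm is not homogeneous under dilations, but [tau] is scaled by [r ^ 2], which is at most
    [r] here. *)
Lemma heis_dilate_norm (r : R) zeta : (0 <= r <= 1)%R ->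
  (`|heis_dilate r zeta| <= r * `|zeta|)%R.
Proof.
move=> /andP[r0 r1]; case: zeta => -[x y] tau.
rewrite /heis_dilate [`|(_ *: _, _, _)|%R]prod_normE [`|(_ *: _, _)|%R]prod_normE /=.
rewrite prod_normE /= prod_normE /= !normrZ; set N := Num.max (Num.max `|x| `|y|)%R `|tau|%R.
have H (a : R) : (a <= N)%R -> (r * a <= r * N)%R by exact: ler_wpM2l.
rewrite (ger0_norm r0) !ge_max -andbA; apply/and3P; split.
- by apply: H; rewrite /N !le_max lexx.
- by apply: H; rewrite /N !le_max lexx orbT.
- apply: (@le_trans _ _ (r * (r * `|tau|))%R); first by rewrite mulrA.
  apply: H.
  rewrite /N le_max; apply/orP; right; rewrite -[leRHS]mul1r.
  by apply: ler_wpM2r.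
Qed.

(* The dilation by [sqrt t] maps the tail of [h t] to a tail of [h 1] at distance of order [t ^ (-1/2)]. *)
Lemma heat_kernel_concentration (rho e : R) : (0 < rho)%R -> (0 < e)%R ->
  \forall t \near (0%R : R)^'+,
    \int[haar]_zeta (h t zeta * (rho <= `|zeta|)%R%:R)%:E <= e%:E.
Proof.
move=> rho0 e0.
have mnorm (r : R) : measurable_fun [set: mH]
    (fun zeta : heis R n => (rho <= `|heis_dilate r zeta|)%R%:R : R).
  rewrite (_ : (fun _ => _) = fun zeta => if (rho <= `|heis_dilate r zeta|)%R then 1%R else 0%R).
    apply: measurable_fun_ifT; [|exact: measurable_cst|exact: measurable_cst].
    apply: measurable_fun_ler; first exact: measurable_cst.
    apply: continuous_heis_measurable => zeta; apply: cvg_norm.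
    by apply: (@cvg_heis_dilate _ _ _ (nbhs zeta) (nbhs_filter zeta)); exact: cvg_id.
  by apply/funext => zeta; case: ifP.
have mh1 := heat_kernel_measurable ltr01.
apply: near_seq => u u0.
have [u_gt0|/existsNP[k /negP uk]] := pselect (forall k, 0 < u k)%R; last first.
  by exists k => /= uk'; rewrite uk' in uk.
pose f_ k zeta := (h 1 zeta * (rho <= `|heis_dilate (Num.sqrt (u k)) zeta|)%R%:R)%R.
have H : \forall k \near \oo, \int[haar]_zeta (f_ k zeta)%:E <= e%:E.
  apply: (dominated_cvg0 (mu := haar) (f_ := f_) (g := h 1)) => //.
  - by move=> k; apply: measurable_funM => //; exact: mnorm.
  - move=> k zeta; rewrite /f_; have h0 := ltW (heat_kernel_gt0 hh zeta ltr01).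
    set b := (rho <= _)%R; case: b; first by rewrite mulr1 h0 lexx.
    by rewrite mulr0 h0 lexx.
  - by rewrite heat_kernel_integral// ltry.
  - move=> zeta; apply/cvgrPdist_lt => d d_gt0.
    have d0 : (0 < Num.min 1 ((rho / (`|zeta| + 1)) ^+ 2))%R.
      by rewrite lt_min ltr01 exprn_gt0// divr_gt0// ltr_wpDl.
    move/cvgrPdist_lt : u0 => /(_ _ d0); apply: filterS => k.
    rewrite sub0r normrN gtr0_norm// lt_min => /andP[uk1 ukr].
    have s1 : (Num.sqrt (u k) <= 1)%R by rewrite -sqrtr1 ler_wsqrtr// ltW.
    have sr : (Num.sqrt (u k) < rho / (`|zeta| + 1))%R.
      rewrite -(@ger0_norm _ (rho / _)%R) ?divr_ge0 ?ltW// ?ltr_wpDl//.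
      by rewrite -sqrtr_sqr ltr_sqrt// exprn_gt0// divr_gt0// ltr_wpDl.
    rewrite /f_ leNgt (_ : (_ < rho)%R) ?mulr0 ?subrr ?normr0//.
    apply: le_lt_trans (heis_dilate_norm _ _) _; first by rewrite sqrtr_ge0.
    apply: (@le_lt_trans _ _ (Num.sqrt (u k) * (`|zeta| + 1))%R).
      by rewrite ler_wpM2l ?sqrtr_ge0// lerDl.
    by rewrite -ltr_pdivlMr// ltr_wpDl.
have [k /= Hk] := filter_ex H; exists k => uk.
have suk : (0 < Num.sqrt (u k))%R by rewrite sqrtr_gt0.
have sukN : (Num.sqrt (u k) != 0)%R by rewrite gt_eqF.
have mF : measurable_fun [set: mH] (fun zeta => (f_ k zeta)%:E).
  by apply/measurable_EFinP; apply: measurable_funM => //; exact: mnorm.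
have F0 zeta : 0 <= (f_ k zeta)%:E.
  by rewrite lee_fin /f_ mulr_ge0// ltW// heat_kernel_gt0.
have sV : (0 < (Num.sqrt (u k))^-1)%R by rewrite invr_gt0.
(* The Jacobian of the dilation by [(u k) ^ (- 1 / 2)] cancels the factor [(u k) ^ (- (n + 1))] of
   the scaling law. *)
have := haar_dilate sV mF F0.
rewrite -exprVn invrK exprM sqr_sqrtr ?(ltW uk)// => E.
have pw : (0 < u k ^+ n.+1)%R by rewrite exprn_gt0.
rewrite (_ : (fun _ => _) = fun zeta => ((u k ^+ n.+1)^-1)%:E *
    (f_ k (heis_dilate (Num.sqrt (u k))^-1 zeta))%:E); last first.
  apply/funext => zeta; rewrite -EFinM /f_ heat_kernel_profile// mulrA.
  have := @heis_dilateK R n (Num.sqrt (u k))^-1 zeta.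
  by rewrite invrK invr_eq0 => ->.
rewrite ge0_integralZl_EFin//; last 2 first.
- apply: (measurableT_comp mF); apply: measurable_heis_dilate.
    exact: measurable_cst.
  exact: measurable_id.
- by rewrite invr_ge0 ltW.
by rewrite E muleA -EFinM mulVf ?gt_eqF// mul1e.
Qed.

End heat_kernel.

(** * Beta integrals *)

Section time_integrals.
Local Open Scope ereal_scope.
Context {R : realType}.
Local Notation leb := (@lebesgue_measure R).
Implicit Types (a b s t A : R).

Lemma powRN_le A s t : (0 <= A)%R -> (0 < s)%R -> (s <= t)%R ->
  (t `^ (- A) <= s `^ (- A))%R.
Proof.
move=> A0 s0 st; have t0 : (0 < t)%R by exact: lt_le_trans st.
rewrite !powRN lef_pV2 ?posrE ?powR_gt0//.
by apply: ge0_ler_powR; rewrite ?nnegrE// ltW.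
Qed.

Lemma measurable_powRN_translate A t :
  measurable_fun [set: measurableTypeR R] (fun s : R => ((t - s) `^ (- A))%R).
Proof.
apply: (measurableT_comp (measurable_powR _)).
by apply: measurable_funB; [exact: measurable_cst|exact: measurable_id].
Qed.

(** Away from the singularity at 0 the fundamental theorem of calculus applies; dropping the
    contribution of the lower endpoint makes the bound uniform in [s]. *)
Lemma integral_powRN_cc b s t : (0 <= b < 1)%R -> (0 < s < t)%R ->
  \int[leb]_(x in `[s, t]) (x `^ (- b))%:E <= (t `^ (1 - b) / (1 - b))%:E.
Proof.
move=> /andP[b0 b1] /andP[s0 st].
have t0 : (0 < t)%R by exact: lt_trans st.
have c0 : (0 < 1 - b)%R by rewrite subr_gt0.
pose F (x : R) := ((1 - b)^-1 * x `^ (1 - b))%R.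
have dpow (x : R) : (0 < x)%R -> derivable (fun y : R => y `^ (1 - b))%R x 1.
  by move=> x0; apply: derivable_powR; rewrite in_itv/= x0.
have dF (x : R) : (0 < x)%R -> derivable F x 1.
  by move=> x0; apply: derivableM; [exact: derivable_cst|exact: dpow].
have cF (x : R) : (0 < x)%R -> {for x, continuous F}.
  by move=> x0; apply: differentiable_continuous; apply/derivable1_diffP; exact: dF.
rewrite (@continuous_FTC2 R (fun x => x `^ (- b))%R F s t st).
- rewrite -EFinB lee_fin /F mulrC lerBlDr lerDl.
  by rewrite mulr_ge0 ?powR_ge0// invr_ge0 ltW.
- apply: continuous_in_subspaceT => x; rewrite inE/= in_itv/= => /andP[sx _].
  apply: differentiable_continuous; apply/derivable1_diffP.
  by apply: derivable_powR; rewrite in_itv/= andbT (lt_le_trans s0).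
- split.
  + by move=> x; rewrite in_itv/= => /andP[sx _]; apply: dF; exact: lt_trans sx.
  + by apply: cvg_at_right_filter; exact: cF.
  + by apply: cvg_at_left_filter; exact: cF.
- move=> x; rewrite in_itv/= => /andP[sx _].
  have x0 : (0 < x)%R by exact: lt_trans sx.
  rewrite /F derive1E deriveM//; last exact: dpow.
  rewrite derive_cst scaler0 addr0 -derive1E powR_derive1 ?in_itv/= ?x0//.
  rewrite /GRing.scale/= mulrA mulVf ?gt_eqF// mul1r; congr (_ `^ _)%R; ring.
Qed.

Lemma integral_powRN b t : (0 <= b < 1)%R -> (0 < t)%R ->
  \int[leb]_(x in `]0%R, t[) (x `^ (- b))%:E <= (t `^ (1 - b) / (1 - b))%:E.
Proof.
move=> b01 t0.
have mp (D : set (measurableTypeR R)) : measurable D ->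
    measurable_fun D (fun x : measurableTypeR R => (x `^ (- b))%:E).
  move=> mD; apply/measurable_EFinP; apply: measurable_funTS.
  exact: measurable_powR.
(* [k.+2] keeps the left endpoint strictly below [t] already for [k = 0]. *)
pose D (k : nat) : set (measurableTypeR R) := `[(t / k.+2%:R)%R, t]%classic.
have mDk k : measurable (D k) by exact: measurable_itv.
have tk (k : nat) : (0 < t / k.+2%:R < t)%R.
  by rewrite divr_gt0//= ltr_pdivrMr// ltr_pMr// ltr1n.
have sub : `]0%R, t[%classic `<=` \bigcup_k D k.
  move=> x /=; rewrite in_itv/= => /andP[x0 xt].
  have := near_infty_natSinv_lt (PosNum (divr_gt0 x0 t0)).
  move=> /filter_ex[k /= kx]; exists k => //; rewrite /D/= in_itv/= (ltW xt) andbT.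
  have : (t / k.+1%:R <= x)%R.
    by move: kx; rewrite ltr_pdivlMr// mulrC => /ltW.
  apply: le_trans; apply: ler_wpM2l; first exact: ltW.
  by rewrite lef_pV2 ?posrE ?ltr0n// ler_nat.
apply: (@le_trans _ _ (\int[leb]_(x in \bigcup_k D k) (x `^ (- b))%:E)).
  apply: ge0_subset_integral => //.
  - exact: bigcupT_measurable.
  - by apply: mp; exact: bigcupT_measurable.
  - by move=> x _; rewrite lee_fin powR_ge0.
have ndD : {homo D : n m / (n <= m)%N >-> (n <= m)%O}.
  move=> n m nm; apply/subsetPset => x /=; rewrite /D/= !in_itv/= => /andP[xn ->].
  rewrite andbT; apply: le_trans xn; apply: ler_wpM2l; first exact: ltW.
  by rewrite lef_pV2 ?posrE ?ltr0n// ler_nat.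
have H := @ge0_nondecreasing_set_cvg_integral _ _ R D
  (fun x : measurableTypeR R => (x `^ (- b))%:E) leb ndD mDk
  (fun k => mp _ (mDk k)) (fun k x _ => powR_ge0 x (- b)).
apply: (cvge_le _ H); apply: nearW => k; exact: integral_powRN_cc.
Qed.

(** The reflection of [x] to [t - x] preserves Lebesgue measure and the interval. *)
Lemma integral_powRN_translate A t : (0 <= A < 1)%R -> (0 < t)%R ->
  \int[leb]_(x in `]0%R, t[) ((t - x) `^ (- A))%:E <=
  (t `^ (1 - A) / (1 - A))%:E.
Proof.
move=> A01 t0; apply: le_trans (integral_powRN A01 t0).
pose f (x : measurableTypeR R) : \bar R :=
  ((fun x => (x `^ (- A))%:E) \_ (`]0%R, t[%classic)) x.
have mf : measurable_fun setT f.
  apply/(measurable_restrictT _ _).1 => //; apply/measurable_EFinP.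
  by apply: measurable_funTS; exact: measurable_powR.
have f0 x : 0 <= f x.
  by rewrite /f patchE; case: ifP => // _; rewrite lee_fin powR_ge0.
have N10 : (-1 != 0 :> R)%R by rewrite oppr_eq0 oner_eq0.
have := ge0_integral_affine t N10 mf f0.
rewrite normrN normr1 invr1 mul1e => E.
rewrite [leRHS]integral_mkcond -[leRHS]/(\int[leb]_x f x) -E integral_mkcond.
rewrite le_eqVlt; apply/orP; left; apply/eqP; apply: eq_integral => x _; rewrite patchE.
have -> : (x \in `]0%R, t[%classic) = ((- x + t)%R \in `]0%R, t[%classic).
  by apply/idP/idP; rewrite !inE/= !in_itv/= addrC subr_gt0 gtrBl andbC.
by rewrite /f !patchE mulN1r [(t - x)%R]addrC.
Qed.

(* On each half of [0, t] one of the two factors is bounded by its value at [t / 2]. *)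
Lemma integral_beta A b : (0 <= A < 1)%R -> (0 <= b < 1)%R ->
  exists2 C : R, (0 < C)%R & forall t, (0 < t)%R ->
  \int[leb]_(s in `]0%R, t[) ((t - s) `^ (- A) * s `^ (- b))%:E <=
  (C * t `^ (1 - A - b))%:E.
Proof.
move=> A01 b01; have [A0 A1] := andP A01; have [b0 b1] := andP b01.
have cA : (0 < 1 - A)%R by rewrite subr_gt0.
have cb : (0 < 1 - b)%R by rewrite subr_gt0.
pose k1 := (2^-1 `^ (- A))%R; pose k2 := (2^-1 `^ (- b) : R)%R.
have k10 : (0 < k1)%R by rewrite powR_gt0 ?invr_gt0.
have k20 : (0 < k2)%R by rewrite powR_gt0 ?invr_gt0.
exists (k1 / (1 - b) + k2 / (1 - A))%R; first by rewrite addr_gt0// divr_gt0.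
move=> t t0; have t20 : (0 < t / 2)%R by rewrite divr_gt0.
have mI : measurable (`]0%R, t[%classic : set (measurableTypeR R)).
  exact: measurable_itv.
have m1 : measurable_fun (`]0%R, t[%classic : set (measurableTypeR R))
    (fun s : R => s `^ (- b))%R.
  by apply: measurable_funTS; exact: measurable_powR.
have m2 : measurable_fun (`]0%R, t[%classic : set (measurableTypeR R))
    (fun s : R => (t - s) `^ (- A))%R.
  by apply: measurable_funTS; exact: measurable_powRN_translate.
apply: (@le_trans _ _ (\int[leb]_(s in `]0%R, t[)
  ((k1 * t `^ (- A))%:E * (s `^ (- b))%:E +
   (k2 * t `^ (- b))%:E * ((t - s) `^ (- A))%:E))).
  apply: ge0_le_integral => //.
  - by move=> s _; rewrite lee_fin mulr_ge0 ?powR_ge0.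
  - by apply/measurable_EFinP; apply: measurable_funM.
  - by apply: emeasurable_funD; apply: emeasurable_funM;
      by [exact: measurable_cst|exact/measurable_EFinP].
  - move=> s /=; rewrite in_itv/= => /andP[s0 st].
    rewrite -!EFinM -EFinD lee_fin.
    have half (c : R) : (2^-1 `^ (- c) * t `^ (- c) = (t / 2) `^ (- c))%R.
      by rewrite mulrC -powRM ?invr_ge0// ltW.
    have [st2|st2] := leP s (t / 2)%R.
      apply: ler_wpDr; first by rewrite !mulr_ge0 ?powR_ge0// ltW.
      rewrite ler_wpM2r ?powR_ge0// /k1 half; apply: powRN_le => //; lra.
    apply: ler_wpDl; first by rewrite !mulr_ge0 ?powR_ge0// ltW.
    rewrite mulrC ler_wpM2r ?powR_ge0// /k2 half; apply: powRN_le => //; lra.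
rewrite ge0_integralD//; last 4 first.
- by move=> s _; rewrite -EFinM lee_fin !mulr_ge0 ?powR_ge0// ltW.
- by apply: emeasurable_funM; by [exact: measurable_cst|exact/measurable_EFinP].
- by move=> s _; rewrite -EFinM lee_fin !mulr_ge0 ?powR_ge0// ltW.
- by apply: emeasurable_funM; by [exact: measurable_cst|exact/measurable_EFinP].
rewrite ge0_integralZl_EFin//; last 3 first.
- by move=> s _; rewrite lee_fin powR_ge0.
- exact/measurable_EFinP.
- by rewrite mulr_ge0 ?powR_ge0// ltW.
rewrite ge0_integralZl_EFin//; last 3 first.
- by move=> s _; rewrite lee_fin powR_ge0.
- exact/measurable_EFinP.
- by rewrite mulr_ge0 ?powR_ge0// ltW.
apply: (@le_trans _ _ ((k1 * t `^ (- A))%:E * (t `^ (1 - b) / (1 - b))%:E +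
   (k2 * t `^ (- b))%:E * (t `^ (1 - A) / (1 - A))%:E)).
  apply: leeD; apply: lee_wpmul2l.
  - by rewrite lee_fin mulr_ge0 ?powR_ge0// ltW.
  - exact: integral_powRN.
  - by rewrite lee_fin mulr_ge0 ?powR_ge0// ltW.
  - exact: integral_powRN_translate.
rewrite -!EFinM -EFinD lee_fin le_eqVlt; apply/orP; left; apply/eqP.
have e1 : (t `^ (1 - A - b) = t `^ (- A) * t `^ (1 - b))%R.
  by rewrite -gt0_powRD//; congr (_ `^ _)%R; ring.
have e2 : (t `^ (1 - A - b) = t `^ (- b) * t `^ (1 - A))%R.
  by rewrite -gt0_powRD//; congr (_ `^ _)%R; ring.
by rewrite mulrDl {1}e1 e2; field; rewrite !gt_eqF.
Qed.

End time_integrals.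

(** * Symmetric Markov kernels *)

Section heat_operator.
Local Open Scope ereal_scope.
Context {R : realType} {d : measure_display} {X : measurableType d}.
Variables (mu : {sigma_finite_measure set X -> \bar R}) (k : R -> X -> X -> R).
Variables (dim C : R).

(* A symmetric Markov kernel with the on-diagonal decay [t ^ (- dim)] of the heat kernel, extended by zero to [t <= 0]. *)
Record markov_kernel : Prop := MarkovKernel {
  mk_ge0 : forall t x y, (0 <= k t x y)%R ;
  mk_le0 : forall t x y, (t <= 0)%R -> k t x y = 0%R ;
  mk_measurable : forall d' (T : measurableType d') (t : T -> R) (f g : T -> X),
    measurable_fun setT t -> measurable_fun setT f -> measurable_fun setT g ->
    measurable_fun setT (fun z => k (t z) (f z) (g z)) ;
  mk_sym : forall t x y, k t x y = k t y x ;
  mk_mass : forall t x, (0 < t)%R -> \int[mu]_y (k t x y)%:E = 1 ;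
  mk_semigroup : forall s t x y, (0 < s)%R -> (0 < t)%R ->
    \int[mu]_z (k s x z * k t z y)%:E = (k (s + t) x y)%:E ;
  mk_bound : forall t x y, (0 < t)%R -> (k t x y <= C * t `^ (- dim))%R
}.
Hypothesis mk : markov_kernel.
Hypothesis C_gt0 : (0 < C)%R.

(** For [t <= 0] the kernel vanishes, so this is 0 and not the identity; [solution_curve] puts the
    value at time 0 back. *)
Definition heat_op (t : R) (f : X -> \bar R) (y : X) : \bar R :=
  \int[mu]_x ((k t x y)%:E * f x).

Lemma heat_op_ge0 t f y : (forall x, 0 <= f x) -> 0 <= heat_op t f y.
Proof.
move=> f0; apply: integral_ge0 => x _.
by rewrite mule_ge0// lee_fin (mk_ge0 mk).
Qed.

Lemma heat_op_le0 t f y : (t <= 0)%R -> heat_op t f y = 0.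
Proof.
move=> t0; apply: integral0_eq => x _.
by rewrite (mk_le0 mk)// mul0e.
Qed.

Lemma measurable_heat_op d' (T : measurableType d') (t : T -> R)
    (f : T * X -> \bar R) (y : T -> X) :
  measurable_fun setT t -> measurable_fun setT f -> (forall p, 0 <= f p) ->
  measurable_fun setT y ->
  measurable_fun setT (fun z => heat_op (t z) (fun x => f (z, x)) (y z)).
Proof.
move=> mt mf f0 my.
apply: (measurable_fun_fubini_tonelli_F (m2 := mu)
  (fun p : T * X => (k (t p.1) p.2 (y p.1))%:E * f p)).
  apply: emeasurable_funM => //; apply/measurable_EFinP; apply: (mk_measurable mk).
  - by apply: (measurableT_comp mt); exact: measurable_fst.
  - exact: measurable_snd.
  - by apply: (measurableT_comp my); exact: measurable_fst.
by move=> p; rewrite mule_ge0// lee_fin (mk_ge0 mk).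
Qed.

Lemma measurable_heat_op1 t (f : X -> \bar R) :
  measurable_fun setT f -> (forall p, 0 <= f p) ->
  measurable_fun setT (heat_op t f).
Proof.
move=> mf f0.
apply: (@measurable_heat_op _ X (cst t) (fun p => f p.2) id) => //.
by apply: (measurableT_comp mf); exact: measurable_snd.
Qed.

Let mkx t y : measurable_fun setT (fun x => k t x y).
Proof.
by apply: (mk_measurable mk); [exact: measurable_cst|exact: measurable_id|exact: measurable_cst].
Qed.

Let mky t x : measurable_fun setT (fun y => k t x y).
Proof.
by apply: (mk_measurable mk); [exact: measurable_cst|exact: measurable_cst|exact: measurable_id].
Qed.

Lemma mk_mass_l t y : (0 < t)%R -> \int[mu]_x (k t x y)%:E = 1.
Proof.
by move=> t0; rewrite -(mk_mass mk y t0); apply: eq_integral => x _; rewrite (mk_sym mk).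
Qed.

Lemma le_heat_op t f g y : measurable_fun setT f -> measurable_fun setT g ->
  (forall x, 0 <= f x) -> (forall x, f x <= g x) ->
  heat_op t f y <= heat_op t g y.
Proof.
move=> mf mg f0 fg; apply: ge0_le_integral => //.
- by move=> x _; rewrite mule_ge0// lee_fin (mk_ge0 mk).
- by apply: emeasurable_funM => //; apply/measurable_EFinP; exact: mkx.
- by apply: emeasurable_funM => //; apply/measurable_EFinP; exact: mkx.
- by move=> x _; apply: lee_wpmul2l; rewrite ?lee_fin ?(mk_ge0 mk).
Qed.

Lemma heat_op_cst t c y : (0 < t)%R -> (0 <= c)%R ->
  heat_op t (fun _ => c%:E) y = c%:E.
Proof.
move=> t0 c0; rewrite /heat_op; under eq_integral do rewrite muleC.
rewrite ge0_integralZl_EFin//; last 2 first.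
- by move=> x _; rewrite lee_fin (mk_ge0 mk).
- by apply/measurable_EFinP; exact: mkx.
by rewrite mk_mass_l// mule1.
Qed.

Lemma heat_op_le_cst t f c y : measurable_fun setT f -> (forall x, 0 <= f x) ->
  (0 <= c)%R -> (forall x, f x <= c%:E) -> heat_op t f y <= c%:E.
Proof.
move=> mf f0 c0 fc; have [t0|t0] := leP t 0%R; first by rewrite heat_op_le0// lee_fin.
rewrite -(heat_op_cst y t0 c0); exact: le_heat_op.
Qed.

Lemma heat_op_jensen t f y a : (0 < t)%R -> (1 <= a)%R ->
  measurable_fun setT f -> (forall x, 0 <= f x) ->
  heat_op t f y `^ a <= heat_op t (fun x => f x `^ a) y.
Proof.
move=> t0 a1 mf f0.
have := @jensen_powR R _ X mu setT (fun x => k t x y) f a 1 measurableT a1 ltr01.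
rewrite powR1 mul1e; apply.
- exact: mkx.
- exact: mf.
- by move=> x _; exact: mk_ge0.
- by move=> x _; exact: f0.
- by rewrite mk_mass_l.
Qed.

Lemma heat_op_le_mass t f y : (0 < t)%R ->
  measurable_fun setT f -> (forall x, 0 <= f x) ->
  heat_op t f y <= (C * t `^ (- dim))%:E * \int[mu]_x f x.
Proof.
move=> t0 mf f0.
have c0 : (0 <= C * t `^ (- dim))%R by rewrite mulr_ge0 ?powR_ge0// ltW.
rewrite -ge0_integralZl_EFin//.
apply: ge0_le_integral => //.
- by move=> x _; rewrite mule_ge0// lee_fin (mk_ge0 mk).
- by apply: emeasurable_funM => //; apply/measurable_EFinP; exact: mkx.
- by apply: emeasurable_funM => //; exact: measurable_cst.
- by move=> x _; apply: lee_wpmul2r => //; rewrite lee_fin (mk_bound mk).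
Qed.

Lemma integral_heat_op t f : (0 < t)%R ->
  measurable_fun setT f -> (forall x, 0 <= f x) ->
  \int[mu]_y heat_op t f y = \int[mu]_x f x.
Proof.
move=> t0 mf f0; rewrite /heat_op.
have mF : measurable_fun setT (fun p : X * X => (k t p.1 p.2)%:E * f p.1).
  apply: emeasurable_funM.
    apply/measurable_EFinP; apply: (mk_measurable mk).
    - exact: measurable_cst.
    - exact: measurable_fst.
    - exact: measurable_snd.
  by apply: (measurableT_comp mf); exact: measurable_fst.
rewrite -(fubini_tonelli (m1 := mu) (m2 := mu)
  (fun p : X * X => (k t p.1 p.2)%:E * f p.1) mF); last first.
  by move=> p; rewrite mule_ge0// lee_fin (mk_ge0 mk).
apply: eq_integral => x _ /=; under eq_integral do rewrite muleC.
rewrite ge0_integralZl//; last 2 first.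
- by apply/measurable_EFinP; exact: mky.
- by move=> y _; rewrite lee_fin (mk_ge0 mk).
by rewrite (mk_mass mk)// mule1.
Qed.

Lemma heat_op_semigroup s t f y : (0 < s)%R -> (0 < t)%R ->
  measurable_fun setT f -> (forall x, 0 <= f x) ->
  heat_op t (heat_op s f) y = heat_op (s + t) f y.
Proof.
move=> s0 t0 mf f0; rewrite /heat_op.
transitivity (\int[mu]_z \int[mu]_x ((k t z y)%:E * ((k s x z)%:E * f x))).
  apply: eq_integral => z _; rewrite ge0_integralZl//.
  - by apply: emeasurable_funM => //; apply/measurable_EFinP; exact: mkx.
  - by move=> x _; rewrite mule_ge0// lee_fin (mk_ge0 mk).
  - by rewrite lee_fin (mk_ge0 mk).
have mF : measurable_fun setT (fun p : X * X =>
    (k t p.1 y)%:E * ((k s p.2 p.1)%:E * f p.2)).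
  apply: emeasurable_funM.
    apply/measurable_EFinP; apply: (mk_measurable mk); [exact: measurable_cst|
      exact: measurable_fst|exact: measurable_cst].
  apply: emeasurable_funM.
    by apply/measurable_EFinP; apply: (mk_measurable mk); [exact: measurable_cst|
      exact: measurable_snd|exact: measurable_fst].
  by apply: (measurableT_comp mf); exact: measurable_snd.
rewrite (fubini_tonelli (m1 := mu) (m2 := mu) _ mF)/=; last first.
  by move=> p; rewrite !mule_ge0// lee_fin (mk_ge0 mk).
apply: eq_integral => x _.
under eq_integral do rewrite muleA -EFinM mulrC muleC.
rewrite ge0_integralZl//; last 2 first.
- by apply/measurable_EFinP; apply: measurable_funM; [exact: mky|exact: mkx].
- by move=> z _; rewrite lee_fin mulr_ge0 ?(mk_ge0 mk).
by rewrite (mk_semigroup mk)// muleC.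
Qed.

Local Notation Lbound := (Lbound mu).

Lemma poweR_ge1_le (x : \bar R) (M e : R) : (1 <= e)%R -> 0 <= x -> x <= M%:E ->
  x `^ e <= (M `^ (e - 1))%:E * x.
Proof.
move=> e1; case: x => [x| |]//; rewrite !lee_fin => x0 xM.
have e0 : (0 < e)%R by exact: lt_le_trans e1.
rewrite -(mulr_powRB1 x0 e0) mulrC.
by apply: ler_wpM2r => //; apply: ge0_ler_powR; rewrite ?subr_ge0 ?nnegrE ?(le_trans x0).
Qed.

Lemma poweR_le (x y : \bar R) (e : R) : (0 <= e)%R -> 0 <= x -> x <= y -> x `^ e <= y `^ e.
Proof.
move=> e0 x0 xy; apply: gt0_ler_poweR => //; rewrite in_itv/= leey andbT//.
exact: le_trans xy.
Qed.

(** The bound on the kernel is the case [a = 1]; Jensen carries it over to [f ^ a], and the root of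
    order [a] is taken at the end. *)
Lemma heat_op_Loo t f y a c : (0 < t)%R -> (1 <= a)%R -> (0 <= c)%R ->
  measurable_fun setT f -> (forall x, 0 <= f x) -> Lbound a f c ->
  heat_op t f y <= ((C * t `^ (- dim)) `^ a^-1 * c)%:E.
Proof.
move=> t0 a1 c0 mf f0 fc; have a0 : (0 < a)%R by exact: lt_le_trans a1.
have B0 : (0 <= C * t `^ (- dim))%R by rewrite mulr_ge0 ?powR_ge0// ltW.
have mfa : measurable_fun setT (fun x => f x `^ a).
  exact: (measurableT_comp (measurable_poweR a) mf).
have H : heat_op t f y `^ a <= (C * t `^ (- dim) * c `^ a)%:E.
  apply: le_trans (heat_op_jensen y t0 a1 mf f0) _.
  apply: le_trans (heat_op_le_mass y t0 mfa _) _.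
    by move=> x; exact: poweR_ge0.
  by rewrite [leRHS]EFinM; apply: lee_wpmul2l => //; rewrite lee_fin.
have := poweR_le (ltW (_ : 0 < a^-1)%R) (poweR_ge0 _ _) H.
rewrite -poweRrM divff ?gt_eqF// poweRe1 ?heat_op_ge0// poweR_EFin.
rewrite (powRM _ B0 (powR_ge0 _ _)) -powRrM divff ?gt_eqF// (powRr1 c0).
by apply; rewrite invr_gt0.
Qed.

(** Writing [S] for the flow, Jensen gives [(S f) ^ N <= (S (f ^ a)) ^ (N / a)]. All but one power
    of [S (f ^ a)] are bounded by its sup, and the remaining one integrates to the integral of
    [f ^ a]. *)
Lemma heat_op_Lbound t f a N c : (0 < t)%R -> (1 <= a)%R -> (a <= N)%R -> (0 < c)%R ->
  measurable_fun setT f -> (forall x, 0 <= f x) -> Lbound a f c ->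
  Lbound N (heat_op t f) ((C * t `^ (- dim)) `^ (a^-1 - N^-1) * c).
Proof.
move=> t0 a1 aN c0 mf f0 fc; have a0 : (0 < a)%R by exact: lt_le_trans a1.
have N0 : (0 < N)%R by exact: lt_le_trans aN.
pose B := (C * t `^ (- dim))%R.
have B0 : (0 < B)%R by rewrite mulr_gt0 ?powR_gt0.
have ca0 : (0 < c `^ a)%R by rewrite powR_gt0.
have mfa : measurable_fun setT (fun x => f x `^ a).
  exact: (measurableT_comp (measurable_poweR a) mf).
have fa0 x : 0 <= f x `^ a by exact: poweR_ge0.
have mH := measurable_heat_op1 t mfa fa0.
have e1 : (1 <= N / a)%R by rewrite ler_pdivlMr// mul1r.
rewrite /Lbound.
apply: (@le_trans _ _ (\int[mu]_y (((B * c `^ a) `^ (N / a - 1))%:E *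
   heat_op t (fun x => f x `^ a) y))).
  apply: ge0_le_integral => //.
  - by move=> y _; exact: poweR_ge0.
  - apply: (measurableT_comp (measurable_poweR N)); exact: measurable_heat_op1.
  - by apply: emeasurable_funM => //; exact: measurable_cst.
  - move=> y _; apply: le_trans (poweR_ge1_le e1 (heat_op_ge0 _ _ fa0) _).
      have -> : heat_op t f y `^ N = (heat_op t f y `^ a) `^ (N / a).
        by rewrite -poweRrM [(a * _)%R]mulrC divfK ?gt_eqF.
      apply: poweR_le; [by rewrite divr_ge0 // ltW|exact: poweR_ge0|].
      exact: heat_op_jensen.
    apply: le_trans (heat_op_le_mass y t0 mfa fa0) _.
    by rewrite [leRHS]EFinM; apply: lee_wpmul2l => //; rewrite lee_fin ltW.
rewrite ge0_integralZl//; last 2 first.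
- by move=> y _; exact: heat_op_ge0.
- by rewrite lee_fin powR_ge0.
rewrite integral_heat_op//.
apply: (@le_trans _ _ (((B * c `^ a) `^ (N / a - 1))%:E * (c `^ a)%:E)).
  by apply: lee_wpmul2l => //; rewrite lee_fin powR_ge0.
rewrite -EFinM lee_fin le_eqVlt; apply/orP; left; apply/eqP.
rewrite (powRM _ (ltW B0) (ltW ca0)) (powRM _ (powR_ge0 _ _) (ltW c0)).
rewrite -!powRrM -mulrA -gt0_powRD//; congr (_ `^ _ * _ `^ _)%R; field.
  by rewrite !gt_eqF.
by rewrite gt_eqF.
Qed.

End heat_operator.

(** * Memory and Duhamel operators *)

Section duhamel.
Local Open Scope ereal_scope.
Context {R : realType} {d : measure_display} {X : measurableType d}.
Variables (mu : {sigma_finite_measure set X -> \bar R}) (k : R -> X -> X -> R).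
Variables (dim C : R).
Hypothesis mk : markov_kernel mu k dim C.
Hypotheses (C_gt0 : (0 < C)%R) (dim_gt0 : (0 < dim)%R).
Local Notation leb := (@lebesgue_measure R).
Local Notation mR := (measurableTypeR R).
Local Notation Lbound := (Lbound mu).
Local Notation heat_op := (heat_op mu k).
Implicit Types (F G : mR * X -> \bar R) (a b c gamma t s : R).

Definition memory_weight gamma t : R := (if 0 < t then t `^ (- gamma) else 0)%R.

(* With kernels extended by zero to nonpositive times, the integrals over
   [0, t] become convolutions over the whole line, so that Tonelli applies. *)
Definition memory gamma F (p : mR * X) : \bar R :=
  \int[leb]_s ((memory_weight gamma (p.1 - s))%:E * F (s, p.2)).

Definition duhamel F (p : mR * X) : \bar R :=
  \int[leb]_s heat_op (p.1 - s) (fun x => F (s, x)) p.2.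

(** Under this convention the integrals over the whole line start at time 0; memory and Duhamel
    terms inherit it. *)
Definition past_null F : Prop := forall s x, (s <= 0)%R -> F (s, x) = 0.

Lemma memory_weight_ge0 gamma t : (0 <= memory_weight gamma t)%R.
Proof. by rewrite /memory_weight; case: ifP => // _; exact: powR_ge0. Qed.

Lemma measurable_memory_weight gamma : measurable_fun setT (memory_weight gamma).
Proof.
apply: measurable_fun_ifT; [|exact: measurable_powR|exact: measurable_cst].
by apply: measurable_fun_ltr; [exact: measurable_cst|exact: measurable_id].
Qed.

Section elementary.
Variables (F : mR * X -> \bar R).
Hypotheses (mF : measurable_fun setT F) (F0 : forall p, 0 <= F p).

Let measurable_shift : measurable_fun setT (fun q : (mR * X) * mR => (q.1.1 - q.2 : R)%R).
Proof.
apply: measurable_funB; last exact: measurable_snd.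
by apply: (measurableT_comp measurable_fst); exact: measurable_fst.
Qed.

Lemma memory_ge0 gamma p : 0 <= memory gamma F p.
Proof.
by apply: integral_ge0 => s _; rewrite mule_ge0// lee_fin memory_weight_ge0.
Qed.

Lemma duhamel_ge0 p : 0 <= duhamel F p.
Proof.
by apply: integral_ge0 => s _; apply: (heat_op_ge0 mk) => x; exact: F0.
Qed.

Lemma measurable_memory gamma : measurable_fun setT (memory gamma F).
Proof.
apply: (measurable_fun_fubini_tonelli_F (m2 := leb)
  (fun q : (mR * X) * mR => (memory_weight gamma (q.1.1 - q.2))%:E * F (q.2, q.1.2))).
  apply: emeasurable_funM.
    apply/measurable_EFinP.
    exact: (measurableT_comp (measurable_memory_weight gamma) measurable_shift).
  apply: (measurableT_comp mF); apply: measurable_fun_pair; first exact: measurable_snd.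
  by apply: (measurableT_comp measurable_snd); exact: measurable_fst.
by move=> q; rewrite mule_ge0// lee_fin memory_weight_ge0.
Qed.

Lemma measurable_duhamel : measurable_fun setT (duhamel F).
Proof.
apply: (measurable_fun_fubini_tonelli_F (m2 := leb)
  (fun q : (mR * X) * mR => heat_op (q.1.1 - q.2) (fun x => F (q.2, x)) q.1.2)).
  apply: (measurable_heat_op mk (f := fun z : ((mR * X) * mR) * X => F (z.1.2, z.2))).
  - exact: measurable_shift.
  - apply: (measurableT_comp mF); apply: measurable_fun_pair; last exact: measurable_snd.
    by apply: (measurableT_comp measurable_snd); exact: measurable_fst.
  - by move=> z; exact: F0.
  - by apply: (measurableT_comp measurable_snd); exact: measurable_fst.
by move=> q; apply: (heat_op_ge0 mk) => x; exact: F0.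
Qed.

Lemma measurable_slice s : measurable_fun setT (fun x => F (s, x)).
Proof. by apply: (measurableT_comp mF); exact: measurable_pair1. Qed.

Lemma measurable_path x : measurable_fun setT (fun s => F (s, x)).
Proof. by apply: (measurableT_comp mF); exact: measurable_pair2. Qed.

Hypothesis F_null : past_null F.

Lemma memoryE gamma t x : memory gamma F (t, x) =
  \int[leb]_(s in `]0%R, t[) (((t - s) `^ (- gamma))%:E * F (s, x)).
Proof.
rewrite [RHS]integral_mkcond; apply: eq_integral => s _; rewrite patchE /=.
rewrite /memory_weight subr_gt0; case: ifPn => st.
  case: ifPn => // /negP; rewrite inE/= in_itv/= st andbT => /negP.
  by rewrite -leNgt => s0; rewrite F_null// mule0.
by rewrite ifF ?mul0e//; apply/negP; rewrite inE/= in_itv/= (negbTE st) andbF.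
Qed.

Lemma duhamelE t x : duhamel F (t, x) =
  \int[leb]_(s in `]0%R, t[) heat_op (t - s) (fun x => F (s, x)) x.
Proof.
rewrite [RHS]integral_mkcond; apply: eq_integral => s _; rewrite patchE /=.
case: ifPn => // /negP; rewrite inE/= in_itv/= => /negP.
rewrite negb_and -!leNgt => /orP[s0|ts]; last first.
  by rewrite (heat_op_le0 mk)// subr_le0.
apply: integral0_eq => y _.
by rewrite F_null// mule0.
Qed.

Lemma memory_null gamma : past_null (memory gamma F).
Proof.
by move=> t x t0; rewrite memoryE set_itv_ge ?integral_set0// bnd_simp -leNgt.
Qed.

Lemma duhamel_null : past_null (duhamel F).
Proof.
by move=> t x t0; rewrite duhamelE set_itv_ge ?integral_set0// bnd_simp -leNgt.
Qed.

End elementary.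

Lemma Lbound_scale N (f : X -> \bar R) (w c : R) : (0 <= w)%R -> (0 <= c)%R ->
  measurable_fun setT f -> (forall x, 0 <= f x) ->
  Lbound N f c -> Lbound N (fun x => w%:E * f x) (w * c).
Proof.
move=> w0 c0 mf f0 fc; rewrite /Lbound.
under eq_integral do rewrite poweRM ?lee_fin// poweR_EFin.
rewrite ge0_integralZl_EFin//; last 3 first.
- by move=> x _; exact: poweR_ge0.
- exact: (measurableT_comp (measurable_poweR N) mf).
- exact: powR_ge0.
rewrite (powRM _ w0 c0) EFinM; apply: lee_wpmul2l => //.
by rewrite lee_fin powR_ge0.
Qed.

Let mitv t : measurable (`]0%R, t[%classic : set mR).
Proof. exact: measurable_itv. Qed.

(** Minkowski's inequality in time reduces this to a beta integral. [K] is chosen before [F] and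
    [c], since one constant has to serve all iterates. *)
Lemma memory_Lbound gamma a b : (0 <= gamma < 1)%R -> (1 <= a)%R -> (0 <= b < 1)%R ->
  exists2 K : R, (0 < K)%R & forall F c, measurable_fun setT F ->
    (forall p, 0 <= F p) -> past_null F -> (0 < c)%R ->
    (forall s, (0 < s)%R -> Lbound a (fun x => F (s, x)) (c * s `^ (- b))) ->
    forall t, (0 < t)%R ->
      Lbound a (fun x => memory gamma F (t, x)) (K * c * t `^ (1 - gamma - b)).
Proof.
move=> g01 a1 b01; have [K K0 HK] := integral_beta g01 b01.
exists K; first exact: K0.
move=> F c mF F0 Fn c0 Fc t t0.
under [X in Lbound _ X _]eq_fun do rewrite memoryE//.
have mw : measurable_fun setT (fun s : mR => ((t - s) `^ (- gamma))%R).
  exact: measurable_powRN_translate.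
apply: (@Lbound_integral _ _ _ _ _ leb mu `]0%R, t[%classic
  (fun p : mR * X => ((t - p.1) `^ (- gamma))%:E * F p)
  (fun s => ((t - s) `^ (- gamma) * (c * s `^ (- b)))%R)) => //.
- apply: emeasurable_funM => //; apply/measurable_EFinP.
  by apply: (measurableT_comp mw); exact: measurable_fst.
- by move=> p; rewrite mule_ge0// lee_fin powR_ge0.
- apply: measurable_funM => //; apply: measurable_funM; first exact: measurable_cst.
  exact: measurable_powR.
- move=> s /=; rewrite in_itv/= => /andP[s0 st].
  by rewrite !mulr_gt0 ?powR_gt0// subr_gt0.
- move=> s /=; rewrite in_itv/= => /andP[s0 st]; apply: Lbound_scale.
  + exact: powR_ge0.
  + by rewrite mulr_ge0 ?powR_ge0// ltW.
  + exact: measurable_slice.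
  + by move=> x; exact: F0.
  + exact: Fc.
- by rewrite !mulr_gt0 ?powR_gt0.
- apply: (@le_trans _ _ (\int[leb]_(s in `]0%R, t[)
    (c%:E * ((t - s) `^ (- gamma) * s `^ (- b))%:E))).
    rewrite le_eqVlt; apply/orP; left; apply/eqP.
    by apply: eq_integral => s _; rewrite -EFinM mulrCA.
  rewrite ge0_integralZl_EFin//; last 3 first.
  + by move=> s _; rewrite lee_fin mulr_ge0 ?powR_ge0.
  + by apply/measurable_EFinP; apply: measurable_funTS; apply: measurable_funM.
  + exact: ltW.
  rewrite mulrAC mulrC [leRHS]EFinM; apply: lee_wpmul2l; first by rewrite lee_fin ltW.
  exact: HK.
Qed.

Lemma integral_duhamel_weight A b e c t K : (0 < t)%R -> (0 < c)%R ->
  (dim * e = A)%R ->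
  (forall t, (0 < t)%R ->
    \int[leb]_(s in `]0%R, t[) ((t - s) `^ (- A) * s `^ (- b))%:E <=
    (K * t `^ (1 - A - b))%:E) ->
  \int[leb]_(s in `]0%R, t[) ((C * (t - s) `^ (- dim)) `^ e * (c * s `^ (- b)))%:E <=
  (C `^ e * K * c * t `^ (1 - A - b))%:E.
Proof.
move=> t0 c0 eA HK.
have mw : measurable_fun setT (fun s : mR => ((t - s) `^ (- A))%R).
  exact: measurable_powRN_translate.
apply: (@le_trans _ _ (\int[leb]_(s in `]0%R, t[)
    ((C `^ e * c)%:E * ((t - s) `^ (- A) * s `^ (- b))%:E))).
  rewrite le_eqVlt; apply/orP; left; apply/eqP; apply: eq_integral => s _.
  rewrite (powRM _ (ltW C_gt0) (powR_ge0 _ _)) -powRrM mulNr eA -EFinM; congr EFin.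
  ring.
rewrite ge0_integralZl_EFin//; last 3 first.
- by move=> s _; rewrite lee_fin mulr_ge0 ?powR_ge0.
- by apply/measurable_EFinP; apply: measurable_funTS; apply: measurable_funM.
- by rewrite mulr_ge0 ?powR_ge0// ltW.
apply: (@le_trans _ _ ((C `^ e * c)%:E * (K * t `^ (1 - A - b))%:E)).
  by apply: lee_wpmul2l; [rewrite lee_fin mulr_ge0 ?powR_ge0// ltW|exact: HK].
by rewrite -EFinM lee_fin le_eqVlt; apply/orP; left; apply/eqP; ring.
Qed.

(** Smoothing costs [(t - s) ^ (- A)], integrable at [s = t] because [A < 1]; the size of [F] costs
    [s ^ (- b)], integrable at 0 because [b < 1]. Minkowski and the beta integral then give the
    power of [t]. *)
Lemma duhamel_Lbound a N b A : (1 <= a)%R -> (a <= N)%R -> (0 <= b < 1)%R ->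
  A = (dim * (a^-1 - N^-1))%R -> (A < 1)%R ->
  exists2 K : R, (0 < K)%R & forall F c, measurable_fun setT F ->
    (forall p, 0 <= F p) -> past_null F -> (0 < c)%R ->
    (forall s, (0 < s)%R -> Lbound a (fun x => F (s, x)) (c * s `^ (- b))) ->
    forall t, (0 < t)%R ->
      Lbound N (fun x => duhamel F (t, x)) (K * c * t `^ (1 - A - b)).
Proof.
move=> a1 aN b01 eA A1.
have a0 : (0 < a)%R by exact: lt_le_trans a1.
have N0 : (0 < N)%R by exact: lt_le_trans aN.
have A0 : (0 <= A)%R.
  by rewrite eA mulr_ge0 ?(ltW dim_gt0)// subr_ge0 lef_pV2.
have [K K0 HK] := @integral_beta R A b (introT andP (conj A0 A1)) b01.
exists (C `^ (a^-1 - N^-1) * K)%R; first by rewrite mulr_gt0 ?powR_gt0.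
move=> F c mF F0 Fn c0 Fc t t0.
under [X in Lbound _ X _]eq_fun do rewrite duhamelE//.
have mw : measurable_fun setT (fun s : mR => ((t - s) `^ (- dim))%R).
  exact: measurable_powRN_translate.
apply: (@Lbound_integral _ _ _ _ _ leb mu `]0%R, t[%classic
  (fun p : mR * X => heat_op (t - p.1) (fun x => F (p.1, x)) p.2)
  (fun s => ((C * (t - s) `^ (- dim)) `^ (a^-1 - N^-1) * (c * s `^ (- b)))%R)) => //.
- exact: le_trans aN.
- apply: (measurable_heat_op mk (f := fun z : (mR * X) * X => F (z.1.1, z.2))).
  + by apply: measurable_funB; [exact: measurable_cst|exact: measurable_fst].
  + apply: (measurableT_comp mF); apply: measurable_fun_pair; last exact: measurable_snd.
    by apply: (measurableT_comp measurable_fst); exact: measurable_fst.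
  + by move=> z; exact: F0.
  + exact: measurable_snd.
- by move=> p; apply: (heat_op_ge0 mk) => x; exact: F0.
- apply: measurable_funM; last first.
    apply: measurable_funM; first exact: measurable_cst.
    exact: measurable_powR.
  apply: (measurableT_comp (measurable_powR _)).
  by apply: measurable_funM => //; exact: measurable_cst.
- move=> s /=; rewrite in_itv/= => /andP[s0 st].
  by rewrite !mulr_gt0 ?powR_gt0// ?mulr_gt0 ?powR_gt0 ?subr_gt0.
- move=> s /=; rewrite in_itv/= => /andP[s0 st]; apply: (heat_op_Lbound mk) => //.
  + by rewrite subr_gt0.
  + by rewrite mulr_gt0 ?powR_gt0.
  + exact: measurable_slice.
  + exact: Fc.
- by rewrite !mulr_gt0 ?powR_gt0.
- exact: integral_duhamel_weight.
Qed.

(** The endpoint [N = oo] of [duhamel_Lbound]: the pointwise bound on the heat flow is integrated in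
    time directly. *)
Lemma duhamel_Loo a b A : (1 <= a)%R -> (0 <= b < 1)%R ->
  A = (dim * a^-1)%R -> (A < 1)%R ->
  exists2 K : R, (0 < K)%R & forall F c, measurable_fun setT F ->
    (forall p, 0 <= F p) -> past_null F -> (0 < c)%R ->
    (forall s, (0 < s)%R -> Lbound a (fun x => F (s, x)) (c * s `^ (- b))) ->
    forall t x, (0 < t)%R -> duhamel F (t, x) <= (K * c * t `^ (1 - A - b))%:E.
Proof.
move=> a1 b01 eA A1.
have a0 : (0 < a)%R by exact: lt_le_trans a1.
have A0 : (0 <= A)%R by rewrite eA mulr_ge0 ?(ltW dim_gt0)// invr_ge0 ltW.
have [K K0 HK] := @integral_beta R A b (introT andP (conj A0 A1)) b01.
exists (C `^ a^-1 * K)%R; first by rewrite mulr_gt0 ?powR_gt0.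
move=> F c mF F0 Fn c0 Fc t x t0; rewrite duhamelE//.
have mw : measurable_fun setT (fun s : mR => ((t - s) `^ (- dim))%R).
  exact: measurable_powRN_translate.
apply: le_trans (@integral_duhamel_weight A b a^-1 c t K t0 c0 (esym eA) HK).
apply: ge0_le_integral => //.
- by move=> s _; apply: (heat_op_ge0 mk) => y; exact: F0.
- apply: measurable_funTS.
  apply: (measurable_heat_op mk (f := F) (y := cst x)) => //.
    by apply: measurable_funB; [exact: measurable_cst|exact: measurable_id].
- apply/measurable_EFinP; apply: measurable_funTS; apply: measurable_funM; last first.
    apply: measurable_funM; first exact: measurable_cst.
    exact: measurable_powR.
  apply: (measurableT_comp (measurable_powR _)).
  by apply: measurable_funM => //; exact: measurable_cst.
- move=> s /=; rewrite in_itv/= => /andP[s0 st]; apply: (heat_op_Loo mk) => //.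
  + by rewrite subr_gt0.
  + by rewrite mulr_ge0 ?powR_ge0// ltW.
  + exact: measurable_slice.
  + exact: Fc.
Qed.

End duhamel.

(** * A priori estimates *)

Section a_priori.
Local Open Scope ereal_scope.
Context {R : realType} {d : measure_display} {X : measurableType d}.
Variables (mu : {sigma_finite_measure set X -> \bar R}) (k : R -> X -> X -> R).
Variables (dim C : R).
Hypothesis mk : markov_kernel mu k dim C.
Hypotheses (C_gt0 : (0 < C)%R) (dim_gt0 : (0 < dim)%R).
Local Notation leb := (@lebesgue_measure R).
Local Notation mR := (measurableTypeR R).
Local Notation Lbound := (Lbound mu).
Local Notation heat_op := (heat_op mu k).
Local Notation duhamel := (duhamel mu k).

Lemma le_Lbound N (f g : X -> \bar R) (c : R) : (0 <= N)%R ->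
  measurable_fun setT f -> measurable_fun setT g ->
  (forall x, 0 <= f x) -> (forall x, f x <= g x) -> Lbound N g c -> Lbound N f c.
Proof.
move=> N0 mf mg f0 fg; apply: le_trans; apply: ge0_le_integral => //.
- by move=> x _; exact: poweR_ge0.
- exact: (measurableT_comp (measurable_poweR N) mf).
- exact: (measurableT_comp (measurable_poweR N) mg).
- by move=> x _; exact: poweR_le.
Qed.

Lemma Lbound_le N (f : X -> \bar R) (c c' : R) : (0 <= N)%R ->
  (0 <= c)%R -> (c <= c')%R -> Lbound N f c -> Lbound N f c'.
Proof.
move=> N0 c0 cc fc; apply: le_trans fc _; rewrite lee_fin.
by apply: ge0_ler_powR; rewrite ?nnegrE// (le_trans c0).
Qed.

(** A triangle inequality with a wasteful factor 2, from [(x + y) ^ N <= (2 * max x y) ^ N] and the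
    superadditivity of powers; the later constants absorb the factor. *)
Lemma Lbound_add N (f g : X -> \bar R) (a b : R) : (1 <= N)%R ->
  measurable_fun setT f -> measurable_fun setT g ->
  (forall x, 0 <= f x) -> (forall x, 0 <= g x) -> (0 <= a)%R -> (0 <= b)%R ->
  Lbound N f a -> Lbound N g b -> Lbound N (fun x => f x + g x) (2 * (a + b)).
Proof.
move=> N1 mf mg f0 g0 a0 b0 fa gb; have N0 : (0 < N)%R by exact: lt_le_trans N1.
have mp (h : X -> \bar R) : measurable_fun setT h -> measurable_fun setT (fun x => h x `^ N).
  by move=> mh; exact: (measurableT_comp (measurable_poweR N) mh).
rewrite /Lbound.
apply: (@le_trans _ _ (\int[mu]_x ((2 `^ N)%:E * (f x `^ N + g x `^ N)))).
  apply: ge0_le_integral => //.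
  - by move=> x _; exact: poweR_ge0.
  - by apply: mp; exact: emeasurable_funD.
  - apply: emeasurable_funM; first exact: measurable_cst.
    by apply: emeasurable_funD; exact: mp.
  - move=> x _.
    have S (u v : \bar R) : 0 <= u -> 0 <= v -> u <= v ->
        (u + v) `^ N <= (2 `^ N)%:E * (u `^ N + v `^ N).
      move=> u0 v0 uv; apply: (@le_trans _ _ ((2%:E * v) `^ N)).
        apply: poweR_le; [exact: ltW|exact: adde_ge0|].
        by rewrite mule_natl mule2n leeD2r.
      rewrite poweRM ?lee_fin// poweR_EFin; apply: lee_wpmul2l.
        by rewrite lee_fin powR_ge0.
      by rewrite leeDr// poweR_ge0.
    have [fg|/ltW gf] := leP (f x) (g x); first exact: S.
    by rewrite addeC [X in _ <= _ * X]addeC; exact: S.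
rewrite ge0_integralZl_EFin//; last 2 first.
- by move=> x _; rewrite adde_ge0 ?poweR_ge0.
- by apply: emeasurable_funD; exact: mp.
have -> : \int[mu]_x (f x `^ N + g x `^ N) =
    \int[mu]_x (f x `^ N) + \int[mu]_x (g x `^ N).
  apply: (ge0_integralD mu measurableT).
  - by move=> x _; exact: poweR_ge0.
  - exact: mp.
  - by move=> x _; exact: poweR_ge0.
  - exact: mp.
rewrite powRM ?addr_ge0// EFinM; apply: lee_wpmul2l.
  by rewrite lee_fin powR_ge0.
apply: (@le_trans _ _ ((a `^ N)%:E + (b `^ N)%:E)); first exact: leeD.
by rewrite -EFinD lee_fin powR_superadditive.
Qed.

Variables (gamma p1 p2 e1 e2 alpha beta r q : R).
Hypotheses (gamma_gt0 : (0 < gamma)%R) (gamma_lt1 : (gamma < 1)%R).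
Hypotheses (e1_gt1 : (1 < e1)%R) (e1_p1 : (e1 <= p1)%R).
Hypotheses (e2_gt1 : (1 < e2)%R) (e2_p2 : (e2 <= p2)%R) (e2_e1 : (e2 <= e1)%R).
Hypotheses (alpha1 : (alpha * (e1 - 1) = 2 - gamma)%R).
Hypotheses (alpha2 : (alpha * (e2 - 1) = 1)%R).
Hypotheses (r_ge : (e1 <= r)%R) (dim_r : (dim / r = alpha - beta)%R).
Hypotheses (q_ge1 : (1 <= q)%R) (dim_q : (dim / q = alpha)%R) (q_r : (q <= r)%R).
Hypotheses (r_q1 : (r <= e1 * q)%R) (r_q2 : (r <= e2 * q)%R).
Hypotheses (beta_gt0 : (0 < beta)%R) (beta_e1 : (beta * e1 < 1)%R).
Hypotheses (beta_gamma : (1 - gamma < beta * (e1 - 1))%R).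

(** The set preserved by the iteration. One [delta] measures both bounds, so that a nonlinear term
    of degree [p] has size [delta ^ p] however its powers are distributed between them. *)
Definition small_solution (delta : R) (u : mR * X -> \bar R) : Prop :=
  [/\ measurable_fun setT u, forall p, 0 <= u p, past_null u,
      forall p, u p <= delta%:E &
      forall t, (0 < t)%R ->
        Lbound r (fun x => u (t, x)) (delta * t `^ (- beta))].

Definition mild_map (u0 : X -> \bar R) (u : mR * X -> \bar R) (z : mR * X) : \bar R :=
  heat_op z.1 u0 z.2 + duhamel (memory gamma (fun w => u w `^ p1)) z +
  duhamel (fun w => u w `^ p2) z.

Let beta_e2 : (beta * e2 <= beta * e1)%R. Proof. by rewrite ler_pM2l. Qed.
Let beta_lt : (beta < beta * e2)%R. Proof. by rewrite ltr_pMr. Qed.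

Ltac lin := move: beta_e2 beta_lt alpha1 alpha2 dim_r dim_q beta_gt0 beta_e1 beta_gamma gamma_gt0 gamma_lt1; lra.

Let r_gt0 : (0 < r)%R. Proof. by apply: lt_le_trans r_ge; exact: lt_trans e1_gt1. Qed.
Let q_gt0 : (0 < q)%R. Proof. exact: lt_le_trans q_ge1. Qed.

Section power.
Variables (p : R) (delta : R) (u : mR * X -> \bar R).
Hypotheses (p_gt1 : (1 < p)%R) (delta_gt0 : (0 < delta)%R)
  (us : small_solution delta u).

Lemma measurable_power : measurable_fun setT (fun w => u w `^ p).
Proof. by have [mu' _ _ _ _] := us; exact: (measurableT_comp (measurable_poweR p) mu'). Qed.

Lemma power_null : past_null (fun w => u w `^ p).
Proof.
have [_ _ un _ _] := us.
by move=> s x s0; rewrite un// poweR0r// gt_eqF// (lt_trans _ p_gt1).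
Qed.

(** Split [u ^ p = u ^ (p - e) * u ^ e]: the first factor is at most [delta ^ (p - e)], the second
    has [L ^ (r / e)] norm at most [(delta * s ^ (- beta)) ^ e]. *)
Lemma power_Lbound (e s : R) : (0 < e <= p)%R -> (0 < s)%R ->
  Lbound (r / e) (fun x => u (s, x) `^ p) (delta `^ p * s `^ (- (beta * e))).
Proof.
move=> /andP[e0 ep] s0; have [mu' u0 _ ud ub] := us.
have mus : measurable_fun setT (fun x => u (s, x)) by exact: measurable_slice.
have mpe (c : R) : measurable_fun setT (fun x => u (s, x) `^ c).
  exact: (measurableT_comp (measurable_poweR c) mus).
have -> : (delta `^ p * s `^ (- (beta * e)) =
    delta `^ (p - e) * (delta * s `^ (- beta)) `^ e)%R.
  rewrite (powRM _ (ltW delta_gt0) (powR_ge0 _ _)) mulrA -gt0_powRD// subrK.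
  by rewrite -powRrM mulNr.
apply: (@le_Lbound _ _ (fun x => (delta `^ (p - e))%:E * u (s, x) `^ e)).
- by rewrite divr_ge0// ltW.
- exact: mpe.
- by apply: emeasurable_funM; [exact: measurable_cst|exact: mpe].
- by move=> x; exact: poweR_ge0.
- move=> x; have := ud (s, x); have := u0 (s, x).
  case: (u (s, x)) => [v| |]//; rewrite !lee_fin => v0 vd.
  have [->|vn0] := eqVneq v 0%R.
    rewrite powR0 ?gt_eqF ?(lt_trans _ p_gt1)//.
    by rewrite mulr_ge0 ?powR_ge0.
  have vgt0 : (0 < v)%R by rewrite lt_neqAle eq_sym vn0.
  have -> : (v `^ p = v `^ (p - e) * v `^ e)%R by rewrite -gt0_powRD// subrK.
  apply: ler_wpM2r; first exact: powR_ge0.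
  by apply: ge0_ler_powR; rewrite ?subr_ge0 ?nnegrE// ltW.
apply: Lbound_scale.
- exact: powR_ge0.
- exact: powR_ge0.
- exact: mpe.
- by move=> x; exact: poweR_ge0.
rewrite /Lbound.
under eq_integral do rewrite -poweRrM [(e * _)%R]mulrC divfK ?gt_eqF//.
rewrite -powRrM [(e * _)%R]mulrC divfK ?gt_eqF//.
exact: ub.
Qed.

End power.

Let p1_gt1 : (1 < p1)%R. Proof. exact: lt_le_trans e1_p1. Qed.
Let p2_gt1 : (1 < p2)%R. Proof. exact: lt_le_trans e2_p2. Qed.

(** [e] stays free because two values are used: [e1] for the bounds in Lebesgue norms and [e1 - 1]
    for the sup bound. *)
Lemma memory_power_Lbound (e : R) : (0 < e <= p1)%R -> (e <= r)%R ->
  (1 - gamma <= beta * e < 1)%R ->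
  exists2 K : R, (0 < K)%R & forall delta u, (0 < delta)%R ->
    small_solution delta u -> forall t, (0 < t)%R ->
    Lbound (r / e) (fun x => memory gamma (fun w => u w `^ p1) (t, x))
      (K * delta `^ p1 * t `^ (- (beta * e + gamma - 1))).
Proof.
move=> e01 er /andP[be1 be2]; have [e0 ep] := andP e01.
have be0 : (0 <= beta * e < 1)%R.
  by rewrite be2 andbT mulr_ge0// ltW.
have a1 : (1 <= r / e)%R by rewrite ler_pdivlMr// mul1r.
have g01 : (0 <= gamma < 1)%R by rewrite gamma_lt1 ltW.
have [K K0 HK] := memory_Lbound mu g01 a1 be0.
exists K; first exact: K0.
  move=> delta u d0 us t t0.
have -> : (- (beta * e + gamma - 1) = 1 - gamma - beta * e)%R by ring.
apply: HK => //.
- exact: (@measurable_power p1 _ _ us).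
- by move=> w; exact: poweR_ge0.
- exact: (power_null p1_gt1 us).
- exact: powR_gt0.
- move=> s s0; exact: power_Lbound.
Qed.

(** One estimate for two targets: [N = r] with [betaN = beta] reproduces the decay, and [N = q] with
    [betaN = 0] bounds the critical norm. *)
Lemma mild_term_Lbound (N betaN : R) : (1 <= N)%R -> (dim / N = alpha - betaN)%R ->
  (0 <= betaN <= beta)%R -> (r <= e1 * N)%R -> (r <= e2 * N)%R -> (q <= N)%R ->
  exists2 K : R, (0 < K)%R & forall delta u eps u0,
    (0 < delta)%R -> small_solution delta u -> (0 < eps)%R ->
    measurable_fun setT u0 -> (forall x, 0 <= u0 x) -> Lbound q u0 eps ->
    forall t, (0 < t)%R ->
    Lbound N (fun x => mild_map u0 u (t, x))
      (K * (eps + delta `^ p1 + delta `^ p2) * t `^ (- betaN)).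
Proof.
move=> N1 dN /andP[bN0 bNb] rN1 rN2 qN.
have N0 : (0 < N)%R by exact: lt_le_trans N1.
have e1_gt0 : (0 < e1)%R by exact: lt_trans e1_gt1.
have e2_gt0 : (0 < e2)%R by exact: lt_trans e2_gt1.
have rN0 : r != 0%R by rewrite gt_eqF.
have NN0 : N != 0%R by rewrite gt_eqF.
have dimE (e : R) : (0 < e)%R ->
    (dim * ((r / e)^-1 - N^-1) = (alpha - beta) * e - (alpha - betaN))%R.
  by move=> e0; rewrite -dim_r -dN invf_div; ring.
have [K1 K10 HK1] : exists2 K : R, (0 < K)%R & forall delta u, (0 < delta)%R ->
    small_solution delta u -> forall t, (0 < t)%R ->
    Lbound N (fun x => duhamel (memory gamma (fun w => u w `^ p1)) (t, x))
      (K * delta `^ p1 * t `^ (- betaN)).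
  have be : (1 - gamma <= beta * e1 < 1)%R by apply/andP; split; lin.
  have [Km Km0 HKm] := memory_power_Lbound
    (introT andP (conj e1_gt0 e1_p1)) r_ge be.
  have b01 : (0 <= beta * e1 + gamma - 1 < 1)%R.
    by apply/andP; split; lin.
  have a1 : (1 <= r / e1)%R by rewrite ler_pdivlMr// mul1r.
  have aN : (r / e1 <= N)%R by rewrite ler_pdivrMr// mulrC.
  have A1 : ((alpha - beta) * e1 - (alpha - betaN) < 1)%R by lin.
  have [K K0 HK] := duhamel_Lbound mk C_gt0 dim_gt0 a1 aN b01 (esym (dimE e1 e1_gt0)) A1.
  exists (K * Km)%R; first exact: mulr_gt0.
  move=> delta u d0 us t t0.
  have := HK (memory gamma (fun w => u w `^ p1)) (Km * delta `^ p1)%R.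
  (* Smoothing, memory and decay add up to [2 - gamma - alpha * (e1 - 1) - betaN], where the
     relation [alpha1] cancels all but [- betaN]. *)
  have -> : (1 - ((alpha - beta) * e1 - (alpha - betaN)) - (beta * e1 + gamma - 1) = - betaN)%R.
    by lin.
  rewrite mulrA; apply => //.
  - apply: measurable_memory; first exact: (@measurable_power p1 _ _ us).
    by move=> w; exact: poweR_ge0.
  - by move=> w; apply: memory_ge0 => w'; exact: poweR_ge0.
  - apply: memory_null; exact: (power_null p1_gt1 us).
  - by rewrite mulr_gt0// powR_gt0.
  - by move=> s s0; exact: HKm.
have [K2 K20 HK2] : exists2 K : R, (0 < K)%R & forall delta u, (0 < delta)%R ->
    small_solution delta u -> forall t, (0 < t)%R ->
    Lbound N (fun x => duhamel (fun w => u w `^ p2) (t, x))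
      (K * delta `^ p2 * t `^ (- betaN)).
  have b01 : (0 <= beta * e2 < 1)%R.
    by apply/andP; split; [rewrite mulr_ge0// ltW|exact: le_lt_trans beta_e1].
  have a1 : (1 <= r / e2)%R by rewrite ler_pdivlMr// mul1r (le_trans e2_e1).
  have aN : (r / e2 <= N)%R by rewrite ler_pdivrMr// mulrC.
  have A1 : ((alpha - beta) * e2 - (alpha - betaN) < 1)%R by lin.
  have [K K0 HK] := duhamel_Lbound mk C_gt0 dim_gt0 a1 aN b01 (esym (dimE e2 e2_gt0)) A1.
  exists K; first exact: K0.
  move=> delta u d0 us t t0.
  have := HK (fun w => u w `^ p2) (delta `^ p2)%R.
  have -> : (1 - ((alpha - beta) * e2 - (alpha - betaN)) - beta * e2 = - betaN)%R.
    by lin.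
  apply => //.
  - exact: (@measurable_power p2 _ _ us).
  - by move=> w; exact: poweR_ge0.
  - exact: (power_null p2_gt1 us).
  - by rewrite powR_gt0.
  - move=> s s0; apply: (power_Lbound p2_gt1 d0 us) => //.
    by rewrite e2_gt0.
pose K0 := (C `^ (q^-1 - N^-1))%R.
have K00 : (0 < K0)%R by rewrite powR_gt0.
(* The 4 pays for the two factors 2 of [Lbound_add]. *)
exists (4 * (K0 + K1 + K2))%R; first by rewrite mulr_gt0// !addr_gt0.
move=> delta u eps u0 d0 us eps0 mu0 u00 u0q t t0.
have H0 : Lbound N (heat_op t u0) (K0 * eps * t `^ (- betaN)).
  have := heat_op_Lbound mk C_gt0 t0 q_ge1 qN eps0 mu0 u00 u0q.
  rewrite (powRM _ (ltW C_gt0) (powR_ge0 _ _)) -powRrM.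
  have -> : (- dim * (q^-1 - N^-1) = - betaN)%R.
    have -> : (- dim * (q^-1 - N^-1) = dim / N - dim / q)%R by ring.
    by rewrite dN dim_q; ring.
  by rewrite mulrAC.
have H1 := HK1 _ _ d0 us _ t0; have H2 := HK2 _ _ d0 us _ t0.
have mpow (p : R) : (1 < p)%R -> measurable_fun setT (fun w => u w `^ p).
  by move=> _; exact: (@measurable_power p _ _ us).
have p0 (p : R) w : 0 <= u w `^ p by exact: poweR_ge0.
have mm := measurable_memory (mpow p1 p1_gt1) (p0 p1) gamma.
have m0 w : 0 <= memory gamma (fun w => u w `^ p1) w by exact: memory_ge0.
have md1 := measurable_duhamel mk mm m0.
have md2 := measurable_duhamel mk (mpow p2 p2_gt1) (p0 p2).
have T0 : (0 <= t `^ (- betaN))%R by exact: powR_ge0.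
have D1 : (0 <= delta `^ p1)%R by exact: powR_ge0.
have D2 : (0 <= delta `^ p2)%R by exact: powR_ge0.
apply: (@Lbound_le _ _ (2 * (2 * (K0 * eps * t `^ (- betaN) + K1 * delta `^ p1 * t `^ (- betaN))
    + K2 * delta `^ p2 * t `^ (- betaN)))%R).
- exact: ltW.
- by rewrite !(mulr_ge0, addr_ge0)// ltW.
- rewrite -!mulrDl !mulrA -!mulrDl mulrA; apply: ler_wpM2r => //.
  have k0 := ltW K00; have k1 := ltW K10; have k2 := ltW K20; have ee := ltW eps0.
  have := mulr_ge0 k0 D1; have := mulr_ge0 k0 D2; have := mulr_ge0 k1 ee.
  have := mulr_ge0 k1 D1; have := mulr_ge0 k1 D2; have := mulr_ge0 k2 ee.
  have := mulr_ge0 k2 D1; have := mulr_ge0 k2 D2; have := mulr_ge0 k0 ee.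
  lra.
have mh := measurable_heat_op1 mk t mu0 u00.
have h0 x : 0 <= heat_op t u0 x by exact: (heat_op_ge0 mk).
have ms1 := measurable_slice md1 t.
have ms2 := measurable_slice md2 t.
have d10 x : 0 <= duhamel (memory gamma (fun w => u w `^ p1)) (t, x).
  exact: (duhamel_ge0 mk).
have d20 x : 0 <= duhamel (fun w => u w `^ p2) (t, x) by exact: (duhamel_ge0 mk).
have c0 : (0 <= K0 * eps * t `^ (- betaN))%R by rewrite !mulr_ge0// ltW.
have c1 : (0 <= K1 * delta `^ p1 * t `^ (- betaN))%R by rewrite !mulr_ge0// ltW.
have c2 : (0 <= K2 * delta `^ p2 * t `^ (- betaN))%R by rewrite !mulr_ge0// ltW.
have H01 := Lbound_add N1 mh ms1 h0 d10 c0 c1 H0 H1.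
apply: (Lbound_add N1 (emeasurable_funD mh ms1) ms2 _ d20 _ c2 H01 H2).
  by move=> x; exact: adde_ge0.
by rewrite mulr_ge0// addr_ge0.
Qed.

(** With [e1 - 1] and [e2 - 1] in [power_Lbound] the exponents of [t] are
    [2 - gamma - alpha * (e1 - 1)] and [1 - alpha * (e2 - 1)], both 0. For the memory term,
    integrability of the smoothing singularity is the condition [1 - gamma < beta * (e1 - 1)]. *)
Lemma mild_term_Loo :
  exists2 K : R, (0 < K)%R & forall delta u eps u0,
    (0 < delta)%R -> small_solution delta u -> (0 < eps)%R ->
    (forall t x, heat_op t u0 x <= eps%:E) ->
    forall z, mild_map u0 u z <= (K * (eps + delta `^ p1 + delta `^ p2))%:E.
Proof.
have e10 : (0 < e1 - 1)%R by rewrite subr_gt0.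
have e20 : (0 < e2 - 1)%R by rewrite subr_gt0.
have rN0 : r != 0%R by rewrite gt_eqF.
have dimE (e : R) : (0 < e)%R -> (dim * (r / e)^-1 = (alpha - beta) * e)%R.
  by move=> e0; rewrite -dim_r invf_div; ring.
have e1p : (0 < e1 - 1 <= p1)%R by rewrite e10/= lerBlDr (le_trans e1_p1)// lerDl.
have e2p : (0 < e2 - 1 <= p2)%R by rewrite e20/= lerBlDr (le_trans e2_p2)// lerDl.
have [K1 K10 HK1] : exists2 K : R, (0 < K)%R & forall delta u, (0 < delta)%R ->
    small_solution delta u -> forall t x, (0 < t)%R ->
    duhamel (memory gamma (fun w => u w `^ p1)) (t, x) <= (K * delta `^ p1)%:E.
  have be : (1 - gamma <= beta * (e1 - 1) < 1)%R by apply/andP; split; lin.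
  have er : (e1 - 1 <= r)%R by rewrite lerBlDr (le_trans r_ge)// lerDl.
  have [Km Km0 HKm] := memory_power_Lbound e1p er be.
  have b01 : (0 <= beta * (e1 - 1) + gamma - 1 < 1)%R by apply/andP; split; lin.
  have a1 : (1 <= r / (e1 - 1))%R by rewrite ler_pdivlMr// mul1r.
  have A1 : ((alpha - beta) * (e1 - 1) < 1)%R by lin.
  have [K K0 HK] := duhamel_Loo mk C_gt0 dim_gt0 a1 b01 (esym (dimE _ e10)) A1.
  exists (K * Km)%R; first exact: mulr_gt0.
  move=> delta u d0 us t x t0.
  have := HK (memory gamma (fun w => u w `^ p1)) (Km * delta `^ p1)%R.
  have -> : (1 - (alpha - beta) * (e1 - 1) - (beta * (e1 - 1) + gamma - 1) = 0)%R.
    by lin.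
  rewrite mulrA => H; rewrite -[X in X%:E]mulr1 -(powRr0 t); apply: H => //.
  - apply: measurable_memory; first exact: (@measurable_power p1 _ _ us).
    by move=> w; exact: poweR_ge0.
  - by move=> w; apply: memory_ge0 => w'; exact: poweR_ge0.
  - apply: memory_null; exact: (power_null p1_gt1 us).
  - by rewrite mulr_gt0// powR_gt0.
  - by move=> s s0; exact: HKm.
have [K2 K20 HK2] : exists2 K : R, (0 < K)%R & forall delta u, (0 < delta)%R ->
    small_solution delta u -> forall t x, (0 < t)%R ->
    duhamel (fun w => u w `^ p2) (t, x) <= (K * delta `^ p2)%:E.
  have b01 : (0 <= beta * (e2 - 1) < 1)%R by apply/andP; split; lin.
  have a1 : (1 <= r / (e2 - 1))%R.
    by rewrite ler_pdivlMr// mul1r lerBlDr (le_trans e2_e1)// (le_trans r_ge)// lerDl.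
  have A1 : ((alpha - beta) * (e2 - 1) < 1)%R by lin.
  have [K K0 HK] := duhamel_Loo mk C_gt0 dim_gt0 a1 b01 (esym (dimE _ e20)) A1.
  exists K; first exact: K0.
  move=> delta u d0 us t x t0.
  have := HK (fun w => u w `^ p2) (delta `^ p2)%R.
  have -> : (1 - (alpha - beta) * (e2 - 1) - beta * (e2 - 1) = 0)%R.
    by lin.
  move=> H; rewrite -[X in X%:E]mulr1 -(powRr0 t); apply: H => //.
  - exact: (@measurable_power p2 _ _ us).
  - by move=> w; exact: poweR_ge0.
  - exact: (power_null p2_gt1 us).
  - by rewrite powR_gt0.
  - by move=> s s0; exact: (power_Lbound p2_gt1 d0 us).
exists (1 + K1 + K2)%R; first by rewrite !addr_gt0.
move=> delta u eps u0 d0 us eps0 u0e [t x].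
have D1 : (0 <= delta `^ p1)%R by exact: powR_ge0.
have D2 : (0 <= delta `^ p2)%R by exact: powR_ge0.
have M0 w : 0 <= memory gamma (fun w => u w `^ p1) w.
  by apply: memory_ge0 => w'; exact: poweR_ge0.
have [t0|t0] := leP t 0%R.
  rewrite /mild_map/= (heat_op_le0 mk)// add0e.
  rewrite (duhamel_null mk (memory_null (power_null p1_gt1 us) gamma))//.
  rewrite (duhamel_null mk (power_null p2_gt1 us))// adde0 lee_fin.
  by rewrite mulr_ge0// !addr_ge0// ltW.
apply: (@le_trans _ _ (eps%:E + (K1 * delta `^ p1)%:E + (K2 * delta `^ p2)%:E)).
  apply: leeD; [apply: leeD|].
  - exact: u0e.
  - exact: HK1.
  - exact: HK2.
rewrite -!EFinD lee_fin.
have k1 := ltW K10; have k2 := ltW K20; have ee := ltW eps0.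
have := mulr_ge0 k1 ee; have := mulr_ge0 k1 D2; have := mulr_ge0 k2 ee.
have := mulr_ge0 k2 D1.
lra.
Qed.

End a_priori.

(** * Monotone iteration *)

Section monotone_limits.
Local Open Scope ereal_scope.
Context {R : realType} {d : measure_display} {T : measurableType d}.

Record monotone_cvg (f : (T -> \bar R)^nat) (g : T -> \bar R) : Prop := MonotoneCvg {
  mc_measurable : forall i, measurable_fun setT (f i) ;
  mc_ge0 : forall i x, 0 <= f i x ;
  mc_nd : forall i j x, (i <= j)%N -> f i x <= f j x ;
  mc_cvg : forall x, f ^~ x @ \oo --> g x
}.

Lemma mc_lim_measurable f g : monotone_cvg f g -> measurable_fun setT g.
Proof. by case=> mf _ _ fg; apply: (emeasurable_fun_cvg f) => // x _; exact: fg. Qed.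

Lemma mc_lim_ge0 f g x : monotone_cvg f g -> 0 <= g x.
Proof.
case=> mf f0 _ fg; apply: (cvge_to_ge (fg x)).
by near=> i; exact: f0.
Unshelve. all: by end_near. Qed.

Lemma monotone_cvg_integral (m : {measure set T -> \bar R}) f g : monotone_cvg f g ->
  \int[m]_x f i x @[i --> \oo] --> \int[m]_x g x.
Proof.
case=> mf f0 nd fg.
have -> : \int[m]_x g x = \int[m]_x (fun y => limn (f ^~ y)) x.
  by apply: eq_integral => x _; apply/esym/cvg_lim => //; exact: fg.
apply: cvg_monotone_convergence => //.
by move=> x _ i j; exact: nd.
Qed.

(** The uniform bound [M] makes the limit finite, so that the continuity of real powers applies. *)
Lemma monotone_cvg_poweR f g p M : (1 <= p)%R -> monotone_cvg f g ->
  (forall i x, f i x <= M%:E) ->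
  monotone_cvg (fun i x => f i x `^ p) (fun x => g x `^ p).
Proof.
move=> p1 fg fM; have p0 : (0 < p)%R by exact: lt_le_trans p1.
have  [mf f0 nd cfg] := fg; split.
- by move=> i; exact: (measurableT_comp (measurable_poweR p) (mf i)).
- by move=> i x; exact: poweR_ge0.
- by move=> i j x ij; apply: poweR_le; [exact: ltW|exact: f0|exact: nd].
move=> x.
have fE i : f i x = (fine (f i x))%:E.
  by rewrite fineK// ge0_fin_numE ?(le_lt_trans (fM i x)) ?ltry.
have gE : g x = (fine (g x))%:E.
  rewrite fineK// ge0_fin_numE ?(mc_lim_ge0 _ fg)//.
  apply: (@le_lt_trans _ _ M%:E); last exact: ltry.
  by apply: (cvge_to_le (cfg x)); near=> i; exact: fM.
rewrite gE poweR_EFin.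
under eq_cvg do rewrite fE poweR_EFin.
apply: cvg_EFin; first by near=> i.
apply: cvg_powR => //.
  by move=> i; exact: fine_ge0.
  by apply: fine_ge0; exact: (mc_lim_ge0 _ fg).
by have := cfg x; rewrite gE => /fine_cvgP[].
Unshelve. all: by end_near. Qed.

End monotone_limits.

(** [r p] is the radius where [x ^ p = x / (4 * K)]. Below both radii, and with
    [eps = delta / (4 * K)], each of the three summands is at most [delta / (4 * K)], which gives
    three quarters of [delta] in total. *)
Lemma small_radius {R : realType} (K p1 p2 : R) : 0 < K -> 1 < p1 -> 1 < p2 ->
  exists2 delta : R, 0 < delta & exists2 eps : R, 0 < eps &
    K * (eps + delta `^ p1 + delta `^ p2) <= delta.
Proof.
move=> K0 p11 p21; have K40 : 0 < 4 * K by rewrite mulr_gt0.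
pose r (p : R) := ((4 * K)^-1) `^ (p - 1)^-1.
have r0 p : 0 < r p by rewrite powR_gt0// invr_gt0.
have small p x : 1 < p -> 0 < x -> x <= r p -> x `^ p <= x / (4 * K).
  move=> p1' x0 xr; have p0 : 0 < p by exact: lt_trans p1'.
  rewrite -(mulr_powRB1 (ltW x0) p0); apply: ler_wpM2l; first exact: ltW.
  have -> : (4 * K)^-1 = r p `^ (p - 1).
    by rewrite /r -powRrM mulVf ?subr_eq0 ?gt_eqF// powRr1// invr_ge0 ltW.
  by apply: ge0_ler_powR; rewrite ?subr_ge0 ?nnegrE// ltW.
pose delta := Num.min (r p1) (r p2).
have d0 : 0 < delta by rewrite /delta lt_min !r0.
have d1 : delta `^ p1 <= delta / (4 * K).
  by apply: small => //; rewrite /delta ge_min lexx.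
have d2 : delta `^ p2 <= delta / (4 * K).
  by apply: small => //; rewrite /delta ge_min lexx orbT.
exists delta => //; exists (delta / (4 * K)); first by rewrite divr_gt0.
apply: (@le_trans _ _ (K * (delta / (4 * K) + delta / (4 * K) + delta / (4 * K)))).
  by apply: ler_wpM2l; [exact: ltW|rewrite !lerD].
have -> : K * (delta / (4 * K) + delta / (4 * K) + delta / (4 * K)) = delta * (3 / 4).
  by field; rewrite gt_eqF.
by apply: ler_piMr; [exact: ltW|lra].
Qed.

Section existence.
Local Open Scope ereal_scope.
Context {R : realType} {d : measure_display} {X : measurableType d}.
Variables (mu : {sigma_finite_measure set X -> \bar R}) (k : R -> X -> X -> R).
Variables (dim C : R).
Hypothesis mk : markov_kernel mu k dim C.
Hypotheses (C_gt0 : (0 < C)%R) (dim_gt0 : (0 < dim)%R).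
Local Notation leb := (@lebesgue_measure R).
Local Notation mR := (measurableTypeR R).
Local Notation Lbound := (Lbound mu).
Local Notation heat_op := (heat_op mu k).
Local Notation duhamel := (duhamel mu k).

Let measurable_shift : measurable_fun setT (fun q : (mR * X) * mR => (q.1.1 - q.2 : R)%R).
Proof.
apply: measurable_funB; last exact: measurable_snd.
by apply: (measurableT_comp measurable_fst); exact: measurable_fst.
Qed.

Lemma memory_monotone_cvg gamma (F : (mR * X -> \bar R)^nat) G :
  monotone_cvg F G -> monotone_cvg (fun i => memory gamma (F i)) (memory gamma G).
Proof.
move=> FG; have [mF F0 nd cF] := FG.
have H z : monotone_cvg (fun i (s : mR) => (memory_weight gamma (z.1 - s))%:E * F i (s, z.2))
    (fun s => (memory_weight gamma (z.1 - s))%:E * G (s, z.2)).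
  split.
  - move=> i; apply: emeasurable_funM; last exact: (measurable_path (mF i)).
    apply/measurable_EFinP; apply: (measurableT_comp (measurable_memory_weight gamma)).
    by apply: measurable_funB; [exact: measurable_cst|exact: measurable_id].
  - by move=> i s; rewrite mule_ge0// lee_fin memory_weight_ge0.
  - move=> i j s ij; apply: lee_wpmul2l; first by rewrite lee_fin memory_weight_ge0.
    exact: nd.
  - by move=> s; apply: cvgeZl; [|exact: cF].
split.
- by move=> i; exact: measurable_memory.
- by move=> i z; exact: memory_ge0.
- move=> i j z ij; have [mh h0 hnd _] := H z.
  by apply: ge0_le_integral => // s _; exact: hnd.
- by move=> z; exact: (@monotone_cvg_integral _ _ _ leb _ _ (H z)).
Qed.

Lemma heat_op_monotone_cvg t y (F : (X -> \bar R)^nat) G : monotone_cvg F G ->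
  monotone_cvg (fun i x => (k t x y)%:E * F i x) (fun x => (k t x y)%:E * G x).
Proof.
move=> FG; have [mF F0 nd cF] := FG; split.
- move=> i; apply: emeasurable_funM; last exact: mF.
  apply/measurable_EFinP; apply: (mk_measurable mk);
    [exact: measurable_cst|exact: measurable_id|exact: measurable_cst].
- by move=> i x; rewrite mule_ge0// lee_fin (mk_ge0 mk).
- by move=> i j x ij; apply: lee_wpmul2l; [rewrite lee_fin (mk_ge0 mk)|exact: nd].
- by move=> x; apply: cvgeZl; [|exact: cF].
Qed.

Lemma slice_monotone_cvg (F : (mR * X -> \bar R)^nat) G s :
  monotone_cvg F G -> monotone_cvg (fun i x => F i (s, x)) (fun x => G (s, x)).
Proof.
move=> [mF F0 nd cF]; split => //.
- by move=> i; exact: measurable_slice.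
- by move=> i j x ij; exact: nd.
Qed.

Lemma duhamel_monotone_cvg (F : (mR * X -> \bar R)^nat) G :
  monotone_cvg F G -> monotone_cvg (fun i => duhamel (F i)) (duhamel G).
Proof.
move=> FG; have [mF F0 nd cF] := FG.
have H z : monotone_cvg (fun i (s : mR) => heat_op (z.1 - s) (fun x => F i (s, x)) z.2)
    (fun s => heat_op (z.1 - s) (fun x => G (s, x)) z.2).
  split.
  - move=> i; apply: (measurable_heat_op mk (f := F i) (y := cst z.2)) => //.
    by apply: measurable_funB; [exact: measurable_cst|exact: measurable_id].
  - by move=> i s; exact: (heat_op_ge0 mk).
  - move=> i j s ij.
    have [mh h0 hnd _] := heat_op_monotone_cvg (z.1 - s) z.2 (slice_monotone_cvg s FG).
    by apply: ge0_le_integral => // x _; exact: hnd.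
  - move=> s.
    exact: (@monotone_cvg_integral _ _ _ mu _ _ (heat_op_monotone_cvg (z.1 - s) z.2 (slice_monotone_cvg s FG))).
split.
- by move=> i; exact: (measurable_duhamel mk).
- by move=> i z; exact: (duhamel_ge0 mk).
- move=> i j z ij; have [mh h0 hnd _] := H z.
  by apply: ge0_le_integral => // s _; exact: hnd.
- by move=> z; exact: (@monotone_cvg_integral _ _ _ leb _ _ (H z)).
Qed.

Variables (gamma p1 p2 e1 e2 alpha beta r q : R).
Hypotheses (gamma_gt0 : (0 < gamma)%R) (gamma_lt1 : (gamma < 1)%R).
Hypotheses (e1_gt1 : (1 < e1)%R) (e1_p1 : (e1 <= p1)%R).
Hypotheses (e2_gt1 : (1 < e2)%R) (e2_p2 : (e2 <= p2)%R) (e2_e1 : (e2 <= e1)%R).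
Hypotheses (alpha1 : (alpha * (e1 - 1) = 2 - gamma)%R).
Hypotheses (alpha2 : (alpha * (e2 - 1) = 1)%R).
Hypotheses (r_ge : (e1 <= r)%R) (dim_r : (dim / r = alpha - beta)%R).
Hypotheses (q_ge1 : (1 <= q)%R) (dim_q : (dim / q = alpha)%R) (q_r : (q <= r)%R).
Hypotheses (r_q1 : (r <= e1 * q)%R) (r_q2 : (r <= e2 * q)%R).
Hypotheses (beta_gt0 : (0 < beta)%R) (beta_e1 : (beta * e1 < 1)%R).
Hypotheses (beta_gamma : (1 - gamma < beta * (e1 - 1))%R).
Local Notation small_solution := (small_solution mu beta r).
Local Notation mild_map := (mild_map mu k gamma p1 p2).

Let p1_gt1 : (1 < p1)%R. Proof. exact: lt_le_trans e1_p1. Qed.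
Let p2_gt1 : (1 < p2)%R. Proof. exact: lt_le_trans e2_p2. Qed.

Lemma small_solution0 delta : (0 <= delta)%R -> small_solution delta (cst 0).
Proof.
move=> d0; split.
- exact: measurable_cst.
- by [].
- by [].
- by move=> z; rewrite lee_fin.
- by move=> t t0; rewrite /Lbound integral0_eq ?lee_fin ?powR_ge0// => x _;
    rewrite poweR0r// gt_eqF// (lt_le_trans _ r_ge)// (lt_trans _ e1_gt1).
Qed.

(** It serves twice: for a sequence constant from index 1 on it yields the monotonicity of the map,
    and for the iterates the passage to the limit. *)
Lemma mild_map_monotone_cvg u0 (F : (mR * X -> \bar R)^nat) G M z :
  (forall x, 0 <= u0 x) -> monotone_cvg F G -> (forall i w, F i w <= M%:E) ->
  (forall i j, (i <= j)%N -> mild_map u0 (F i) z <= mild_map u0 (F j) z) /\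
  (mild_map u0 (F i) z @[i --> \oo] --> mild_map u0 G z).
Proof.
move=> u00 FG FM.
have H (p : R) : (1 < p)%R -> monotone_cvg (fun i w => F i w `^ p) (fun w => G w `^ p).
  by move=> pgt1; exact: (monotone_cvg_poweR (ltW pgt1) FG FM).
have [_ a0 and ac] := duhamel_monotone_cvg (memory_monotone_cvg gamma (H _ p1_gt1)).
have [_ b0 bnd bc] := duhamel_monotone_cvg (H _ p2_gt1).
have h0 : 0 <= heat_op z.1 u0 z.2 by exact: (heat_op_ge0 mk).
have A0 : 0 <= duhamel (memory gamma (fun w => G w `^ p1)) z.
  by apply: (cvge_to_ge (ac z)); apply: nearW => i; exact: a0.
have B0 : 0 <= duhamel (fun w => G w `^ p2) z.
  by apply: (cvge_to_ge (bc z)); apply: nearW => i; exact: b0.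
split.
  move=> i j ij; apply: leeD; last exact: bnd.
  by apply: leeD; [exact: lexx|exact: and].
apply: cvgeD; last exact: bc.
  apply: ge0_adde_def; rewrite inE; last exact: B0.
  exact: (adde_ge0 h0 A0).
apply: cvgeD; last exact: ac.
  by apply: ge0_adde_def; rewrite inE; [exact: h0|exact: A0].
exact: cvg_cst.
Qed.

(** The datum enters through the sup of its heat flow, which an essential bound on [u0] controls.
    [eps] is fixed by [small_radius], hence by the kernel and the exponents. *)
Lemma mild_existence : exists2 eps : R, (0 < eps)%R & forall u0,
  measurable_fun setT u0 -> (forall x, 0 <= u0 x) -> Lbound q u0 eps ->
  (forall t x, heat_op t u0 x <= eps%:E) ->
  exists delta c u, [/\ (0 < delta)%R, (0 < c)%R, small_solution delta u,
    forall z, u z = mild_map u0 u z &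
    forall t, (0 < t)%R -> Lbound q (fun x => u (t, x)) c].
Proof.
have r_gt0 : (0 < r)%R by apply: lt_le_trans r_ge; exact: lt_trans e1_gt1.
have e10 : (0 < e1)%R by exact: lt_trans e1_gt1.
have q_gt0 : (0 < q)%R by exact: lt_le_trans q_ge1.
(* The instance [N = r] and the sup bound decide the radius. The second instance, [N = q] with
   [betaN = 0], is applied to the fixed point at the end and only yields the constant [c]. *)
have [K1 K10 HK1] := mild_term_Lbound mk C_gt0 dim_gt0 gamma_gt0 gamma_lt1 e1_gt1
  e1_p1 e2_gt1 e2_p2 e2_e1 alpha1 alpha2 r_ge dim_r q_ge1 dim_q beta_gt0 beta_e1 beta_gamma
  (le_trans q_ge1 q_r) dim_r (introT andP (conj (ltW beta_gt0) (lexx beta)))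
  (ler_peMl (ltW r_gt0) (ltW e1_gt1)) (ler_peMl (ltW r_gt0) (ltW e2_gt1)) q_r.
have [K2 K20 HK2] := mild_term_Lbound mk C_gt0 dim_gt0 gamma_gt0 gamma_lt1 e1_gt1
  e1_p1 e2_gt1 e2_p2 e2_e1 alpha1 alpha2 r_ge dim_r q_ge1 dim_q beta_gt0 beta_e1 beta_gamma
  q_ge1 (etrans dim_q (esym (subr0 alpha))) (introT andP (conj (lexx 0%R) (ltW beta_gt0)))
  r_q1 r_q2 (lexx q).
have [K3 K30 HK3] := mild_term_Loo mk C_gt0 dim_gt0 gamma_gt0 gamma_lt1 e1_gt1
  e1_p1 e2_gt1 e2_p2 e2_e1 alpha1 alpha2 r_ge dim_r dim_q beta_gt0 beta_e1 beta_gamma.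
have K130 : (0 < K1 + K3)%R by exact: addr_gt0.
have [delta d0 [eps eps0 Kd]] := small_radius K130 p1_gt1 p2_gt1.
exists eps => // u0 mu0 u00 u0q u0e.
pose S := (eps + delta `^ p1 + delta `^ p2)%R.
have S0 : (0 < S)%R by rewrite /S !addr_gt0 ?powR_gt0.
have KS1 : (K1 * S <= delta)%R.
  by apply: le_trans Kd; apply: ler_wpM2r; [exact: ltW|rewrite lerDl ltW].
have KS3 : (K3 * S <= delta)%R.
  by apply: le_trans Kd; apply: ler_wpM2r; [exact: ltW|rewrite lerDr ltW].
have step u : small_solution delta u -> small_solution delta (mild_map u0 u).
  move=> us; have mp (p : R) : measurable_fun setT (fun w => u w `^ p).
    exact: (@measurable_power _ _ _ _ _ _ p _ _ us).
  have p0 (p : R) w : 0 <= u w `^ p by exact: poweR_ge0.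
  have m0 w : 0 <= memory gamma (fun w => u w `^ p1) w by exact: memory_ge0.
  have mm := measurable_memory (mp p1) (p0 p1) gamma.
  split.
  - apply: emeasurable_funD; [apply: emeasurable_funD|].
    + apply: (measurable_heat_op mk (f := fun z : (mR * X) * X => u0 z.2)).
      * exact: measurable_fst.
      * by apply: (measurableT_comp mu0); exact: measurable_snd.
      * by move=> z; exact: u00.
      * exact: measurable_snd.
    + exact: (measurable_duhamel mk mm m0).
    + exact: (measurable_duhamel mk (mp p2) (p0 p2)).
  - move=> z; apply: adde_ge0; [apply: adde_ge0|].
    + exact: (heat_op_ge0 mk).
    + exact: (duhamel_ge0 mk m0).
    + exact: (duhamel_ge0 mk (p0 p2)).
  - move=> s x s0; rewrite /mild_map/= (heat_op_le0 mk)// add0e.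
    rewrite (duhamel_null mk (memory_null (power_null p1_gt1 us) gamma))//.
    by rewrite (duhamel_null mk (power_null p2_gt1 us))// adde0.
  - move=> z; apply: le_trans (HK3 _ _ _ _ d0 us eps0 u0e z) _.
    by rewrite lee_fin.
  - move=> t t0; apply: Lbound_le (HK1 _ _ _ _ d0 us eps0 mu0 u00 u0q t t0).
    + exact: ltW.
    + by rewrite !mulr_ge0 ?powR_ge0// ltW.
    + by apply: ler_wpM2r; [exact: powR_ge0|].
pose un i := iter i (mild_map u0) (cst 0).
have us i : small_solution delta (un i).
  by elim: i => [|i ih]; [exact/small_solution0/ltW|exact: step].
have und i z : un i z <= un i.+1 z.
  elim: i z => [|i ih] z; first by have [_ u0' _ _ _] := us 1%N; exact: u0'.
  (* The step of the induction compares the images of [un i] and [un i.+1], viewed as the increasing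
     sequence [un i, un i.+1, un i.+1, ...]. *)
  pose F j := if j is 0%N then un i else un i.+1.
  have FG : monotone_cvg F (un i.+1).
    have [m1 g1 _ _ _] := us i; have [m2 g2 _ _ _] := us i.+1.
    split; [by case|by case| |].
      by move=> [|a] [|b] x //= _; exact: ih.
    by move=> x; rewrite -(cvg_shiftS (fun j => F j x)); exact: cvg_cst.
  have FM j w : F j w <= delta%:E.
    by case: j => [|j]; [have [_ _ _ h _] := us i|have [_ _ _ h _] := us i.+1]; exact: h.
  by have [h _] := mild_map_monotone_cvg z u00 FG FM; exact: (h 0 1)%N.
have uM i z : un i z <= delta%:E by have [_ _ _ h _] := us i; exact: h.
pose u z := limn (un ^~ z).
have ucvg : monotone_cvg un u.
  have nd i j z : (i <= j)%N -> un i z <= un j z.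
    by move=> ij; apply: (@nondecreasing_seqP _ _ (un ^~ z)).1 => // m; exact: und.
  split => //.
  - by move=> i; have [] := us i.
  - by move=> i; have [] := us i.
  - by move=> z; apply: ereal_nondecreasing_is_cvgn => i j; exact: nd.
have ufix z : u z = mild_map u0 u z.
  have [_ h] := mild_map_monotone_cvg z u00 ucvg uM.
  have [_ _ _ cu] := ucvg; have := cu z; rewrite -(cvg_shiftS (un ^~ z)) => h'.
  exact: (cvg_unique _ h' h).
have uLim N c t : (1 <= N)%R -> (forall i, Lbound N (fun x => un i (t, x)) c) ->
    Lbound N (fun x => u (t, x)) c.
  move=> N1 H.
  have W := @monotone_cvg_integral _ _ _ mu _ _
    (monotone_cvg_poweR N1 (slice_monotone_cvg t ucvg) (fun i x => uM i (t, x))).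
  by apply: (cvge_to_le W); near=> i; exact: H.
have usm : small_solution delta u.
  split.
  - exact: (mc_lim_measurable ucvg).
  - by move=> z; exact: (mc_lim_ge0 _ ucvg).
  - move=> s x s0; apply/cvg_lim => //.
    have -> : un ^~ (s, x) = cst 0.
      by apply/funext => i; have [_ _ h _ _] := us i; exact: h.
    exact: cvg_cst.
  - move=> z; have [_ _ _ cu] := ucvg.
    by apply: (cvge_to_le (cu z)); near=> i; exact: uM.
  - move=> t t0; apply: uLim; first exact: le_trans q_r.
    by move=> i; have [_ _ _ _ h] := us i; exact: h.
exists delta, (K2 * S)%R, u; split => //; first exact: mulr_gt0.
move=> t t0; have := HK2 _ _ _ _ d0 usm eps0 mu0 u00 u0q t t0.
rewrite oppr0 powRr0 mulr1.
by under [X in Lbound _ X _ -> _]eq_fun do rewrite -ufix.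
Unshelve. all: by end_near. Qed.

End existence.

(** * Exponents *)

Section exponents.
Context {R : realType}.

Record critical_exponents (dim gamma p1 p2 q e1 e2 alpha beta r : R) : Prop := CriticalExponents {
  ce_e1_gt1 : 1 < e1 ; ce_e1_p1 : e1 <= p1 ;
  ce_e2_gt1 : 1 < e2 ; ce_e2_p2 : e2 <= p2 ; ce_e2_e1 : e2 <= e1 ;
  ce_alpha1 : alpha * (e1 - 1) = 2 - gamma ; ce_alpha2 : alpha * (e2 - 1) = 1 ;
  ce_r_ge : e1 <= r ; ce_dim_r : dim / r = alpha - beta ;
  ce_q_ge1 : 1 <= q ; ce_dim_q : dim / q = alpha ; ce_q_r : q <= r ;
  ce_r_q1 : r <= e1 * q ; ce_r_q2 : r <= e2 * q ;
  ce_beta_gt0 : 0 < beta ; ce_beta_e1 : beta * e1 < 1 ;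
  ce_beta_gamma : 1 - gamma < beta * (e1 - 1)
}.

(** [beta] has to fit between two lower bounds and [1 / e1], and the last two hypotheses make room
    for it: [1 < e1 * gamma] rearranges to [(1 - gamma) / (e1 - 1) < 1 / e1], the other one to
    [alpha - dim / e1 < 1 / e1]. *)
Lemma critical_exponents_core dim gamma p1 p2 e1 e2 : 1 <= dim -> 0 < gamma < 1 ->
  1 < e1 -> e1 <= p1 -> e2 = 1 + (e1 - 1) / (2 - gamma) -> e2 <= p2 ->
  1 < e1 * gamma -> 2 - gamma < (e1 - 1) * (dim - 1 + gamma) ->
  exists alpha beta r, critical_exponents dim gamma p1 p2
    (dim * (e1 - 1) / (2 - gamma)) e1 e2 alpha beta r.
Proof.
move=> dim1 /andP[g0 g1] e11 e1p1 e2E e2p2 e1g sob.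
have d0 : 0 < dim by exact: lt_le_trans dim1.
have e10 : 0 < e1 - 1 by rewrite subr_gt0.
have e1_gt0 : 0 < e1 by exact: lt_trans e11.
have c0 : 0 < 2 - gamma by lra.
have c1 : 1 < 2 - gamma by lra.
pose alpha := (2 - gamma) / (e1 - 1).
have a0 : 0 < alpha by rewrite divr_gt0.
have alpha1 : alpha * (e1 - 1) = 2 - gamma by rewrite /alpha divfK ?gt_eqF.
have alpha2 : alpha * (e2 - 1) = 1.
  by rewrite e2E /alpha; field; rewrite !gt_eqF.
have e21 : 1 < e2 by rewrite e2E ltrDl divr_gt0.
have e2e1 : e2 <= e1.
  have : (e1 - 1) / (2 - gamma) <= e1 - 1 by rewrite ler_pdivrMr// ler_peMr ?ltW.
  rewrite e2E; lra.
(* The bounds on [beta] say that [(1 - gamma) / (e1 - 1) < beta] (the memory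
   term decays), [alpha - dim / e1 < beta] ([e1 < r]) and [beta < 1 / e1]
   (integrability at [s = 0]). *)
pose L := Num.max ((1 - gamma) / (e1 - 1)) (alpha - dim / e1).
have ie1 : e1^-1 * e1 = 1 by rewrite mulVf ?gt_eqF.
have Le1 : L < e1^-1.
  rewrite /L gt_max; apply/andP; split.
    by rewrite ltr_pdivrMr// -(ltr_pM2r e1_gt0) mulrAC ie1; lra.
  rewrite -(ltr_pM2r e1_gt0) ie1 mulrBl divfK ?gt_eqF//.
  rewrite -(ltr_pM2r e10) mulrBl mulrAC alpha1; lra.
pose beta := (L + e1^-1) / 2.
have Lb : L < beta by rewrite /beta; lra.
have be1 : beta < e1^-1 by rewrite /beta; lra.
have b1 : (1 - gamma) / (e1 - 1) < beta by apply: le_lt_trans Lb; rewrite /L le_max lexx.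
have b2 : alpha - dim / e1 < beta by apply: le_lt_trans Lb; rewrite /L le_max lexx orbT.
have beta0 : 0 < beta by apply: lt_trans b1; rewrite divr_gt0// subr_gt0.
have be1' : beta * e1 < 1 by rewrite -ie1 ltr_pM2r.
have bg : 1 - gamma < beta * (e1 - 1) by rewrite -ltr_pdivrMr.
have ba : beta < alpha.
  by rewrite -(ltr_pM2r e10) alpha1; lra.
have ab0 : 0 < alpha - beta by rewrite subr_gt0.
have qE : dim * (e1 - 1) / (2 - gamma) = dim / alpha.
  by rewrite /alpha; field; rewrite !gt_eqF.
(* With [r = dim / (alpha - beta)] and [q = dim / alpha], [r <= e * q] amounts to
   [beta * e <= alpha * (e - 1)]. The right-hand side is [2 - gamma] for [e1] and 1 for [e2], and
   [beta * e2 <= beta * e1 < 1]. *)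
have rge e : beta * e <= alpha * (e - 1) -> dim / (alpha - beta) <= e * (dim / alpha).
  move=> be; rewrite ler_pdivrMr//.
  have -> : e * (dim / alpha) * (alpha - beta) = dim * (e * (alpha - beta) / alpha) by ring.
  by rewrite ler_peMr ?(ltW d0)// ler_pdivlMr// mul1r; lra.
exists alpha, beta, (dim / (alpha - beta)); rewrite qE; split => //.
- rewrite ler_pdivlMr// mulrC.
  by move: b2; rewrite ltrBlDl -ltrBlDr ltr_pdivlMr//; exact: ltW.
- by rewrite invf_div mulrC divfK ?gt_eqF.
- rewrite ler_pdivlMr// mul1r -(ler_pM2r e10) alpha1.
  apply: (le_trans (ltW sob)); rewrite mulrC ler_wpM2r//; [exact: ltW|lra].
- by rewrite invf_div mulrC divfK ?gt_eqF.
- by rewrite ler_pM2l// lef_pV2 ?posrE// lerBlDr lerDl ltW.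
- by apply: rge; lra.
- have : beta * e2 <= beta * e1 by rewrite ler_pM2l.
  by move=> ?; apply: rge; lra.
Qed.

(** The pair starts from the power that defines [q_sc]: [e1 = p1] if [p2_tilde <= p2], and
    [e1 = 1 + (2 - gamma) * (p2 - 1)], so that [e2 = p2], otherwise. The two entries of [p1_star],
    respectively [p2_star2], are the conditions [1 < e1 * gamma] and
    [2 - gamma < (e1 - 1) * (n + gamma)] solved for that power. *)
Lemma critical_exponents_exist n gamma p1 p2 : (1 <= n)%N -> 0 < gamma -> gamma < 1 ->
  1 < p1 -> 1 < p2 -> p1_star n gamma < p1 -> p2_star2 n gamma < p2 ->
  exists e1 e2 alpha beta r,
    critical_exponents n.+1%:R gamma p1 p2 (q_sc n gamma p1 p2) e1 e2 alpha beta r.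
Proof.
move=> n1 g0 g1 p11 p21; rewrite /p1_star /p2_star2 !gt_max.
have d2 : 1 <= n%:R :> R by rewrite (ler_nat R 1).
have hd : homdim n = 2 * (n%:R + 1) :> R by rewrite /homdim natrD natrM mulrDr mulr1.
have dE : n.+1%:R = n%:R + 1 :> R by rewrite natr1.
have c0 : 0 < 2 - gamma by lra.
have m0 : 0 < n%:R + gamma by lra.
have -> : homdim n - 2 + 2 * gamma = 2 * (n%:R + gamma) :> R by rewrite hd; ring.
have -> : 2 * (2 - gamma) / (2 * (n%:R + gamma)) = (2 - gamma) / (n%:R + gamma) :> R.
  by field; rewrite gt_eqF.
have -> : 2 / (2 * (n%:R + gamma)) = 1 / (n%:R + gamma) :> R.
  by field; rewrite gt_eqF.
move=> /andP[p1a p1b] /andP[p2a p2b].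
have {}p1b : 2 - gamma < (p1 - 1) * (n%:R + gamma) by rewrite -ltr_pdivrMr//; lra.
have {}p2b : 1 < (p2 - 1) * (n%:R + gamma) by rewrite -ltr_pdivrMr//; lra.
rewrite ltr_pdivrMr// in p1a.
have p2a' : 1 - gamma < (p2 - 1) * (2 - gamma) * gamma.
  by move: p2a; rewrite ltr_pdivrMr ?mulr_gt0//; lra.
have nD : n.+1%:R - 1 + gamma = n%:R + gamma :> R by rewrite dE; ring.
have p2tE : p2_tilde gamma p1 = 1 + (p1 - 1) / (2 - gamma).
  by rewrite /p2_tilde; field; rewrite gt_eqF.
have g01 : 0 < gamma < 1 by rewrite g0.
have dim1 : 1 <= n.+1%:R :> R by rewrite ler1n.
rewrite /q_sc; case: ifPn => [p2t|].
  have -> : homdim n * (p1 - 1) / (2 * (2 - gamma)) = n.+1%:R * (p1 - 1) / (2 - gamma).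
    by rewrite hd dE; field; rewrite gt_eqF.
  have e2p : 1 + (p1 - 1) / (2 - gamma) <= p2 by rewrite -p2tE.
  have sob : 2 - gamma < (p1 - 1) * (n.+1%:R - 1 + gamma) by rewrite nD.
  have [alpha [beta [r H]]] :=
    critical_exponents_core dim1 g01 p11 (lexx p1) erefl e2p p1a sob.
  by exists p1, (1 + (p1 - 1) / (2 - gamma)), alpha, beta, r.
rewrite -ltNge => p2t.
have e1E : (2 - gamma) * (p2 - 1) < p1 - 1.
  by move: p2t; rewrite p2tE -ltrBlDl ltr_pdivlMr// mulrC.
have q0 : 0 < (2 - gamma) * (p2 - 1) by rewrite mulr_gt0// subr_gt0.
have -> : homdim n * (p2 - 1) / 2 = n.+1%:R * (1 + (2 - gamma) * (p2 - 1) - 1) / (2 - gamma).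
  by rewrite hd dE; field; rewrite gt_eqF.
have e2E : p2 = 1 + (1 + (2 - gamma) * (p2 - 1) - 1) / (2 - gamma).
  by field; rewrite gt_eqF.
have e11 : 1 < 1 + (2 - gamma) * (p2 - 1) by rewrite ltrDl.
have e1p : 1 + (2 - gamma) * (p2 - 1) <= p1 by lra.
have e1g : 1 < (1 + (2 - gamma) * (p2 - 1)) * gamma by lra.
have sob : 2 - gamma < (1 + (2 - gamma) * (p2 - 1) - 1) * (n.+1%:R - 1 + gamma).
  have -> : 1 + (2 - gamma) * (p2 - 1) - 1 = (2 - gamma) * (p2 - 1) by ring.
  by rewrite nD -mulrA -[ltLHS]mulr1 ltr_pM2l.
have [alpha [beta [r H]]] := critical_exponents_core dim1 g01 e11 e1p e2E (lexx p2) e1g sob.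
by exists (1 + (2 - gamma) * (p2 - 1)), p2, alpha, beta, r.
Qed.

End exponents.

(** * Restarting the solution at a later time *)

Section solution.
Local Open Scope ereal_scope.
Context {R : realType} {d : measure_display} {X : measurableType d}.
Variables (mu : {sigma_finite_measure set X -> \bar R}) (k : R -> X -> X -> R).
Variables (dim C : R).
Hypothesis mk : markov_kernel mu k dim C.
Hypotheses (C_gt0 : (0 < C)%R) (dim_gt0 : (0 < dim)%R).
Local Notation leb := (@lebesgue_measure R).
Local Notation mR := (measurableTypeR R).
Local Notation Lbound := (Lbound mu).
Local Notation heat_op := (heat_op mu k).
Local Notation duhamel := (duhamel mu k).

Lemma integral_cst_itv (a b M : R) : (a <= b)%R ->
  \int[leb]_(s in `[a, b[) M%:E = (M * (b - a))%:E.
Proof.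
move=> ab; rewrite integral_cst//=.
by rewrite lebesgue_measure_itv/= lte_fin; case: ltP => [_|ba];
  rewrite -?EFinB// (le_anti (introT andP (conj ab ba))) subrr mulr0 mule0.
Qed.

Lemma duhamel_add (F G : mR * X -> \bar R) z :
  measurable_fun setT F -> measurable_fun setT G ->
  (forall w, 0 <= F w) -> (forall w, 0 <= G w) ->
  duhamel (fun w => F w + G w) z = duhamel F z + duhamel G z.
Proof.
move=> mF mG F0 G0.
have mh (K : mR * X -> \bar R) : measurable_fun setT K -> (forall w, 0 <= K w) ->
    measurable_fun setT (fun s : mR => heat_op (z.1 - s) (fun x => K (s, x)) z.2).
  move=> mK K0; apply: (measurable_heat_op mk (f := K) (y := cst z.2)) => //.
  by apply: measurable_funB; [exact: measurable_cst|exact: measurable_id].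
rewrite /duhamel -ge0_integralD//; last 4 first.
- by move=> s _; exact: (heat_op_ge0 mk).
- exact: mh.
- by move=> s _; exact: (heat_op_ge0 mk).
- exact: mh.
apply: eq_integral => s _; rewrite /heat_op -ge0_integralD//.
- by apply: eq_integral => x _; rewrite ge0_muleDr.
- by move=> x _; rewrite mule_ge0// lee_fin (mk_ge0 mk).
- apply: emeasurable_funM; last exact: measurable_slice.
  apply/measurable_EFinP; apply: (mk_measurable mk);
    [exact: measurable_cst|exact: measurable_id|exact: measurable_cst].
- by move=> x _; rewrite mule_ge0// lee_fin (mk_ge0 mk).
- apply: emeasurable_funM; last exact: measurable_slice.
  apply/measurable_EFinP; apply: (mk_measurable mk);
    [exact: measurable_cst|exact: measurable_id|exact: measurable_cst].
Qed.

Variables (gamma p1 p2 beta r q : R).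
Hypotheses (gamma_gt0 : (0 < gamma)%R) (gamma_lt1 : (gamma < 1)%R).
Hypotheses (p1_gt1 : (1 < p1)%R) (p2_gt1 : (1 < p2)%R) (q_ge1 : (1 <= q)%R).
Local Notation small_solution := (small_solution mu beta r).
Local Notation mild_map := (mild_map mu k gamma p1 p2).

Variables (u0 : X -> \bar R) (u : mR * X -> \bar R) (delta c : R).
Hypotheses (mu0 : measurable_fun setT u0) (u00 : forall x, 0 <= u0 x).
Hypotheses (delta_gt0 : (0 < delta)%R) (c_gt0 : (0 < c)%R).
Hypotheses (us : small_solution delta u) (ufix : forall z, u z = mild_map u0 u z).
Hypothesis (uq : forall t, (0 < t)%R -> Lbound q (fun x => u (t, x)) c).

(** The whole right-hand side of the equation on the fixed point, treated from here on as a given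
    inhomogeneity. *)
Definition source (z : mR * X) : \bar R :=
  memory gamma (fun w => u w `^ p1) z + u z `^ p2.

Let mpow (p : R) : measurable_fun setT (fun w => u w `^ p).
Proof. exact: (@measurable_power _ _ _ _ _ _ p _ _ us). Qed.

Let pow_ge0 (p : R) w : 0 <= u w `^ p. Proof. exact: poweR_ge0. Qed.

Let mmem : measurable_fun setT (memory gamma (fun w => u w `^ p1)).
Proof. exact: measurable_memory. Qed.

Let mem_ge0 w : 0 <= memory gamma (fun w => u w `^ p1) w.
Proof. exact: memory_ge0. Qed.

Lemma measurable_source : measurable_fun setT source.
Proof. exact: emeasurable_funD. Qed.

Lemma source_ge0 z : 0 <= source z.
Proof. exact: adde_ge0. Qed.

Lemma source_null : past_null source.
Proof.
move=> s x s0; rewrite /source (memory_null (power_null p1_gt1 us) gamma)//.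
by rewrite (power_null p2_gt1 us)// adde0.
Qed.

Lemma source_eq t x : u (t, x) = heat_op t u0 x + duhamel source (t, x).
Proof. by rewrite ufix /mild_map -addeA -duhamel_add. Qed.

Let u_le_pow p z : (0 < p)%R -> u z `^ p <= (delta `^ p)%:E.
Proof.
move=> p0; have [_ u_ge0 _ ud _] := us.
by rewrite -poweR_EFin; apply: poweR_le; [exact: ltW|exact: u_ge0|exact: ud].
Qed.

Let gamma01 : (0 <= gamma < 1)%R. Proof. by rewrite gamma_lt1 ltW. Qed.

(** The memory of a bounded function may grow like [s ^ (1 - gamma)], so the bound is local in time.
    [T'] guards against [T <= 0]. *)
Lemma source_bound T : exists2 M : R, (0 < M)%R & forall s x, (s <= T)%R ->
  source (s, x) <= M%:E.
Proof.
pose T' := Num.max T 1%R.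
have T'0 : (0 < T')%R by rewrite /T' lt_max ltr01 orbT.
pose W := (T' `^ (1 - gamma) / (1 - gamma))%R.
have g10 : (0 < 1 - gamma)%R by rewrite subr_gt0.
have W0 : (0 <= W)%R by rewrite divr_ge0 ?powR_ge0// ltW.
have D10 : (0 < delta `^ p1)%R by rewrite powR_gt0.
have D20 : (0 < delta `^ p2)%R by rewrite powR_gt0.
exists (delta `^ p1 * W + delta `^ p2)%R; first by rewrite ltr_wpDl// mulr_ge0// ltW.
move=> s x sT; rewrite /source EFinD; apply: leeD; last first.
  by apply: u_le_pow; exact: lt_trans p2_gt1.
have [s0|s0] := leP s 0%R.
  by rewrite (memory_null (power_null p1_gt1 us) gamma)// lee_fin mulr_ge0// ltW.
rewrite memoryE//; last exact: (power_null p1_gt1 us).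
apply: (@le_trans _ _ (\int[leb]_(y in `]0%R, s[)
    ((delta `^ p1)%:E * ((s - y) `^ (- gamma))%:E))).
  apply: ge0_le_integral => //.
  - by move=> y _; rewrite mule_ge0// lee_fin powR_ge0.
  - apply: measurable_funTS; apply: emeasurable_funM.
      by apply/measurable_EFinP; exact: measurable_powRN_translate.
    exact: (measurable_path (mpow p1)).
  - apply: measurable_funTS; apply: emeasurable_funM; first exact: measurable_cst.
    by apply/measurable_EFinP; exact: measurable_powRN_translate.
  - move=> y _; rewrite muleC; apply: lee_wpmul2r; first by rewrite lee_fin powR_ge0.
    by apply: u_le_pow; exact: lt_trans p1_gt1.
rewrite ge0_integralZl_EFin//; last 3 first.
- by move=> y _; rewrite lee_fin powR_ge0.
- by apply/measurable_EFinP; apply: measurable_funTS; exact: measurable_powRN_translate.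
- exact: ltW.
rewrite EFinM; apply: lee_wpmul2l; first by rewrite lee_fin ltW.
apply: le_trans (integral_powRN_translate gamma01 s0) _.
rewrite lee_fin /W; apply: ler_wpM2r; first by rewrite invr_ge0 ltW.
apply: ge0_ler_powR; rewrite ?nnegrE; [exact: ltW|exact: ltW|exact: ltW|].
by apply: le_trans sT _; rewrite /T' le_max lexx.
Qed.

Let power_q p : (1 < p)%R -> forall s, (0 < s)%R ->
  Lbound q (fun x => u (s, x) `^ p) (delta `^ (p - 1) * c).
Proof.
move=> p_gt1 s s0; have [mu' u_ge0 _ ud _] := us.
have q0 : (0 <= q)%R by rewrite (le_trans _ q_ge1).
apply: (@le_Lbound _ _ _ _ _ _ (fun x => (delta `^ (p - 1))%:E * u (s, x))) => //.
- exact: (measurable_slice (mpow p)).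
- by apply: emeasurable_funM; [exact: measurable_cst|exact: measurable_slice].
- by move=> x; apply: poweR_ge1_le; [exact: ltW|exact: u_ge0|exact: ud].
apply: Lbound_scale.
- exact: powR_ge0.
- exact: ltW.
- exact: measurable_slice.
- by move=> x; exact: u_ge0.
- exact: uq.
Qed.

(** As [u <= delta], [u ^ p <= delta ^ (p - 1) * u], which reduces the powers to the bound of [u] in
    [L ^ q]. That bound is uniform in time, so the memory estimate is used with [b = 0]. *)
Lemma source_Lbound T : exists2 M : R, (0 < M)%R & forall s, (0 < s)%R -> (s <= T)%R ->
  Lbound q (fun x => source (s, x)) M.
Proof.
have b01 : (0 <= (0 : R) < 1)%R by rewrite lexx ltr01.
have [K K0 HK] := memory_Lbound mu gamma01 q_ge1 b01.
pose T' := Num.max T 1%R.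
have T'0 : (0 < T')%R by rewrite /T' lt_max ltr01 orbT.
have c1 : (0 < delta `^ (p1 - 1) * c)%R by rewrite mulr_gt0 ?powR_gt0.
have c2 : (0 < delta `^ (p2 - 1) * c)%R by rewrite mulr_gt0 ?powR_gt0.
pose M1 := (K * (delta `^ (p1 - 1) * c) * T' `^ (1 - gamma))%R.
have M10 : (0 < M1)%R by rewrite !mulr_gt0 ?powR_gt0.
exists (2 * (M1 + delta `^ (p2 - 1) * c))%R; first by rewrite mulr_gt0// addr_gt0.
move=> s s0 sT; apply: Lbound_add.
- exact: q_ge1.
- exact: (measurable_slice mmem).
- exact: (measurable_slice (mpow p2)).
- by move=> x; exact: mem_ge0.
- by move=> x; exact: pow_ge0.
- exact: ltW.
- exact: ltW.
- have q0 : (0 <= q)%R by rewrite (le_trans _ q_ge1).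
  have := HK (fun w => u w `^ p1) (delta `^ (p1 - 1) * c)%R (mpow p1) (pow_ge0 p1)
    (power_null p1_gt1 us) c1 _ s s0.
  rewrite !oppr0 addr0 => H.
  apply: (Lbound_le q0 _ _ (H _)).
  + by rewrite !mulr_ge0 ?powR_ge0// ltW.
  + rewrite /M1; apply: ler_wpM2l; first by rewrite mulr_ge0// ltW.
    apply: ge0_ler_powR; rewrite ?nnegrE; [by rewrite subr_ge0 ltW|exact: ltW|exact: ltW|].
    by apply: le_trans sT _; rewrite /T' le_max lexx.
  + by move=> y y0; rewrite powRr0 mulr1; exact: power_q.
- exact: power_q.
Qed.

Definition increment t tau x : \bar R :=
  \int[leb]_(s in `[t, (t + tau)%R[) heat_op (t + tau - s) (fun y => source (s, y)) x.

Let msrc_s s : measurable_fun setT (fun y => source (s, y)).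
Proof. exact: (measurable_slice measurable_source). Qed.

Let mheat_s t x : measurable_fun setT
  (fun s : mR => heat_op (t - s) (fun y => source (s, y)) x).
Proof.
apply: (measurable_heat_op mk (f := source) (y := cst x)).
- by apply: measurable_funB; [exact: measurable_cst|exact: measurable_id].
- exact: measurable_source.
- exact: source_ge0.
- exact: measurable_cst.
Qed.

Let heat_s_ge0 t s x : 0 <= heat_op (t - s) (fun y => source (s, y)) x.
Proof. by apply: (heat_op_ge0 mk) => y; exact: source_ge0. Qed.

Lemma increment_ge0 t tau x : 0 <= increment t tau x.
Proof. by apply: integral_ge0 => s _; exact: heat_s_ge0. Qed.

Lemma increment_le t tau M x : (0 <= tau)%R -> (0 <= M)%R ->
  (forall s y, (s <= t + tau)%R -> source (s, y) <= M%:E) ->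
  increment t tau x <= (M * tau)%:E.
Proof.
move=> tau0 M0 HM.
have -> : (M * tau)%:E = \int[leb]_(s in `[t, (t + tau)%R[) M%:E.
  by rewrite integral_cst_itv ?lerDl// addrAC subrr add0r.
apply: ge0_le_integral.
- exact: measurable_itv.
- by move=> s _; exact: heat_s_ge0.
- by apply: measurable_funTS; exact: mheat_s.
- by apply: measurable_funTS; exact: measurable_cst.
- move=> s /=; rewrite in_itv/= => /andP[_ st]; apply: (heat_op_le_cst mk).
  + exact: msrc_s.
  + by move=> y; exact: source_ge0.
  + exact: M0.
  + by move=> y; apply: HM; exact: ltW.
Qed.

Lemma increment_Lbound t tau M : (0 <= t)%R -> (0 < tau)%R -> (0 < M)%R ->
  (forall s, (0 < s)%R -> (s <= t + tau)%R -> Lbound q (fun x => source (s, x)) M) ->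
  Lbound q (increment t tau) (M * tau).
Proof.
move=> t0 tau0 M0 HM.
have -> : increment t tau = fun x => \int[leb]_(s in `]t, (t + tau)%R[)
    heat_op (t + tau - s) (fun y => source (s, y)) x.
  apply/funext => x; rewrite /increment.
  by apply: integral_itv_bndoo; apply: measurable_funTS; exact: mheat_s.
apply: (@Lbound_integral _ _ _ _ _ leb mu `]t, (t + tau)%R[%classic
  (fun p : mR * X => heat_op (t + tau - p.1) (fun x => source (p.1, x)) p.2) (fun _ => M)).
- exact: measurable_itv.
- exact: q_ge1.
- apply: (measurable_heat_op mk (f := fun z : (mR * X) * X => source (z.1.1, z.2))).
  + by apply: measurable_funB; [exact: measurable_cst|exact: measurable_fst].
  + apply: (measurableT_comp measurable_source); apply: measurable_fun_pair; last exact: measurable_snd.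
    by apply: (measurableT_comp measurable_fst); exact: measurable_fst.
  + by move=> z; exact: source_ge0.
  + exact: measurable_snd.
- by move=> p; apply: (heat_op_ge0 mk) => x; exact: source_ge0.
- exact: measurable_cst.
- by [].
- move=> s /=; rewrite in_itv/= => /andP[ts st].
  have s0 : (0 < s)%R by exact: le_lt_trans ts.
  have st0 : (0 < t + tau - s)%R by rewrite subr_gt0.
  (* From [L ^ q] to itself the smoothing exponent is 0: the flow is a contraction, and the
     increment is linear in [tau]. *)
  have := heat_op_Lbound mk C_gt0 st0 q_ge1 (lexx q) M0 (msrc_s s)
    (fun x => source_ge0 (s, x)) (HM s s0 (ltW st)).
  by rewrite subrr powRr0 mul1r.
- exact: mulr_gt0.
- have <- : \int[leb]_(s in `[t, (t + tau)%R[) M%:E = \int[leb]_(s in `]t, (t + tau)%R[) M%:E.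
    by apply: integral_itv_bndoo; apply: measurable_funTS; exact: measurable_cst.
  rewrite integral_cst_itv; last by rewrite lerDl ltW.
  by rewrite addrAC subrr add0r.
Qed.

(* For [t = 0] the term [u (0, _)] is replaced by the datum. *)
Lemma increment0 tau x : (0 < tau)%R -> u (tau, x) = heat_op tau u0 x + increment 0 tau x.
Proof.
move=> tau0.
have -> : increment 0 tau x = duhamel source (tau, x); last exact: source_eq.
apply: etrans (esym (duhamelE mk source_null tau x)).
rewrite /increment add0r.
by apply: integral_itv_bndoo; apply: measurable_funTS; exact: mheat_s.
Qed.

(** The Duhamel integral over the line is cut at time [t]. On the past the semigroup law extracts
    the flow over [tau]; the rest is the increment. The memory inside [source] still sees all
    earlier times, so the equation itself is not restarted. *)
Lemma semigroup_decomposition t tau x : (0 < t)%R -> (0 < tau)%R ->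
  u (t + tau, x)%R = heat_op tau (fun y => u (t, y)) x + increment t tau x.
Proof.
move=> t0 tau0; apply: etrans (source_eq _ x) _.
have mh := measurable_heat_op1 mk t mu0 u00.
have md := measurable_slice (measurable_duhamel mk measurable_source source_ge0) t.
have h0 y : 0 <= heat_op t u0 y by exact: (heat_op_ge0 mk).
have d0 y : 0 <= duhamel source (t, y) by exact: (duhamel_ge0 mk source_ge0).
have mkx : measurable_fun setT (fun y => (k tau y x)%:E).
  by apply/measurable_EFinP; apply: (mk_measurable mk);
    [exact: measurable_cst|exact: measurable_id|exact: measurable_cst].
have -> : heat_op tau (fun y => u (t, y)) x =
    heat_op tau (heat_op t u0) x + heat_op tau (fun y => duhamel source (t, y)) x.
  rewrite {1}/heat_op.
  transitivity (\int[mu]_y ((k tau y x)%:E * heat_op t u0 y +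
      (k tau y x)%:E * duhamel source (t, y))).
    by apply: eq_integral => y _; rewrite (source_eq t y) ge0_muleDr.
  rewrite ge0_integralD//.
  - by move=> y _; rewrite mule_ge0// lee_fin (mk_ge0 mk).
  - exact: emeasurable_funM.
  - by move=> y _; rewrite mule_ge0// lee_fin (mk_ge0 mk).
  - exact: emeasurable_funM.
rewrite (heat_op_semigroup mk)// -[RHS]addeA.
suff -> : duhamel source ((t + tau)%R, x) =
  heat_op tau (fun y => duhamel source (t, y)) x + increment t tau x by [].
have E1 : heat_op tau (fun y => duhamel source (t, y)) x =
    \int[leb]_(s in `]-oo, t[) heat_op (t + tau - s) (fun y => source (s, y)) x.
  rewrite /heat_op.
  transitivity (\int[mu]_y \int[leb]_s ((k tau y x)%:E *
      heat_op (t - s) (fun y => source (s, y)) y)).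
    apply: eq_integral => y _; rewrite ge0_integralZl//.
    by rewrite lee_fin (mk_ge0 mk).
  have mF : measurable_fun setT (fun z : X * mR => (k tau z.1 x)%:E *
      heat_op (t - z.2) (fun y => source (z.2, y)) z.1).
    apply: emeasurable_funM.
      by apply: (measurableT_comp mkx); exact: measurable_fst.
    apply: (measurable_heat_op mk (f := fun w : (X * mR) * X => source (w.1.2, w.2))
      (t := fun z : X * mR => (t - z.2)%R) (y := fst)).
    - by apply: measurable_funB; [exact: measurable_cst|exact: measurable_snd].
    - apply: (measurableT_comp measurable_source); apply: measurable_fun_pair; last exact: measurable_snd.
      by apply: (measurableT_comp measurable_snd); exact: measurable_fst.
    - by move=> w; exact: source_ge0.
    - exact: measurable_fst.
  etransitivity.
    apply: (fubini_tonelli (m1 := mu) (m2 := leb) _ mF) => z.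
    by rewrite mule_ge0 ?lee_fin ?(mk_ge0 mk).
  rewrite [RHS]integral_mkcond; apply: eq_integral => s _; rewrite patchE /=.
  case: ifPn => [|/negP]; rewrite inE/= in_itv/=.
    move=> st; have st0 : (0 < t - s)%R by rewrite subr_gt0.
    have -> : (t + tau - s = t - s + tau)%R by ring.
    exact: (heat_op_semigroup mk x st0 tau0 (msrc_s s) (fun y => source_ge0 (s, y))).
  move=> /negP; rewrite -leNgt => ts; apply: integral0_eq => y _.
  by rewrite (heat_op_le0 mk) ?subr_le0// mule0.
rewrite E1 /duhamel/= /increment.
have E2 : (setT : set mR) = `]-oo, t[%classic `|` `[t, +oo[%classic.
  by rewrite -itv_bndbnd_setU// set_itvNyy.
transitivity (\int[leb]_(s in (`]-oo, t[%classic : set mR) `|` `[t, +oo[%classic)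
    heat_op (t + tau - s) (fun y => source (s, y)) x); first by rewrite -E2.
rewrite ge0_integral_setU//; last 2 first.
- by rewrite -E2; exact: mheat_s.
- by apply: lt_disjoint => a b /=; rewrite !in_itv/= andbT; exact: lt_le_trans.
congr (_ + _); rewrite integral_mkcond [RHS]integral_mkcond; apply: eq_integral => s _.
rewrite !patchE /=; case: ifPn => [|/negP]; rewrite inE/= in_itv/= andbT.
  move=> ts; case: ifPn => // /negP; rewrite inE/= in_itv/= ts/= => /negP.
  by rewrite -leNgt => st; rewrite (heat_op_le0 mk)// subr_le0.
by move=> ts; rewrite ifF//; apply/negP; rewrite inE/= in_itv/= => /andP[].
Qed.

End solution.

(** * Curves that follow a contraction semigroup up to a linear error *)

Section curve.
Local Open Scope ereal_scope.
Context {R : realType} {V : Type}.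
Variables (dist : V -> V -> \bar R) (G : V -> Prop).
Hypothesis dist_xx : forall x, G x -> dist x x = 0.
Hypothesis dist_sym : forall x y, dist x y = dist y x.
Hypothesis dist_triangle : forall x y z, G x -> G y -> G z ->
  dist x z <= dist x y + dist y z.
(** [P t s] stands for the free flow over time [s] started from [v t], and [G] for the side
    condition under which [dist] satisfies the triangle inequality, namely measurability in the case
    of [L ^ q]. *)
Variables (v : R -> V) (P : R -> R -> V).
Hypotheses (Gv : forall t, (0 <= t)%R -> G (v t))
  (GP : forall t s, (0 <= t)%R -> (0 < s)%R -> G (P t s)).
Hypothesis P_continuous : forall t, (0 <= t)%R -> forall e : R, (0 < e)%R ->
  exists2 rho : R, (0 < rho)%R &
    forall s, (0 < s)%R -> (s < rho)%R -> dist (P t s) (v t) <= e%:E.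
Hypothesis v_P : forall T, exists2 c : R, (0 < c)%R & forall t s, (0 <= t)%R ->
  (0 < s)%R -> (t + s <= T)%R -> dist (v (t + s)%R) (P t s) <= (c * s)%:E.
Hypothesis P_contraction : forall t s tau, (0 <= t)%R -> (0 < s)%R -> (0 < tau)%R ->
  dist (P t (s + tau)%R) (P t s) <= dist (P t tau) (v t).

(* Continuity from the left at [t] compares [v s] and [v t] with the flow started at an earlier time [t0]. *)
Lemma semigroup_curve_continuity t : (0 <= t)%R -> forall e : R, (0 < e)%R ->
  exists2 rho : R, (0 < rho)%R &
    forall s, (0 <= s)%R -> (`|s - t| < rho)%R -> dist (v s) (v t) <= e%:E.
Proof.
move=> t0 e e0; have [c c0 vP] := v_P (t + 1)%R.
have e20 : (0 < e / 2)%R by rewrite divr_gt0.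
have ec0 : (0 < e / (4 * c))%R by rewrite divr_gt0// mulr_gt0.
have [r1 r10 Pr1] := P_continuous t0 e20.
pose rr := (Num.min (Num.min r1 1) (e / (4 * c)))%R.
have rr0 : (0 < rr)%R by rewrite /rr !lt_min r10 ltr01 ec0.
have right s : (t < s)%R -> (s < t + rr)%R -> dist (v s) (v t) <= e%:E.
  move=> ts sr; have st0 : (0 < s - t)%R by rewrite subr_gt0.
  have srr : (s - t < rr)%R by rewrite ltrBlDl.
  move: srr; rewrite /rr !lt_min -andbA => /and3P[s1 s2 s3].
  have s0 : (0 <= s)%R by rewrite (le_trans t0)// ltW.
  apply: le_trans (dist_triangle (Gv s0) (GP t0 st0) (Gv t0)) _.
  have -> : e%:E = (e / 2)%:E + (e / 2)%:E by rewrite -EFinD -splitr.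
  apply: leeD; last exact: Pr1.
  have := vP t (s - t)%R t0 st0; rewrite addrC subrK => /(_ _)/le_trans; apply.
    by rewrite -lerBlDl ltW.
  rewrite lee_fin; apply: (@le_trans _ _ (c * (e / (4 * c))))%R.
    by rewrite ler_pM2l// ltW.
  have -> : (c * (e / (4 * c)) = e / 4)%R by field; rewrite gt_eqF.
  by rewrite ler_pM2l// lef_pV2 ?posrE// ler_nat.
have center : dist (v t) (v t) <= e%:E by rewrite dist_xx ?lee_fin ?ltW//; exact: Gv.
have [t_gt0|tle0] := ltP 0%R t; last first.
  exists rr => // s s0; have tE : t = 0%R by apply: le_anti; rewrite tle0.
  rewrite tE subr0 ger0_norm// => srr.
  move: s0; rewrite le_eqVlt => /predU1P[<-|s0]; first by rewrite -tE.
  by rewrite -tE; apply: right; rewrite tE ?add0r.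
(* The earlier time [t - eta] is fixed before [s], so the radius [r2] of continuity of the flow
   there is independent of [s]. [eta <= t / 2] keeps this time nonnegative, and [c * eta <= e / 4]
   controls the two linear errors. *)
pose eta := (Num.min (t / 2) (e / (4 * c)))%R.
have eta0 : (0 < eta)%R by rewrite /eta lt_min divr_gt0.
pose a := (t - eta)%R.
have a0 : (0 <= a)%R.
  have : (eta <= t / 2)%R by rewrite /eta ge_min lexx.
  rewrite /a; lra.
have ceta : (c * eta <= e / 4)%R.
  apply: (@le_trans _ _ (c * (e / (4 * c))))%R.
    by rewrite ler_pM2l// /eta ge_min lexx orbT.
  by rewrite le_eqVlt; apply/orP; left; apply/eqP; field; rewrite gt_eqF.
have [r2 r20 Pr2] := P_continuous a0 e20.
clearbody rr eta.
exists (Num.min rr (Num.min r2 eta)); first by rewrite !lt_min rr0 r20 eta0.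
move=> s s0; rewrite !lt_min => /and3P[q1 q2 q3].
have [ts|st|ts] := ltgtP t s; last by rewrite -ts.
  by apply: right => //; rewrite -ltrBlDl -(gtr0_norm (_ : 0 < s - t)%R)// subr_gt0.
have st0 : (0 < t - s)%R by rewrite subr_gt0.
move: q1 q2 q3; rewrite distrC gtr0_norm// => _ q2 q3.
have sa : (0 < s - a)%R by rewrite /a; lra.
have ta : (0 < t - a)%R by rewrite /a; lra.
have Gs := Gv s0; have Gt := Gv t0; have G1 := GP a0 sa; have G2 := GP a0 ta.
have H1 : dist (v s) (P a (s - a)%R) <= (e / 4)%:E.
  have := vP a (s - a)%R a0 sa; rewrite addrC subrK => /(_ _)/le_trans; apply.
    by rewrite (le_trans (ltW st))// lerDl.
  rewrite lee_fin; apply: le_trans ceta; rewrite ler_pM2l// /a; lra.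
have H3 : dist (v t) (P a (t - a)%R) <= (e / 4)%:E.
  have := vP a (t - a)%R a0 ta; rewrite addrC subrK => /(_ _)/le_trans; apply.
    by rewrite lerDl.
  rewrite lee_fin; apply: le_trans ceta; rewrite ler_pM2l// /a; lra.
have H2 : dist (P a (t - a)%R) (P a (s - a)%R) <= (e / 2)%:E.
  have := P_contraction a0 sa st0.
  have -> : (s - a + (t - s) = t - a)%R by ring.
  move/le_trans; apply; exact: Pr2.
apply: le_trans (dist_triangle Gs G1 Gt) _.
have -> : e%:E = (e / 4)%:E + ((e / 2)%:E + (e / 4)%:E).
  by rewrite -!EFinD; congr EFin; field.
apply: leeD => //; apply: le_trans (dist_triangle G1 G2 Gt) _.
by apply: leeD; rewrite dist_sym.
Qed.

End curve.

(** * The heat flow on bounded nonnegative real functions *)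

Section real_heat.
Local Open Scope ereal_scope.
Context {R : realType} {d : measure_display} {X : measurableType d}.
Variables (mu : {sigma_finite_measure set X -> \bar R}) (k : R -> X -> X -> R).
Variables (dim C : R).
Hypothesis mk : markov_kernel mu k dim C.
Local Notation heat_op := (heat_op mu k).
Implicit Types f g : X -> R.

Definition bounded_nonneg f : Prop :=
  [/\ measurable_fun setT f, forall x, (0 <= f x)%R & exists M : R, forall x, (f x <= M)%R].

Definition real_heat (t : R) f (x : X) : R := fine (heat_op t (EFin \o f) x).

Lemma bounded_nonneg_bound f : bounded_nonneg f ->
  exists2 M : R, (0 <= M)%R & forall x, (f x <= M)%R.
Proof.
move=> [_ f0 [M fM]]; exists (Num.max M 0%R); first by rewrite le_max lexx orbT.
by move=> x; rewrite le_max fM.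
Qed.

Lemma real_heatE t f x : bounded_nonneg f ->
  (real_heat t f x)%:E = heat_op t (EFin \o f) x.
Proof.
move=> fn; have [M M0 fM] := bounded_nonneg_bound fn; have [mf f0 _] := fn.
rewrite /real_heat fineK// ge0_fin_numE; last first.
  by apply: (heat_op_ge0 mk) => y; rewrite lee_fin.
apply: (@le_lt_trans _ _ M%:E); last exact: ltry.
by apply: (heat_op_le_cst mk) => //; exact/measurable_EFinP.
Qed.

Lemma real_heat_ge0 t f x : (forall x, (0 <= f x)%R) -> (0 <= real_heat t f x)%R.
Proof. by move=> f0; apply: fine_ge0; apply: (heat_op_ge0 mk) => y; rewrite lee_fin. Qed.

Lemma real_heat_bounded_nonneg t f : bounded_nonneg f -> bounded_nonneg (real_heat t f).
Proof.
move=> fn; have [M M0 fM] := bounded_nonneg_bound fn; have [mf f0 _] := fn; split.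
- apply/measurable_EFinP.
  rewrite (_ : _ \o _ = heat_op t (EFin \o f)); last first.
    by apply/funext => x /=; rewrite real_heatE.
  by apply: (measurable_heat_op1 mk) => //; exact/measurable_EFinP.
- by move=> x; exact: real_heat_ge0.
- exists M => x; rewrite -lee_fin real_heatE//; apply: (heat_op_le_cst mk) => //.
  exact/measurable_EFinP.
Qed.

Lemma real_heat_semigroup s t f x : (0 < s)%R -> (0 < t)%R -> bounded_nonneg f ->
  real_heat t (real_heat s f) x = real_heat (s + t) f x.
Proof.
move=> s0 t0 fn; have [mf f0 _] := fn; congr fine.
rewrite -(heat_op_semigroup mk)//; last exact/measurable_EFinP.
by apply: eq_integral => y _; congr (_ * _); exact: real_heatE.
Qed.

Let mdist f g : measurable_fun setT f -> measurable_fun setT g ->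
  measurable_fun setT (fun y => `|f y - g y|%:E).
Proof.
move=> mf mg; apply/measurable_EFinP; apply: measurableT_comp => //.
exact: measurable_funB.
Qed.

(** Monotonicity applied to [f <= g + |f - g|] and to the same inequality with [f] and [g]
    exchanged; no difference of extended integrals is formed. *)
Lemma real_heat_dist t f g x : bounded_nonneg f -> bounded_nonneg g ->
  (`|real_heat t f x - real_heat t g x|)%:E <= heat_op t (fun y => `|f y - g y|%:E) x.
Proof.
move=> fn gn.
have H a b : bounded_nonneg a -> bounded_nonneg b ->
    (real_heat t a x)%:E <= (real_heat t b x)%:E + heat_op t (fun y => `|a y - b y|%:E) x.
  move=> an bn; have [ma a0 _] := an; have [mb b0 _] := bn.
  rewrite !real_heatE//.
  have -> : heat_op t (EFin \o b) x + heat_op t (fun y => `|a y - b y|%:E) x =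
      heat_op t (fun y => (b y + `|a y - b y|)%:E) x.
    have mkx : measurable_fun setT (fun y => (k t y x)%:E).
      by apply/measurable_EFinP; apply: (mk_measurable mk);
        [exact: measurable_cst|exact: measurable_id|exact: measurable_cst].
    rewrite /heat_op -ge0_integralD//.
    - by apply: eq_integral => y _ /=; rewrite EFinD ge0_muleDr// lee_fin.
    - by move=> y _; rewrite /= mule_ge0// lee_fin ?(mk_ge0 mk).
    - by apply: emeasurable_funM => //; exact/measurable_EFinP.
    - by move=> y _; rewrite mule_ge0// lee_fin ?(mk_ge0 mk).
    - by apply: emeasurable_funM => //; exact: mdist.
  apply: (le_heat_op mk).
  - exact/measurable_EFinP.
  - apply/measurable_EFinP; apply: measurable_funD => //.
    by apply/measurable_EFinP; exact: mdist.
  - by move=> y; rewrite lee_fin.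
  - move=> y; rewrite lee_fin -lerBlDl; exact: ler_norm.
have [ab|ba] := leP (real_heat t g x) (real_heat t f x).
  rewrite ger0_norm ?subr_ge0// EFinB leeBlDl//; exact: H.
rewrite ler0_norm ?subr_le0 ?(ltW ba)// opprB EFinB leeBlDl//.
have := H g f gn fn; congr (_ <= _ + heat_op t _ x).
by apply/funext => y; rewrite distrC.
Qed.

Lemma real_heat_dist_sup t f g (c : R) x : bounded_nonneg f -> bounded_nonneg g ->
  (forall y, (`|f y - g y| <= c)%R) -> (`|real_heat t f x - real_heat t g x| <= c)%R.
Proof.
move=> fn gn fg; have [mf f0 _] := fn; have [mg g0 _] := gn.
rewrite -lee_fin; apply: le_trans (real_heat_dist t x fn gn) _.
apply: (heat_op_le_cst mk) => //; first exact: mdist.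
exact: le_trans (fg x).
Qed.

(** The difference is at most the flow of [|f - g|]; Jensen for the probability kernel moves the
    power inside, and the flow conserves integrals. *)
Lemma real_heat_dist_Lq t f g (q : R) : (0 < t)%R -> (1 <= q)%R ->
  bounded_nonneg f -> bounded_nonneg g ->
  \int[mu]_x (`|real_heat t f x - real_heat t g x|%:E `^ q) <=
  \int[mu]_x (`|f x - g x|%:E `^ q).
Proof.
move=> t0 q1 fn gn; have [mf f0 _] := fn; have [mg g0 _] := gn.
have [mf' _ _] := real_heat_bounded_nonneg t fn; have [mg' _ _] := real_heat_bounded_nonneg t gn.
have md := mdist mf mg; have md' := mdist mf' mg'.
have q0 : (0 <= q)%R by rewrite (le_trans _ q1).
have mq (w : X -> \bar R) : measurable_fun setT w -> measurable_fun setT (fun x => w x `^ q).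
  by move=> mw; exact: (measurableT_comp (measurable_poweR q) mw).
have wq0 (x : X) : 0 <= `|f x - g x|%:E `^ q by exact: poweR_ge0.
have mh : measurable_fun setT (heat_op t (fun x => `|f x - g x|%:E `^ q)).
  by apply: (measurable_heat_op1 mk) => //; exact: mq.
rewrite -(integral_heat_op mk t0 (mq _ md) wq0).
apply: ge0_le_integral => //.
- by move=> x _; exact: poweR_ge0.
- exact: mq.
- move=> x _; apply: le_trans (heat_op_jensen mk x t0 q1 md _); last by move=> y; rewrite lee_fin.
  by apply: poweR_le; [|rewrite lee_fin|exact: real_heat_dist].
Qed.

Lemma real_heat_Lq t f (q : R) : (0 < t)%R -> (1 <= q)%R -> bounded_nonneg f ->
  \int[mu]_x ((real_heat t f x) `^ q)%:E <= \int[mu]_x (f x `^ q)%:E.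
Proof.
move=> t0 q1 fn; have [mf f0 _] := fn.
have zn : bounded_nonneg (fun=> 0%R) by split => //; exists 0%R.
have := real_heat_dist_Lq t0 q1 fn zn.
under [X in X <= _ -> _]eq_integral => x _.
  have -> : real_heat t (fun=> 0%R) x = 0%R.
    rewrite /real_heat /heat_op (_ : integral _ _ _ = 0)//.
    by apply: integral0_eq => y _; rewrite /= mule0.
  rewrite subr0 ger0_norm ?real_heat_ge0// poweR_EFin.
  over.
by under [X in _ <= X -> _]eq_integral do rewrite subr0 ger0_norm// poweR_EFin.
Qed.

End real_heat.

(** * C_0 and the heat semigroup *)

Section heis_topology.
Context {R : realType} {n : nat}.
Local Notation H := (heis R n).

Lemma heis_ball_compact (N : R) : compact [set eta : H | `|eta| <= N].
Proof.
have rVc : compact [set v : 'rV[R]_n | `|v| <= N].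
  apply: bounded_closed_compact.
    by exists N; split; [exact: num_real|move=> M NM v /= vN; exact: le_trans (ltW NM)].
  apply: (@closed_comp _ _ (fun v : 'rV[R]_n => `|v|) [set x : R | x <= N]).
    by move=> v _; exact: norm_continuous.
  exact: closed_le.
have Rc : compact [set x : R | `|x| <= N].
  rewrite (_ : [set _ | _] = `[- N, N]%classic); first exact: segment_compact.
  by apply/seteqP; split => x /=; rewrite in_itv/= ler_norml.
rewrite (_ : [set _ | _] =
  ([set v | `|v| <= N] `*` [set v | `|v| <= N]) `*` [set x | `|x| <= N]).
  by apply: compact_setX => //; exact: compact_setX.
apply/seteqP; split => -[[x y] tau] /=;
  rewrite [`|(_, _, _)|]prod_normE/= [`|(_, _)|]prod_normE/= !ge_max.
  by move=> /andP[/andP[? ?] ?].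
by move=> [[-> ->] ->].
Qed.

Lemma C0_bounded_set (f : H -> R) (e : R) : C0 f -> 0 < e ->
  exists N : R, forall eta, N < `|eta| -> `|f eta| < e.
Proof.
move=> [_ fv] e0; have [K Kc fK] := fv e e0.
have [N [_ NK]] := compact_bounded Kc.
exists (N + 1) => eta Neta; apply: fK => Keta.
have N1 : N < N + 1 by rewrite ltrDl.
have /= := NK _ N1 eta Keta.
by rewrite leNgt Neta.
Qed.

Lemma C0_seq (f : H -> R) : continuous f ->
  (forall w : nat -> H, (forall k, k%:R < `|w k|) -> f (w k) @[k --> \oo] --> (0 : R)) ->
  C0 f.
Proof.
move=> cf fv; split => // e e0.
have [N HN] : exists N : R, forall eta, N < `|eta| -> `|f eta| < e.
  apply: bounded_seq => w /fv/cvgrPdist_lt/(_ e e0)[k _ /(_ k (leqnn k))].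
  by rewrite sub0r normrN => ?; exists k.
exists [set eta | `|eta| <= N]; first exact: heis_ball_compact.
by move=> eta /= /negP; rewrite -ltNge; exact: HN.
Qed.

Lemma C0_bounded (f : H -> R) : C0 f -> exists2 M : R, 0 <= M & forall eta, `|f eta| <= M.
Proof.
move=> fC; have [N HN] := C0_bounded_set fC ltr01; have [cf _] := fC.
have fK : compact (f @` [set eta | `|eta| <= N]).
  by apply: continuous_compact; [exact: continuous_subspaceT|exact: heis_ball_compact].
have [M [_ HM]] := compact_bounded fK.
exists (Num.max (M + 1) 1) => [|eta]; first by rewrite le_max ler01 orbT.
rewrite le_max; have [h|h] := leP `|eta| N; last by rewrite (ltW (HN _ h)) orbT.
apply/orP; left; apply: (HM (M + 1)); first by rewrite ltrDl.
by exists eta.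
Qed.

Lemma heis_inv_norm (eta : H) : `|heis_inv eta| = `|eta|.
Proof.
case: eta => -[x y] tau; rewrite /heis_inv /=.
rewrite [`|(- x, - y, - tau)|]prod_normE/= [`|(x, y, tau)|]prod_normE/=.
by rewrite [`|(- x, - y)|]prod_normE/= [`|(x, y)|]prod_normE/= !normrN.
Qed.

(** Compactness gives the estimate at points of [K], off which [f] is below [e / 2]. If only the
    translated point lies in [K], the estimate is used backwards from it with the inverse of [zeta],
    which has the same norm. *)
Lemma C0_uniform (f : H -> R) (e : R) : C0 f -> 0 < e ->
  exists2 rho : R, 0 < rho & forall eta zeta, `|zeta| < rho ->
    `|f (heis_mul eta zeta) - f eta| <= e.
Proof.
move=> fC e0; have [cf fv] := fC.
have e20 : 0 < e / 2 by rewrite divr_gt0.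
have [K Kc fK] := fv _ e20.
have zero_cvg : forall eta : H, heis_mul eta (0 : H) = eta by exact: heis_mul0.
have : \forall zeta \near (0 : H), forall eta, K eta ->
    `|f (heis_mul eta zeta) - f eta| < e.
  have := (compact_near_coveringP K).1 Kc H (nbhs (0 : H))
    (fun zeta eta => `|f (heis_mul eta zeta) - f eta| < e) _.
  apply => eta Keta.
  have W : f (heis_mul p.1 p.2) - f p.1 @[p --> (nbhs eta, nbhs (0 : H))] --> (0 : R).
    rewrite [X in _ --> X](_ : _ = f (heis_mul eta 0) - f eta); last first.
      by rewrite zero_cvg subrr.
    apply: cvgB.
      apply: (cvg_compose (h := f) (cf _)); apply: cvg_heis_mul; [exact: cvg_fst|exact: cvg_snd].
    by apply: (cvg_compose (h := f) (cf _)); exact: cvg_fst.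
  move/cvgrPdist_lt : W => /(_ e e0); apply: filterS => -[a b] /=.
  by rewrite sub0r normrN.
move=> /nbhs_ballP[rho /= rho0 Hrho].
exists rho => // eta zeta zr.
have bz : ball (0 : H) rho zeta by rewrite -ball_normE/= sub0r normrN.
have bz' : ball (0 : H) rho (heis_inv zeta).
  by rewrite -ball_normE/= sub0r normrN heis_inv_norm.
have [Ke|nKe] := pselect (K eta); first by apply: ltW; exact: (Hrho _ bz).
have [Kez|nKez] := pselect (K (heis_mul eta zeta)).
  by have /= := Hrho _ bz' _ Kez; rewrite heis_mulKVr distrC => /ltW.
apply: le_trans (ler_normB _ _) _; rewrite [leRHS]splitr.
by apply: lerD; apply: ltW; exact: fK.
Qed.

End heis_topology.

Section heis_heat.
Local Open Scope ereal_scope.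
Context {R : realType} {n : nat}.
Local Notation H := (heis R n).
Local Notation mH := ('rV[R]_n * 'rV[R]_n * measurableTypeR R)%type.
Variables (h : R -> heis R n -> R) (hh : is_heat_kernel h).
Local Notation mu := (haar : {sigma_finite_measure set mH -> \bar R}).
Local Notation k := (heat_trans h : R -> mH -> mH -> R).

Lemma heat_trans_markov : exists2 C : R, (0 < C)%R & markov_kernel mu k n.+1%:R C.
Proof.
have [C C0 hC] := heat_trans_bound hh; exists C => //; split.
- by move=> t x y; exact: (heat_trans_ge0 hh).
- by move=> t x y t0; rewrite /heat_trans ltNge t0.
- by move=> d' T t f g mt mf mg; exact: (measurable_heat_trans hh).
- by move=> t x y; exact: (heat_trans_sym hh).
- by move=> t x t0; exact: (heat_trans_mass hh).
- by move=> s t x y s0 t0; exact: (heat_trans_semigroup hh).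
- by move=> t x y t0; exact: hC.
Qed.

Let mk : exists2 C : R, (0 < C)%R & markov_kernel mu k n.+1%:R C := heat_trans_markov.

Let mkx t (y : mH) : measurable_fun setT (fun x : mH => k t x y).
Proof.
by apply: (measurable_heat_trans hh); [exact: measurable_cst|exact: measurable_id|exact: measurable_cst].
Qed.

Lemma heat_trans_seq t (x eta : H) (w : nat -> H) :
  w j @[j --> \oo] --> eta -> heat_trans h t x (w j) @[j --> \oo] --> heat_trans h t x eta.
Proof.
move=> weta; apply: (cvg_compose (h := heat_trans h t x)) weta.
exact: heat_trans_continuous.
Qed.

(** All the densities have mass 1, so pointwise convergence improves to [L ^ 1] by [riesz_scheffe]
    with exponent 1. *)
Lemma heat_trans_L1_continuous t (eta : H) (w : nat -> H) : (0 < t)%R ->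
  w j @[j --> \oo] --> eta -> forall e : R, (0 < e)%R ->
  \forall j \near \oo, \int[mu]_x (`|k t x (w j) - k t x eta|)%:E <= e%:E.
Proof.
move=> t0 weta e e0; have [C C0 M] := mk.
have := @riesz_scheffe R _ mH mu (fun j x => k t x (w j)) (fun x => k t x eta) 1
  (lexx 1%R) (fun j => mkx t (w j)) (mkx t eta) _ _ _ _ _ e e0.
under [X in _ -> _ -> X < _ -> _]eq_integral do rewrite powRr1 ?(heat_trans_ge0 hh)//.
move=> /(_ (fun j x => heat_trans_ge0 hh _ _ _)) /(_ (fun x => heat_trans_ge0 hh _ _ _)).
rewrite (mk_mass_l M eta t0) => /(_ (ltry _)).
have HH : forall j, \int[mu]_x (k t x (w j) `^ 1)%:E <= \int[mu]_x (k t x eta `^ 1)%:E.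
  move=> j; under eq_integral do rewrite powRr1 ?(heat_trans_ge0 hh)//.
  under [X in _ <= X]eq_integral do rewrite powRr1 ?(heat_trans_ge0 hh)//.
  by rewrite !(mk_mass_l M).
move=> /(_ HH) H1; apply: (filterS _ (H1 _)).
  by move=> j; under eq_integral do rewrite powRr1//.
by move=> x; exact: (@heat_trans_seq t x eta w weta).
Qed.

(** If the rescaled point is large, the decay [|zeta| * h 1 zeta <= C] makes the kernel small.
    Otherwise [w j] lies in the compact image of a fixed ball, which is impossible for large [j]. *)
Lemma heat_trans_vanish t (x : H) (w : nat -> H) : (forall j, (j%:R < `|w j|)%R) ->
  heat_trans h t x (w j) @[j --> \oo] --> (0 : R)%R.
Proof.
move=> winf; have [t0|t0] := leP t 0%R.
  rewrite /heat_trans ltNge t0/=; exact: cvg_cst.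
have st0 : (0 < Num.sqrt t)%R by rewrite sqrtr_gt0.
pose phi eta := heis_dilate (Num.sqrt t)^-1 (heis_mul (heis_inv x) eta).
pose psi eta := heis_mul x (heis_dilate (Num.sqrt t) eta).
have phiK eta : psi (phi eta) = eta.
  rewrite /psi /phi -{1}[Num.sqrt t]invrK heis_dilateK ?invr_eq0 ?gt_eqF//.
  exact: heis_mulKVl.
have cpsi : continuous psi.
  move=> eta; apply: (@cvg_heis_mul _ _ _ (nbhs eta) (nbhs_filter eta)); first exact: cvg_cst.
  by apply: (@cvg_heis_dilate _ _ _ (nbhs eta) (nbhs_filter eta)); exact: cvg_id.
have [C C0 hC] := heat_kernel1_decay hh.
have kE j : heat_trans h t x (w j) = ((t ^+ n.+1)^-1 * h 1 (phi (w j)))%R.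
  by rewrite /heat_trans t0 (heat_kernel_profile hh).
rewrite (_ : (fun j => _) = fun j => ((t ^+ n.+1)^-1 * h 1 (phi (w j)))%R); last exact/funext.
suff W : h 1 (phi (w j)) @[j --> \oo] --> (0 : R)%R.
  have := cvgM (cvg_cst ((t ^+ n.+1)^-1)%R) W; rewrite mulr0; exact.
apply/cvgrPdist_le => e e0.
have psiK : compact (psi @` [set eta | (`|eta| <= C / e)%R]).
  by apply: continuous_compact; [exact: continuous_subspaceT|exact: heis_ball_compact].
have [M [_ HM]] := compact_bounded psiK.
have M1 : (M < M + 1)%R by rewrite ltrDl.
near=> j; rewrite sub0r normrN.
have [hj0 hjC] := (hC (phi (w j))).
have h0 : (0 <= h 1 (phi (w j)))%R by rewrite ltW// (heat_kernel_gt0 hh).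
rewrite ger0_norm//; have [le_phi|] := leP `|phi (w j)|%R (C / e)%R.
  exfalso.
  have : (`|w j| <= M + 1)%R by apply: (HM _ M1); exists (phi (w j)) => //; exact: phiK.
  rewrite leNgt => /negP; apply; apply: lt_trans (winf j).
  near: j; exact: nbhs_infty_gtr.
rewrite ltr_pdivrMr// => lphi.
have [->|hn0] := eqVneq (h 1 (phi (w j))) 0%R; first exact: ltW.
have hp : (0 < h 1 (phi (w j)))%R by rewrite lt_neqAle eq_sym hn0.
have p0 : (0 < `|phi (w j)|)%R.
  by rewrite -(pmulr_lgt0 _ e0) (lt_trans C0).
rewrite -(ler_pM2l p0); apply: le_trans hjC (ltW lphi).
Unshelve. all: by end_near. Qed.

Local Notation real_heat := (real_heat mu k).

Lemma real_heat_L1 t (f : mH -> R) (M : R) (x y : mH) : bounded_nonneg f ->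
  (forall z, (f z <= M)%R) ->
  (`|real_heat t f x - real_heat t f y|%:E <=
    M%:E * \int[mu]_z (`|k t z x - k t z y|)%:E).
Proof.
move=> fn fM; have [mf f0 _] := fn; have [C C0 Mk] := mk.
have M0 : (0 <= M)%R by exact: le_trans (fM x).
have md a b : measurable_fun setT (fun z => (`|k t z a - k t z b|)%:E).
  apply/measurable_EFinP; apply: measurableT_comp => //.
  by apply: measurable_funB; exact: mkx.
have W a b : (real_heat t f a)%:E <=
    (real_heat t f b)%:E + M%:E * \int[mu]_z (`|k t z a - k t z b|)%:E.
  rewrite !(real_heatE Mk)// -ge0_integralZl_EFin//.
  rewrite /heat_op -ge0_integralD//; last 4 first.
  - by move=> z _; rewrite mule_ge0// lee_fin ?(mk_ge0 Mk).
  - by apply: emeasurable_funM; apply/measurable_EFinP.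
  - by move=> z _; rewrite mule_ge0// lee_fin.
  - by apply: emeasurable_funM => //; exact: measurable_cst.
  apply: ge0_le_integral.
  - exact: measurableT.
  - by move=> z _; rewrite mule_ge0// lee_fin ?(mk_ge0 Mk).
  - by apply: emeasurable_funM; apply/measurable_EFinP.
  - apply: emeasurable_funD; first by apply: emeasurable_funM; apply/measurable_EFinP.
    by apply: emeasurable_funM => //; exact: measurable_cst.
  - move=> z _; rewrite /= -!EFinM -EFinD lee_fin -lerBlDl -mulrBl.
    apply: (@le_trans _ _ (`|k t z a - k t z b| * f z)%R).
      by apply: ler_wpM2r => //; exact: ler_norm.
    by rewrite mulrC; apply: ler_wpM2r.
have [ab|ba] := leP (real_heat t f y) (real_heat t f x).
  by rewrite ger0_norm ?subr_ge0// EFinB leeBlDl//; exact: W.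
rewrite ler0_norm ?subr_le0 ?(ltW ba)// opprB EFinB leeBlDl//.
have := W y x; congr (_ <= _ + _ * _).
by apply: eq_integral => z _; rewrite distrC.
Qed.

(** The strong Feller property: the kernel moves continuously in [L ^ 1], and [f] is bounded. *)
Lemma real_heat_continuous t (f : mH -> R) : (0 < t)%R -> bounded_nonneg f ->
  continuous (real_heat t f : H -> R).
Proof.
move=> t0 fn eta; have [M M0 fM] := bounded_nonneg_bound fn.
apply/cvgrPdist_le => e e0.
apply: (@near_seq R H eta) => w weta.
have e0' : (0 < e / (M + 1))%R by rewrite divr_gt0// ltr_wpDl.
have [j /= Hj] := filter_ex (heat_trans_L1_continuous t0 weta e0').
exists j; rewrite distrC -lee_fin.
apply: le_trans (real_heat_L1 t (w j) eta fn fM) _.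
apply: (@le_trans _ _ (M%:E * (e / (M + 1))%:E)); first exact: lee_wpmul2l.
rewrite -EFinM lee_fin mulrCA ler_piMr ?(ltW e0)// ler_pdivrMr ?ltr_wpDl//.
by rewrite mul1r lerDl.
Qed.

(** Jensen replaces [f] by the integrable [f ^ q], and the kernel bound provides the majorant for
    dominated convergence. Only integrability is asked of [f], because the slices of [source] are
    not yet known to vanish at infinity. *)
Lemma real_heat_vanish t (f : mH -> R) (q : R) (w : nat -> H) :
  (0 < t)%R -> (1 <= q)%R -> bounded_nonneg f -> \int[mu]_x (f x `^ q)%:E < +oo ->
  (forall j, (j%:R < `|w j|)%R) -> real_heat t f (w j) @[j --> \oo] --> (0 : R)%R.
Proof.
move=> t0 q1 fn fq winf; have [mf f0 _] := fn; have [C C0 Mk] := mk.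
have q0 : (0 < q)%R by exact: lt_le_trans q1.
pose B := (C * t `^ (- n.+1%:R))%R.
have B0 : (0 <= B)%R by rewrite mulr_ge0 ?powR_ge0// ltW.
have mfq : measurable_fun setT (fun x => f x `^ q)%R.
  exact: (measurableT_comp (measurable_powR q) mf).
have key (e : R) : (0 < e)%R -> \forall j \near \oo,
    \int[mu]_x (k t x (w j) * f x `^ q)%:E <= e%:E.
  apply: (dominated_cvg0 (mu := mu) (f_ := fun j x => (k t x (w j) * f x `^ q)%R)
    (g := fun x => (B * f x `^ q)%R)).
  - by move=> j; apply: measurable_funM.
  - by apply: measurable_funM => //; exact: measurable_cst.
  - move=> j x; rewrite mulr_ge0 ?powR_ge0 ?(mk_ge0 Mk)//=.
    by apply: ler_wpM2r; rewrite ?powR_ge0// (mk_bound Mk).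
  - under eq_integral do rewrite EFinM.
    rewrite ge0_integralZl_EFin//; last 2 first.
    + by move=> x _; rewrite lee_fin powR_ge0.
    + exact/measurable_EFinP.
    by rewrite lte_mul_pinfty.
  - move=> x; rewrite -(mul0r (f x `^ q)%R); apply: cvgM; last exact: cvg_cst.
    exact: heat_trans_vanish.
apply/cvgrPdist_le => e e0.
have eq0 : (0 < e `^ q)%R by rewrite powR_gt0.
apply: filterS (key _ eq0) => j Hj.
have r0 : (0 <= real_heat t f (w j))%R by exact: (real_heat_ge0 Mk).
rewrite sub0r normrN ger0_norm// leNgt; apply/negP => er.
have : (e `^ q < real_heat t f (w j) `^ q)%R.
  by apply: gt0_ltr_powR; rewrite ?nnegrE// ltW.
apply/negP; rewrite -leNgt -lee_fin -poweR_EFin (real_heatE Mk)//.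
apply: le_trans (heat_op_jensen Mk (w j) t0 q1 _ _) _.
- exact/measurable_EFinP.
- by move=> x; rewrite lee_fin.
apply: le_trans Hj; rewrite le_eqVlt; apply/orP; left; apply/eqP.
by apply: eq_integral => x _; rewrite EFinM -poweR_EFin.
Qed.

Lemma real_heat_C0 t (f : mH -> R) (q : R) : (0 < t)%R -> (1 <= q)%R ->
  bounded_nonneg f -> \int[mu]_x (f x `^ q)%:E < +oo -> C0 (real_heat t f : H -> R).
Proof.
move=> t0 q1 fn fq; apply: C0_seq; first exact: real_heat_continuous.
by move=> w winf; exact: (real_heat_vanish t0 q1 fn fq winf).
Qed.

End heis_heat.

Section strong_continuity.
Local Open Scope ereal_scope.
Context {R : realType} {n : nat}.
Local Notation H := (heis R n).
Local Notation mH := ('rV[R]_n * 'rV[R]_n * measurableTypeR R)%type.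
Variables (h : R -> heis R n -> R) (hh : is_heat_kernel h).
Local Notation mu := (haar : {sigma_finite_measure set mH -> \bar R}).
Local Notation k := (heat_trans h : R -> mH -> mH -> R).
Local Notation real_heat := (real_heat mu k).

Lemma C0_bounded_nonneg (f : H -> R) : C0 f -> (forall eta, 0 <= f eta)%R ->
  bounded_nonneg (f : mH -> R).
Proof.
move=> fC f0; have [cf _] := fC; have [M M0 fM] := C0_bounded fC; split.
- exact: continuous_heis_measurable.
- exact: f0.
- by exists M => x; apply: le_trans (fM x); exact: ler_norm.
Qed.

Lemma heat_op_translate t (f : mH -> \bar R) (eta : H) : (0 < t)%R ->
  measurable_fun setT f -> (forall x, 0 <= f x) ->
  heat_op mu k t f eta = \int[mu]_zeta ((h t zeta)%:E * f (heis_mul eta zeta)).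
Proof.
move=> t0 mf f0.
pose F xi := (h t (heis_mul (heis_inv eta) xi))%:E * f xi.
have mF : measurable_fun [set: mH] F.
  apply: emeasurable_funM => //; apply/measurable_EFinP.
  apply: (measurableT_comp (heat_kernel_measurable hh t0)).
  by apply: measurable_heis_mul; [exact: measurable_cst|exact: measurable_id].
have F0 xi : 0 <= F xi by rewrite mule_ge0// lee_fin ltW// (heat_kernel_gt0 hh).
transitivity (\int[mu]_xi F xi).
  apply: eq_integral => xi _; rewrite /F; congr (_%:E * _).
  by rewrite heat_trans_sym// /heat_trans t0.
rewrite -(haar_left_invariant eta mF F0).
by apply: eq_integral => zeta _; rewrite /F heis_mulVKl.
Qed.

(** The flow averages right translates of [f], so the difference is at most the oscillation over
    small displacements plus [M] times the mass of the kernel away from 0. Dividing by [M + 1]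
    covers [M = 0]. *)
Lemma heat_sup_continuous (f : H -> R) (e : R) : C0 f -> (forall eta, 0 <= f eta)%R ->
  (0 < e)%R -> exists2 rho : R, (0 < rho)%R & forall s, (0 < s)%R -> (s < rho)%R ->
    forall eta, (`|real_heat s f eta - f eta| <= e)%R.
Proof.
move=> fC f0 e0; have [C C_gt0 Mk] := heat_trans_markov hh.
have fn := C0_bounded_nonneg fC f0; have [mf _ _] := fn.
have [M M0 fM] := bounded_nonneg_bound fn.
have e20 : (0 < e / 2)%R by rewrite divr_gt0.
have [rho0 rho0_gt0 Hrho0] := C0_uniform fC e20.
have e2M : (0 < e / 2 / (M + 1))%R by rewrite divr_gt0// ltr_wpDl.
have [rho /= rho_gt0 Hrho] := heat_kernel_concentration hh rho0_gt0 e2M.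
exists rho => // s s0 srho eta.
have Is : \int[mu]_zeta (h s zeta * (rho0 <= `|zeta : H|)%R%:R)%:E <= (e / 2 / (M + 1))%:E.
  by apply: (Hrho s) => //=; rewrite sub0r normrN gtr0_norm.
pose I (zeta : mH) : R := (rho0 <= `|zeta : H|)%R%:R.
have mI : measurable_fun setT I.
  rewrite (_ : I = fun zeta => if (rho0 <= `|zeta : H|)%R then 1%R else 0%R).
    apply: measurable_fun_ifT; [|exact: measurable_cst|exact: measurable_cst].
    apply: measurable_fun_ler; first exact: measurable_cst.
    apply: (continuous_heis_measurable (f := fun zeta : H => `|zeta|%R)) => zeta.
    exact: (@norm_continuous _ _ zeta).
  by apply/funext => zeta; rewrite /I; case: ifP.
have I0 zeta : (0 <= I zeta)%R by rewrite /I.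
have mh := heat_kernel_measurable hh s0.
have h0 zeta : (0 <= h s zeta)%R by rewrite ltW// (heat_kernel_gt0 hh).
have mass := heat_kernel_integral hh s0.
have mtr : measurable_fun [set: mH] (fun zeta => f (heis_mul eta zeta)).
  apply: (measurableT_comp mf).
  by apply: measurable_heis_mul; [exact: measurable_cst|exact: measurable_id].
have hE : (real_heat s f eta)%:E = \int[mu]_zeta (h s zeta * f (heis_mul eta zeta))%:E.
  rewrite (real_heatE Mk)// heat_op_translate//; first by exact/measurable_EFinP.
have osc zeta : (`|f (heis_mul eta zeta) - f eta| <= e / 2 + M * I zeta)%R.
  rewrite /I; have [zr|zr] := leP rho0 `|zeta : H|%R; last first.
    by rewrite mulr0 addr0; exact: Hrho0.
  rewrite mulr1; apply: (@le_trans _ _ M); last by rewrite lerDr ltW.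
  by rewrite ler_norml; apply/andP; split; [rewrite lerNl opprB lerBlDr (le_trans (fM _))// lerDl|
    rewrite lerBlDr (le_trans (fM _))// lerDl].
have bnd : \int[mu]_zeta (h s zeta * (e / 2 + M * I zeta))%:E <= e%:E.
  have -> : \int[mu]_zeta (h s zeta * (e / 2 + M * I zeta))%:E =
      \int[mu]_zeta ((e / 2)%:E * (h s zeta)%:E + M%:E * (h s zeta * I zeta)%:E).
    by apply: eq_integral => zeta _; rewrite -!EFinM -EFinD; congr EFin; ring.
  rewrite ge0_integralD//; last 4 first.
  - by move=> z _; rewrite -EFinM lee_fin mulr_ge0// ltW.
  - by apply: emeasurable_funM; [exact: measurable_cst|exact/measurable_EFinP].
  - by move=> z _; rewrite -EFinM lee_fin !mulr_ge0.
  - apply: emeasurable_funM; first exact: measurable_cst.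
    by apply/measurable_EFinP; exact: measurable_funM.
  rewrite ge0_integralZl_EFin//; last 3 first.
  - by move=> z _; rewrite lee_fin.
  - exact/measurable_EFinP.
  - exact: ltW.
  rewrite ge0_integralZl_EFin//; last 2 first.
  - by move=> z _; rewrite lee_fin mulr_ge0.
  - by apply/measurable_EFinP; exact: measurable_funM.
  rewrite mass mule1; apply: (@le_trans _ _ ((e / 2)%:E + M%:E * (e / 2 / (M + 1))%:E)).
    by apply: leeD2l; apply: lee_wpmul2l.
  rewrite -EFinM -EFinD lee_fin [leRHS]splitr lerD2l mulrCA ler_piMr ?(ltW e20)//.
  by rewrite ler_pdivrMr ?ltr_wpDl// mul1r lerDl.
have cE (a : R) : (0 <= a)%R -> a%:E = \int[mu]_zeta (h s zeta * a)%:E.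
  move=> a0; under eq_integral do rewrite mulrC EFinM.
  rewrite ge0_integralZl_EFin//; last 2 first.
  - by move=> z _; rewrite lee_fin.
  - exact/measurable_EFinP.
  by rewrite mass mule1.
have mosc : measurable_fun [set: mH] (fun zeta => (h s zeta * (e / 2 + M * I zeta))%:E).
  apply/measurable_EFinP; apply: measurable_funM => //.
  apply: measurable_funD; first exact: measurable_cst.
  by apply: measurable_funM => //; exact: measurable_cst.
have osc0 zeta : 0 <= (h s zeta * (e / 2 + M * I zeta))%:E.
  by rewrite lee_fin mulr_ge0// addr_ge0 ?(ltW e20)// mulr_ge0.
have sum (g : mH -> R) : measurable_fun setT g -> (forall z, 0 <= g z)%R ->
    \int[mu]_zeta (h s zeta * g zeta)%:E + \int[mu]_zeta (h s zeta * (e / 2 + M * I zeta))%:E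
    = \int[mu]_zeta (h s zeta * (g zeta + (e / 2 + M * I zeta)))%:E.
  move=> mg g0; rewrite -ge0_integralD//.
  - by apply: eq_integral => z _; rewrite -EFinD -mulrDr.
  - by move=> z _; rewrite lee_fin mulr_ge0.
  - by apply/measurable_EFinP; exact: measurable_funM.
have cmp (g1 g2 : mH -> R) : measurable_fun setT g1 -> measurable_fun setT g2 ->
    (forall z, 0 <= g1 z)%R -> (forall z, 0 <= g2 z)%R ->
    (forall z, `|g1 z - g2 z| <= e / 2 + M * I z)%R ->
    \int[mu]_zeta (h s zeta * g1 zeta)%:E <= \int[mu]_zeta (h s zeta * g2 zeta)%:E + e%:E.
  move=> mg1 mg2 g10 g20 g12.
  apply: le_trans (leeD2l _ bnd); rewrite sum//; apply: ge0_le_integral.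
  - exact: measurableT.
  - by move=> z _; rewrite lee_fin mulr_ge0.
  - by apply/measurable_EFinP; exact: measurable_funM.
  - apply/measurable_EFinP; apply: measurable_funM => //; apply: measurable_funD => //.
    apply: measurable_funD; first exact: measurable_cst.
    by apply: measurable_funM => //; exact: measurable_cst.
  - move=> z _; rewrite lee_fin; apply: ler_wpM2l => //.
    by rewrite -lerBlDl; exact: le_trans (ler_norm _) (g12 z).
rewrite ler_distl; apply/andP; split.
  rewrite lerBlDr -lee_fin EFinD hE (cE _ (f0 eta)).
  by apply: cmp => // z; rewrite distrC.
rewrite -lee_fin EFinD hE (cE _ (f0 eta)).
exact: cmp.
Qed.

Lemma heat_Lq_continuous (f : H -> R) (q e : R) : (1 <= q)%R -> C0 f ->
  (forall eta, 0 <= f eta)%R -> \int[mu]_x (f x `^ q)%:E < +oo -> (0 < e)%R ->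
  exists2 rho : R, (0 < rho)%R & forall s, (0 < s)%R -> (s < rho)%R ->
    \int[mu]_x (`|real_heat s f x - f x| `^ q)%:E <= e%:E.
Proof.
move=> q1 fC f0 fq e0; have [C C_gt0 Mk] := heat_trans_markov hh.
have fn := C0_bounded_nonneg fC f0; have [mf _ _] := fn.
have : \forall s \near (0%R : R)^'+,
    \int[mu]_x (`|real_heat s f x - f x| `^ q)%:E <= e%:E.
  apply: near_seq => u u0.
  have [u_gt0|/existsNP[j /negP uj]] := pselect (forall j, 0 < u j)%R; last first.
    by exists j => /= uj'; rewrite uj' in uj.
  have Hs := @riesz_scheffe R _ mH mu (fun j => real_heat (u j) f) f q q1
    (fun j => let: And3 m _ _ := real_heat_bounded_nonneg Mk (u j) fn in m) mf
    (fun j x => real_heat_ge0 Mk (u j) x f0) f0 fq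
    (fun j => real_heat_Lq Mk (u_gt0 j) q1 fn) _ e e0.
  have [|j /= Hj] := filter_ex (Hs _); last by exists j.
  move=> x; apply/cvgrPdist_le => d d0.
  have [rho rho0 Hrho] := heat_sup_continuous fC f0 d0.
  move/cvgrPdist_lt : u0 => /(_ _ rho0); apply: filterS => j.
  rewrite sub0r normrN gtr0_norm// => uj.
  by rewrite distrC; exact: Hrho.
move=> [rho /= rho0 Hrho]; exists rho => // s s0 sr.
by apply: Hrho => //=; rewrite sub0r normrN gtr0_norm.
Qed.

End strong_continuity.

(** * Continuity of the solution in time *)

Section curve_norms.
Local Open Scope ereal_scope.
Context {R : realType} {n : nat}.
Local Notation H := (heis R n).
Local Notation mH := ('rV[R]_n * 'rV[R]_n * measurableTypeR R)%type.
Local Notation mu := (@haar R n).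
Implicit Types f g : H -> R.

Lemma LqP (q : R) f : (0 < q)%R -> Lq q f <->
  measurable_fun [set: mH] f /\ \int[mu]_x (`|f x| `^ q)%:E < +oo.
Proof.
move=> q0.
have E : 'N[mu]_q%:E [EFin \o f] = (\int[mu]_x (`|f x| `^ q)%:E) `^ q^-1.
  by rewrite unlock /Lnorm; congr (_ `^ _); apply: eq_integral => x _; rewrite -poweR_EFin.
have I0 : 0 <= \int[mu]_x (`|f x| `^ q)%:E.
  by apply: integral_ge0 => x _; rewrite lee_fin powR_ge0.
split.
  move=> /andP[/set_mem mf /set_mem]; rewrite /= /finite_norm E => fq; split => //.
  rewrite -[X in X < _](poweRe1 I0) -(mulVf (lt0r_neq0 q0)) poweRrM.
  exact: poweR_lty.
move=> [mf fq]; apply/andP; split; apply/mem_set => //=.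
by rewrite /finite_norm E; exact: poweR_lty.
Qed.

Lemma Lq_norm_le (q e : R) f : (0 < q)%R -> (0 <= e)%R ->
  \int[mu]_x (`|f x| `^ q)%:E <= (e `^ q)%:E -> Lq_norm q%:E f <= e%:E.
Proof.
move=> q0 e0 H; rewrite /Lq_norm unlock /Lnorm.
have E : \int[mu]_x (`|(EFin \o f) x| `^ q) = \int[mu]_x (`|f x| `^ q)%:E.
  by apply: eq_integral => x _; rewrite -poweR_EFin.
rewrite E; have := poweR_le (ltW (_ : 0 < q^-1)%R) _ H.
rewrite poweR_EFin -powRrM mulfV ?gt_eqF// powRr1//; apply; first by rewrite invr_gt0.
by apply: integral_ge0 => x _; rewrite lee_fin powR_ge0.
Qed.

Lemma Lq_norm_integral (q e : R) f : (0 < q)%R ->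
  Lq_norm q%:E f <= e%:E -> \int[mu]_x (`|f x| `^ q)%:E <= (e `^ q)%:E.
Proof.
move=> q0; rewrite /Lq_norm unlock /Lnorm.
have E : \int[mu]_x (`|(EFin \o f) x| `^ q) = \int[mu]_x (`|f x| `^ q)%:E.
  by apply: eq_integral => x _; rewrite -poweR_EFin.
have I0 : 0 <= \int[mu]_x (`|f x| `^ q)%:E.
  by apply: integral_ge0 => x _; rewrite lee_fin powR_ge0.
rewrite E => /(poweR_le (ltW q0) (poweR_ge0 _ _)).
by rewrite -poweRrM mulVf ?gt_eqF// poweRe1.
Qed.

Lemma sup_norm_ge0 f : 0 <= sup_norm f.
Proof.
apply: (@le_trans _ _ (`|f (0%R : H)|%:E)); first by rewrite lee_fin.
by apply: ereal_sup_ubound; exists (0%R : H).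
Qed.

Lemma sup_norm_le f (e : R) : (forall x, `|f x| <= e)%R <-> sup_norm f <= e%:E.
Proof.
split=> [fe|fe x]; first by apply: ge_ereal_sup => _ [x _ <-]; rewrite lee_fin.
by rewrite -lee_fin; apply: le_trans fe; apply: ereal_sup_ubound; exists x.
Qed.

Lemma sup_norm_triangle f g l : sup_norm (f \- l)%R <= sup_norm (f \- g)%R + sup_norm (g \- l)%R.
Proof.
apply: ge_ereal_sup => _ [x _ <-].
apply: (@le_trans _ _ (`|f x - g x|%:E + `|g x - l x|%:E)).
  by rewrite -EFinD lee_fin; exact: ler_distD.
by apply: leeD; apply: ereal_sup_ubound; exists x.
Qed.

Lemma curve_continuousP (X : set (H -> R)) (N : (H -> R) -> \bar R) (u : R -> H -> R) :
  (forall f, 0 <= N f) -> (forall t, (0 <= t)%R -> X (u t)) ->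
  (forall t, (0 <= t)%R -> forall e : R, (0 < e)%R -> exists2 rho : R, (0 < rho)%R &
    forall s, (0 <= s)%R -> (`|s - t| < rho)%R -> N (u s \- u t)%R <= e%:E) ->
  continuous_curve `[0%R, +oo[%classic X N u.
Proof.
move=> N0 uX uc; split.
  by move=> t /=; rewrite in_itv/= andbT; exact: uX.
move=> t /=; rewrite in_itv/= andbT => t0; apply/ereal_cvg0_near => e e0.
have [rho rho0 Hrho] := uc t t0 e e0.
rewrite near_withinE; exists rho => //= s /= srho; rewrite in_itv/= andbT => s0.
by rewrite gee0_abs//; apply: Hrho => //; rewrite distrC.
Qed.

End curve_norms.

Section solution_curve.
Local Open Scope ereal_scope.
Context {R : realType} {n : nat}.
Local Notation H := (heis R n).
Local Notation mH := ('rV[R]_n * 'rV[R]_n * measurableTypeR R)%type.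
Local Notation mR := (measurableTypeR R).
Variables (h : R -> heis R n -> R) (hh : is_heat_kernel h).
Local Notation mu := (haar : {sigma_finite_measure set mH -> \bar R}).
Local Notation k := (heat_trans h : R -> mH -> mH -> R).
Local Notation leb := (@lebesgue_measure R).
Local Notation real_heat := (real_heat mu k).
Variables (gamma p1 p2 beta r q delta c : R).
Hypotheses (gamma_gt0 : (0 < gamma)%R) (gamma_lt1 : (gamma < 1)%R).
Hypotheses (p1_gt1 : (1 < p1)%R) (p2_gt1 : (1 < p2)%R) (q_ge1 : (1 <= q)%R).
Hypotheses (delta_gt0 : (0 < delta)%R) (c_gt0 : (0 < c)%R).
Variables (u0 : H -> R) (u : mR * mH -> \bar R).
Hypotheses (u0C : C0 u0) (u00 : forall eta, (0 <= u0 eta)%R)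
  (u0q : \int[mu]_x (u0 x `^ q)%:E < +oo).
Hypotheses (us : small_solution mu beta r delta u)
  (ufix : forall z, u z = mild_map mu k gamma p1 p2 (EFin \o u0) u z).
Hypothesis uq : forall t, (0 < t)%R -> Lbound mu q (fun x => u (t, x)) c.

Local Notation source := (source gamma p1 p2 u).
Local Notation increment := (increment mu k gamma p1 p2 u).

(** [u] vanishes at time 0 because the kernels are cut off there; the initial value is put back
    here. *)
Definition solution_curve (t : R) (eta : H) : R :=
  (if 0 < t then fine (u (t, eta)) else u0 eta)%R.
Local Notation v := solution_curve.

Let q_gt0 : (0 < q)%R. Proof. exact: lt_le_trans q_ge1. Qed.

Lemma fine_bounded_nonneg (f : mH -> \bar R) (M : R) : measurable_fun setT f ->
  (forall x, 0 <= f x) -> (forall x, f x <= M%:E) ->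
  bounded_nonneg (fun x => fine (f x)) /\ forall x, (fine (f x))%:E = f x.
Proof.
move=> mf f0 fM.
have fE x : (fine (f x))%:E = f x.
  by rewrite fineK// ge0_fin_numE// (le_lt_trans (fM x))// ltry.
split => //; split.
- exact: (measurableT_comp (@fine_measurable R setT measurableT) mf).
- by move=> x; exact: fine_ge0.
- by exists M => x; rewrite -lee_fin fE.
Qed.

Let u_slice t : bounded_nonneg (fun x : mH => fine (u (t, x))) /\
  forall x, (fine (u (t, x)))%:E = u (t, x).
Proof.
have [um u_ge0 _ ud _] := us.
by apply: (@fine_bounded_nonneg _ delta) => //; exact: measurable_slice.
Qed.

Lemma solution_curveE t eta : (0 < t)%R -> (v t eta)%:E = u (t, eta).
Proof. by move=> t0; rewrite /v t0; exact: (u_slice t).2. Qed.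

Lemma solution_curve_le0 t : (t <= 0)%R -> v t = u0.
Proof. by move=> t0; apply/funext => eta; rewrite /v ltNge t0. Qed.

Lemma solution_curve_bounded t : bounded_nonneg (v t : mH -> R).
Proof.
have [t0|t0] := ltP 0%R t; last by rewrite solution_curve_le0//; exact: C0_bounded_nonneg.
have -> : v t = fun eta => fine (u (t, eta)) by apply/funext => eta; rewrite /v t0.
exact: (u_slice t).1.
Qed.

Lemma solution_curve_Lq t : \int[mu]_x ((v t x) `^ q)%:E < +oo.
Proof.
have [t0|t0] := ltP 0%R t; last by rewrite solution_curve_le0.
apply: (@le_lt_trans _ _ (c `^ q)%:E); last exact: ltry.
apply: le_trans (uq t0); rewrite le_eqVlt; apply/orP; left; apply/eqP.
by apply: eq_integral => x _; rewrite -poweR_EFin solution_curveE.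
Qed.

Let source_slice s : bounded_nonneg (fun x : mH => fine (source (s, x))) /\
  forall x, (fine (source (s, x)))%:E = source (s, x).
Proof.
have [M M0 HM] := source_bound gamma_gt0 gamma_lt1 p1_gt1 p2_gt1 delta_gt0 us s.
apply: (@fine_bounded_nonneg _ M).
- exact: (measurable_slice (measurable_source gamma p1 p2 us)).
- by move=> x; exact: source_ge0.
- by move=> x; exact: HM.
Qed.

Let source_Lq s : \int[mu]_x (fine (source (s, x)) `^ q)%:E < +oo.
Proof.
have [s0|s0] := ltP 0%R s; last first.
  rewrite integral0_eq ?ltry// => x _.
  by rewrite (source_null _ p1_gt1 p2_gt1 us)// powR0// gt_eqF.
have [M M0 HM] := source_Lbound gamma_gt0 gamma_lt1 p1_gt1 p2_gt1 q_ge1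
  delta_gt0 c_gt0 us uq s.
apply: (@le_lt_trans _ _ (M `^ q)%:E); last exact: ltry.
apply: le_trans (HM s s0 (lexx s)); rewrite le_eqVlt; apply/orP; left; apply/eqP.
by apply: eq_integral => x _; rewrite -poweR_EFin (source_slice s).2.
Qed.

Let mkC := heat_trans_markov hh.

Let increment_fin t tau x : (0 <= tau)%R ->
  (fine (increment t tau x))%:E = increment t tau x.
Proof.
move=> tau0; have [C C_gt0 mk] := mkC.
have [M M0 HM] := source_bound gamma_gt0 gamma_lt1 p1_gt1 p2_gt1 delta_gt0 us (t + tau)%R.
rewrite fineK// ge0_fin_numE; last exact: (increment_ge0 mk).
apply: (le_lt_trans (increment_le mk us (t := t) x tau0 (ltW M0) HM)); exact: ltry.
Qed.

(** Dominated convergence in [s], with the local bound on [source] as majorant. It yields both the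
    continuity of the increment and, with [L = 0], its vanishing at infinity. *)
Lemma increment_limit t (w : nat -> H) (L : mR -> R) : (0 < t)%R ->
  measurable_fun setT L ->
  (forall s, (s < t)%R ->
    real_heat (t - s) (fun x => fine (source (s, x))) (w j) @[j --> \oo] --> L s) ->
  increment 0 t (w j) @[j --> \oo] --> \int[leb]_(s in `[0%R, t[) (L s)%:E.
Proof.
move=> t0 mL HL; have [C C_gt0 mk] := mkC.
have [M M0 HM] := source_bound gamma_gt0 gamma_lt1 p1_gt1 p2_gt1 delta_gt0 us t.
have ms := measurable_source gamma p1 p2 us.
have mh (x : H) : measurable_fun [set: mR]
    (fun s : mR => heat_op mu k (t - s) (fun y => source (s, y)) x).
  apply: (measurable_heat_op mk (f := source) (y := cst x)).
  - by apply: measurable_funB; [exact: measurable_cst|exact: measurable_id].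
  - exact: ms.
  - exact: source_ge0.
  - exact: measurable_cst.
have hE s x : heat_op mu k (t - s) (fun y => source (s, y)) x =
    (real_heat (t - s) (fun x => fine (source (s, x))) x)%:E.
  rewrite (real_heatE mk); last exact: (source_slice s).1.
  by apply: eq_integral => y _; rewrite /= (source_slice s).2.
rewrite /increment add0r.
have mitv : measurable (`[0%R, t[%classic : set mR) by exact: measurable_itv.
have [] := @dominated_convergence _ mR R leb `[0%R, t[%classic mitv
  (fun j s => heat_op mu k (t - s) (fun y => source (s, y)) (w j))
  (fun s => (L s)%:E) (fun=> M%:E) _ _ _ _ _.
- by move=> j; apply: measurable_funTS; exact: mh.
- by apply: measurable_funTS; exact/measurable_EFinP.
- apply: aeW => s /=; rewrite in_itv/= => /andP[_ st].
  under eq_cvg do rewrite hE.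
  by apply: cvg_EFin; [near=> j|exact: HL].
- apply: (@measurable_bounded_integrable _ mR R leb (fun=> M)).
  + exact: mitv.
  + by rewrite /= lebesgue_measure_itv/= lte_fin t0 ltry.
  + exact: measurable_cst.
  + by exists M; split; [exact: num_real|move=> N MN s _ /=; rewrite ger0_norm ?ltW// ltW].
- apply: aeW => s j /=; rewrite in_itv/= => /andP[_ st].
  rewrite gee0_abs; last by apply: (heat_op_ge0 mk) => y; exact: source_ge0.
  apply: (heat_op_le_cst mk).
  + exact: measurable_slice.
  + by move=> y; exact: source_ge0.
  + exact: ltW.
  + by move=> y; apply: HM; exact: ltW.
by move=> _ _.
Unshelve. all: by end_near. Qed.

Lemma increment_C0 t : (0 < t)%R -> C0 (fun eta : H => fine (increment 0 t eta)).
Proof.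
move=> t0; have [C C_gt0 mk] := mkC.
have t0' := ltW t0.
apply: C0_seq => [eta|w winf].
  apply/cvgrPdist_le => e e0; apply: (@near_seq R H eta) => w weta.
  pose L s := real_heat (t - s) (fun x => fine (source (s, x))) eta.
  have lim := @increment_limit t w L t0 _ _.
  have mL : measurable_fun [set: mR] L.
    apply: (measurableT_comp (@fine_measurable R setT measurableT)).
    apply: (measurable_heat_op mk (f := fun z => (fine (source z))%:E) (y := cst eta)).
    - by apply: measurable_funB; [exact: measurable_cst|exact: measurable_id].
    - apply/measurable_EFinP; apply: (measurableT_comp (@fine_measurable R setT measurableT)).
      exact: measurable_source us.
    - by move=> z; rewrite lee_fin; apply: fine_ge0; exact: source_ge0.
    - exact: measurable_cst.
  have LE : \int[leb]_(s in `[0%R, t[) (L s)%:E = (fine (increment 0 t eta))%:E.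
    rewrite increment_fin// /increment add0r; apply: eq_integral => s _.
    rewrite /L (real_heatE mk); last exact: (source_slice s).1.
    by apply: eq_integral => y _; rewrite /= (source_slice s).2.
  have : fine (increment 0 t (w j)) @[j --> \oo] --> fine (increment 0 t eta).
    apply: fine_cvg; rewrite -LE; apply: increment_limit => // s st.
    apply: (cvg_compose (h := real_heat (t - s) _ : H -> R)) weta.
    apply: real_heat_continuous => //; first by rewrite subr_gt0.
    exact: (source_slice s).1.
  by move=> /cvgrPdist_le/(_ e e0)/filter_ex[j Hj]; exists j.
have W : increment 0 t (w j) @[j --> \oo] --> (0%R)%:E.
  have -> : (0%R)%:E = \int[leb]_(s in `[0%R, t[) ((fun=> 0%R) s)%:E :> \bar R.
    by rewrite integral0.
  apply: increment_limit => // s st.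
  have ts0 : (0 < t - s)%R by rewrite subr_gt0.
  exact: (real_heat_vanish hh ts0 q_ge1 (source_slice s).1 (source_Lq s) winf).
exact: (fine_cvg W).
Qed.

Lemma C0D (f g : H -> R) : C0 f -> C0 g -> C0 (f \+ g)%R.
Proof.
move=> fC gC; have [cf _] := fC; have [cg _] := gC; apply: C0_seq.
  by move=> eta; apply: cvgD; [exact: cf|exact: cg].
have van (l : H -> R) (w : nat -> H) : C0 l -> (forall j, (j%:R < `|w j|)%R) ->
    l (w j) @[j --> \oo] --> (0 : R)%R.
  move=> lC winf; apply/cvgrPdist_lt => e e0; have [N HN] := C0_bounded_set lC e0.
  near=> j; rewrite sub0r normrN; apply: HN; apply: lt_trans (winf j).
  by near: j; exact: nbhs_infty_gtr.
move=> w winf; rewrite -(addr0 (0 : R)%R); apply: cvgD; exact: van.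
Unshelve. all: by end_near. Qed.

Lemma solution_curve_increment t tau eta : (0 <= t)%R -> (0 < tau)%R ->
  v (t + tau) eta = (real_heat tau (v t) eta + fine (increment t tau eta))%R.
Proof.
move=> t0 tau0; have [C C_gt0 mk] := mkC.
have mu0 : measurable_fun [set: mH] (EFin \o u0).
  by apply/measurable_EFinP; have [] := C0_bounded_nonneg u0C u00.
apply: EFin_inj; rewrite EFinD (real_heatE mk); last exact: solution_curve_bounded.
rewrite (increment_fin _ _ (ltW tau0)) solution_curveE; last by rewrite ltr_wpDl.
move: t0; rewrite le_eqVlt => /predU1P[<-|t0].
  rewrite add0r (increment0 mk p1_gt1 p2_gt1 us ufix eta tau0).
  by rewrite solution_curve_le0.
rewrite (semigroup_decomposition mk mu0 _ us ufix eta t0 tau0); last by move=> x; rewrite lee_fin.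
by congr (heat_op _ _ _ _ _ + _); apply/funext => y; rewrite /= solution_curveE.
Qed.

(** At positive times membership in [C_0] comes from smoothing: the curve is the flow of the datum
    plus an integral of flows of source slices, all of them bounded and in [L ^ q]. *)
Lemma solution_curve_C0 t : C0 (v t).
Proof.
have [t0|t0] := ltP 0%R t; last first.
  by rewrite solution_curve_le0.
have -> : v t = (real_heat t (v 0%R) \+ (fun eta => fine (increment 0 t eta)))%R.
  by apply/funext => eta; rewrite -{1}(add0r t) solution_curve_increment.
apply: C0D; last exact: increment_C0.
apply: (real_heat_C0 hh t0 q_ge1); first exact: solution_curve_bounded.
exact: solution_curve_Lq.
Qed.

Lemma solution_curve_sup_continuous t : (0 <= t)%R -> forall e : R, (0 < e)%R ->
  exists2 rho : R, (0 < rho)%R & forall s, (0 <= s)%R -> (`|s - t| < rho)%R ->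
    sup_norm (v s \- v t)%R <= e%:E.
Proof.
have [C C_gt0 mk] := mkC.
apply: (@semigroup_curve_continuity R (H -> R) (fun f g => sup_norm (f \- g)%R)
  (fun=> True) _ _ _ v (fun t s => real_heat s (v t))) => //.
- move=> f _; apply: le_anti; rewrite sup_norm_ge0 andbT.
  by apply/sup_norm_le => x /=; rewrite subrr normr0.
- move=> f g; congr ereal_sup; apply/seteqP; split => _ [x _ <-]; exists x => //=;
    by rewrite distrC.
- by move=> f g l _ _ _; exact: sup_norm_triangle.
- move=> s s0 e e0.
  have [_ v0 _] := solution_curve_bounded s.
  have [rho rho0 Hrho] := heat_sup_continuous hh (solution_curve_C0 s) v0 e0.
  by exists rho => // tau tau0 taur; apply/sup_norm_le; exact: Hrho.
- move=> T.
  have [M M0 HM] := source_bound gamma_gt0 gamma_lt1 p1_gt1 p2_gt1 delta_gt0 us T.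
  exists M => // s tau s0 tau0 stT; apply/sup_norm_le => x /=.
  rewrite solution_curve_increment// addrAC subrr add0r ger0_norm; last first.
    by apply: fine_ge0; exact: (increment_ge0 mk).
  rewrite -lee_fin (increment_fin _ _ (ltW tau0)).
  apply: (increment_le mk us _ (ltW tau0) (ltW M0)) => a y aT.
  by apply: HM; exact: le_trans stT.
- move=> s tau1 tau2 s0 t10 t20.
  have vb := solution_curve_bounded s.
  have E x : real_heat (tau1 + tau2) (v s) x = real_heat tau1 (real_heat tau2 (v s)) x.
    by rewrite (real_heat_semigroup mk) 1?addrC.
  apply: ge_ereal_sup => _ [x _ <-] /=; rewrite E.
  have [S|] := boolP (sup_norm (real_heat tau2 (v s) \- v s)%R \is a fin_num); last first.
    by rewrite ge0_fin_numE ?sup_norm_ge0// -leNgt leye_eq => /eqP ->; rewrite leey.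
  rewrite -(fineK S) lee_fin; apply: (real_heat_dist_sup mk) => //.
    exact: (real_heat_bounded_nonneg mk).
  by apply/sup_norm_le; rewrite fineK.
Qed.

Lemma solution_curve_Lq_continuous t : (0 <= t)%R -> forall e : R, (0 < e)%R ->
  exists2 rho : R, (0 < rho)%R & forall s, (0 <= s)%R -> (`|s - t| < rho)%R ->
    Lq_norm q%:E (v s \- v t)%R <= e%:E.
Proof.
have [C C_gt0 mk] := mkC.
have q_ge1' : 1 <= q%:E by rewrite lee_fin.
apply: (@semigroup_curve_continuity R (H -> R) (fun f g => Lq_norm q%:E (f \- g)%R)
  (fun f => measurable_fun [set: mH] f) _ _ _ v (fun t s => real_heat s (v t))) => //.
- move=> f _; apply: le_anti; rewrite Lnorm_ge0 andbT; apply: Lq_norm_le => //.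
  rewrite integral0_eq ?lee_fin ?powR_ge0// => x _.
  by rewrite /= subrr normr0 powR0// gt_eqF.
- move=> f g; rewrite /Lq_norm -Lnorm_abse -[RHS]Lnorm_abse; congr (Lnorm _ _ _).
  by apply/funext => x /=; rewrite distrC.
- move=> f g l mf mg ml; rewrite /Lq_norm.
  have -> : (f \- l = (f \- g) \+ (g \- l))%R by apply/funext => x /=; ring.
  exact: (eminkowski (haar : {measure set mH -> \bar R}) (measurable_funB mf mg)
    (measurable_funB mg ml) q_ge1').
- by move=> s _; have [] := solution_curve_bounded s.
- by move=> s tau _ _; have [] := real_heat_bounded_nonneg mk tau (solution_curve_bounded s).
- move=> s s0 e e0.
  have [_ v0 _] := solution_curve_bounded s.
  have eq0 : (0 < e `^ q)%R by rewrite powR_gt0.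
  have [rho rho0 Hrho] := heat_Lq_continuous hh q_ge1 (solution_curve_C0 s) v0
    (solution_curve_Lq s) eq0.
  by exists rho => // tau tau0 taur; apply: Lq_norm_le => //; [exact: ltW|exact: Hrho].
- move=> T.
  have [M M0 HM] := source_Lbound gamma_gt0 gamma_lt1 p1_gt1 p2_gt1 q_ge1
    delta_gt0 c_gt0 us uq T.
  exists M => // s tau s0 tau0 stT; apply: Lq_norm_le => //.
    by rewrite mulr_ge0 ?ltW.
  have := increment_Lbound mk C_gt0 q_ge1 us s0 tau0 M0
    (fun a a0 aT => HM a a0 (le_trans aT stT)).
  apply: le_trans; rewrite le_eqVlt; apply/orP; left; apply/eqP; apply: eq_integral => x _ /=.
  rewrite solution_curve_increment// addrAC subrr add0r -poweR_EFin ger0_norm; last first.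
    by apply: fine_ge0; exact: (increment_ge0 mk).
  by rewrite (increment_fin _ _ (ltW tau0)).
- move=> s tau1 tau2 s0 t10 t20.
  have vb := solution_curve_bounded s.
  have vb2 := real_heat_bounded_nonneg mk tau2 vb.
  have E x : real_heat (tau1 + tau2) (v s) x = real_heat tau1 (real_heat tau2 (v s)) x.
    by rewrite (real_heat_semigroup mk) 1?addrC.
  rewrite /Lq_norm unlock /Lnorm; apply: poweR_le.
  + by rewrite invr_ge0 ltW.
  + by apply: integral_ge0 => x _; exact: poweR_ge0.
  apply: le_trans (real_heat_dist_Lq mk t10 q_ge1 vb2 vb).
  by rewrite le_eqVlt; apply/orP; left; apply/eqP; apply: eq_integral => x _; rewrite /= E.
Qed.

Lemma solution_curve_global : global_curve q v.
Proof.
split; apply: curve_continuousP.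
- exact: sup_norm_ge0.
- by move=> t _; exact: solution_curve_C0.
- exact: solution_curve_sup_continuous.
- by move=> f; exact: Lnorm_ge0.
- move=> t _; apply/(LqP _ q_gt0); have [mv v0 _] := solution_curve_bounded t; split => //.
  under eq_integral do rewrite ger0_norm//.
  exact: solution_curve_Lq.
- exact: solution_curve_Lq_continuous.
Qed.

End solution_curve.

(** * Uniqueness *)

Section Rintegral_facts.
Context {R : realType}.
Local Notation leb := (@lebesgue_measure R).
Local Notation mR := (measurableTypeR R).

(* No integrability is needed, because [fine] sends the infinities to 0. *)
Lemma measurable_Rintegral d1 d2 (Z : measurableType d1) (Y : measurableType d2)
    (m : {sigma_finite_measure set Y -> \bar R}) (F : Z * Y -> R) :
  measurable_fun setT F -> measurable_fun setT (fun z => \int[m]_y F (z, y)).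
Proof.
move=> mF; have mF' : measurable_fun setT (EFin \o F) by exact/measurable_EFinP.
have -> : (fun z => \int[m]_y F (z, y)) = fine \o
    (fun z => \int[m]_y ((EFin \o F)^\+ (z, y)) - \int[m]_y ((EFin \o F)^\- (z, y)))%E.
  apply/funext => z; rewrite /= /Rintegral integralE.
  by congr (fine (_ - _)); apply: eq_integral => y _; rewrite ?funeposE ?funenegE.
apply: (measurableT_comp (@fine_measurable R setT measurableT)).
apply: emeasurable_funB.
- apply: (measurable_fun_fubini_tonelli_F (m2 := m) (EFin \o F)^\+%E) => //.
  exact: measurable_funepos.
- apply: (measurable_fun_fubini_tonelli_F (m2 := m) (EFin \o F)^\-%E) => //.
  exact: measurable_funeneg.
Qed.

Lemma integrable_le d (Y : measurableType d) (m : {measure set Y -> \bar R})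
    (D : set Y) (f b : Y -> R) : measurable D -> measurable_fun D f ->
  measurable_fun D b -> (forall y, D y -> `|f y| <= b y) ->
  (\int[m]_(y in D) (b y)%:E < +oo)%E -> m.-integrable D (EFin \o f).
Proof.
move=> mD mf mb fb bi; apply/integrableP; split; first exact/measurable_EFinP.
apply: le_lt_trans bi; apply: ge0_le_integral => //.
- by apply: measurableT_comp => //; exact/measurable_EFinP.
- exact/measurable_EFinP.
Qed.

Lemma Rintegral_dist d (Y : measurableType d) (m : {measure set Y -> \bar R})
    (D : set Y) (f g : Y -> R) (c : R) : measurable D ->
  m.-integrable D (EFin \o f) -> m.-integrable D (EFin \o g) ->
  (\int[m]_(y in D) (`|f y - g y|)%:E <= c%:E)%E ->
  `|\int[m]_(y in D) f y - \int[m]_(y in D) g y| <= c.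
Proof.
move=> mD fi gi fg; rewrite -RintegralB//.
have fgi : m.-integrable D (EFin \o (fun y => f y - g y)).
  have := integrableB mD fi gi; exact: eq_integrable.
apply: le_trans (le_normr_Rintegral mD fgi) _.
rewrite -lee_fin; apply: le_trans fg; rewrite /Rintegral fineK//.
apply: integrable_fin_num => //; exact: integrable_norm.
Qed.

(** The endpoints are exceptional: [heat_semigroup] at time 0 is the identity whereas the cut-off
    kernel gives 0, and the curve starts at the datum whereas [u] starts at 0. As null sets they can
    be discarded. *)
Lemma Rintegral_itv_ccoo (a b : R) (f : mR -> R) : measurable_fun `]a, b[%classic f ->
  \int[leb]_(x in `[a, b]) f x = \int[leb]_(x in `]a, b[) f x.
Proof.
move=> mf; congr fine; apply: integral_itv_bndoo; exact/measurable_EFinP.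
Qed.

Lemma integral_expR_le (lam t : R) : 0 < lam -> 0 < t ->
  (\int[leb]_(s in `]0%R, t[) (expR (lam * s))%:E <= (expR (lam * t) / lam)%:E)%E.
Proof.
move=> l0 t0; pose F (s : R) := lam^-1 * expR (lam * s).
have dF (s : R) : derivable F s 1 by exact: ex_derive.
have dFE (s : R) : derive1 F s = expR (lam * s).
  rewrite /F derive1Ml// derive1_comp// derive1E.
  have /funeqP -> := @derive_expR R.
  by rewrite derive1Ml// derive1_id mulr1 mulrCA mulVf ?gt_eqF// mulr1.
have cF (s : R) : {for s, continuous F}.
  by apply: differentiable_continuous; apply/derivable1_diffP; exact: dF.
rewrite -(integral_itv_bndoo true false); last first.
  apply/measurable_EFinP; apply: measurable_funTS.
  apply: measurableT_comp => //; apply: measurable_funM => //.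
rewrite (@continuous_FTC2 R (fun s => expR (lam * s)) F 0 t t0).
- rewrite /F mulr0 expR0 mulr1 lee_fin mulrC lerBlDr lerDl invr_ge0 ltW//.
- apply: continuous_in_subspaceT => s _.
  apply: (@continuous_comp _ _ _ (fun y => lam * y) expR); last exact: continuous_expR.
  exact: mulrl_continuous.
- split.
  + by move=> s _; exact: dF.
  + by apply: cvg_at_right_filter; exact: cF.
  + by apply: cvg_at_left_filter; exact: cF.
- by move=> s _; exact: dFE.
Qed.

Lemma power_nl_ge0 (p a : R) : 1 < p -> 0 <= a -> power_nl p a = a `^ p.
Proof.
move=> p1 a0; rewrite /power_nl ger0_norm// mulrC mulr_powRB1//.
exact: lt_trans p1.
Qed.

Lemma power_nlN (p a : R) : power_nl p (- a) = - power_nl p a.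
Proof. by rewrite /power_nl normrN mulrN. Qed.

Lemma power_nl_norm (p a B : R) : 1 < p -> `|a| <= B -> `|power_nl p a| <= B `^ p.
Proof.
move=> p1 aB; have p0 : 0 < p by exact: lt_trans p1.
rewrite /power_nl normrM ger0_norm ?powR_ge0// mulrC mulr_powRB1//.
by apply: ge0_ler_powR; rewrite ?nnegrE ?(le_trans _ aB)// ltW.
Qed.

(** The competitor in the uniqueness statement may change sign. For equal signs this is
    [powR_lipschitz]; for opposite signs [|a - b| = |a| + |b|], and the two powers are bounded
    separately. *)
Lemma power_nl_lipschitz (p a b B : R) : 1 < p -> `|a| <= B -> `|b| <= B ->
  `|power_nl p a - power_nl p b| <= p * B `^ (p - 1) * `|a - b|.
Proof.
move=> p1 aB bB; have p0 : 0 < p by exact: lt_trans p1.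
have pos x y : 0 <= x -> 0 <= y -> x <= B -> y <= B ->
    `|power_nl p x - power_nl p y| <= p * B `^ (p - 1) * `|x - y|.
  move=> x0 y0 xB yB; rewrite !power_nl_ge0//; apply: powR_lipschitz => //.
  - exact: ltW.
  - by rewrite x0.
  - by rewrite y0.
have opp x y : 0 <= x -> 0 <= y -> x <= B -> y <= B ->
    `|power_nl p x + power_nl p y| <= p * B `^ (p - 1) * (x + y).
  move=> x0 y0 xB yB; rewrite !power_nl_ge0// ger0_norm ?addr_ge0 ?powR_ge0//.
  have le z : 0 <= z -> z <= B -> z `^ p <= p * B `^ (p - 1) * z.
    move=> z0 zB; rewrite -(mulr_powRB1 z0 p0) mulrC; apply: ler_wpM2r => //.
    apply: (@le_trans _ _ (B `^ (p - 1))).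
      by apply: ge0_ler_powR; rewrite ?nnegrE ?subr_ge0 ?(le_trans z0 zB)// ltW.
    by rewrite ler_peMl ?powR_ge0// ltW.
  by rewrite mulrDr; apply: lerD; exact: le.
have B0 : 0 <= B by exact: le_trans aB.
have [a0|/ltW a0] := leP 0 a; have [b0|/ltW b0] := leP 0 b.
- by apply: pos => //; [move: aB; rewrite ger0_norm|move: bB; rewrite ger0_norm].
- have -> : power_nl p a - power_nl p b = power_nl p a + power_nl p (- b).
    by rewrite power_nlN.
  rewrite [`|a - b|]ger0_norm ?subr_ge0 ?(le_trans b0)//.
  by apply: opp; rewrite ?oppr_ge0//; [move: aB; rewrite ger0_norm|move: bB; rewrite ler0_norm].
- have -> : power_nl p a - power_nl p b = - (power_nl p (- a) + power_nl p b).
    by rewrite power_nlN; ring.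
  rewrite normrN distrC [`|b - a|]ger0_norm ?subr_ge0 ?(le_trans a0)// addrC [b - a]addrC.
  by rewrite addrC; apply: opp; rewrite ?oppr_ge0//; [move: aB; rewrite ler0_norm|move: bB; rewrite ger0_norm].
- have -> : power_nl p a - power_nl p b = power_nl p (- b) - power_nl p (- a).
    by rewrite !power_nlN; ring.
  have -> : `|a - b| = `|- b - - a| by rewrite opprK addrC.
  by apply: pos; rewrite ?oppr_ge0//; [move: bB; rewrite ler0_norm|move: aB; rewrite ler0_norm].
Qed.

Lemma measurable_power_nl (p : R) : measurable_fun [set: R] (power_nl p : R -> R).
Proof.
apply: measurable_funM => //; apply: (measurableT_comp (measurable_powR _)).
exact: normr_measurable.
Qed.

End Rintegral_facts.

Section uniqueness.
Context {R : realType} {n : nat}.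
Local Notation H := (heis R n).
Local Notation mH := ('rV[R]_n * 'rV[R]_n * measurableTypeR R)%type.
Local Notation mR := (measurableTypeR R).
Variables (h : R -> heis R n -> R) (hh : is_heat_kernel h).
Local Notation mu := (haar : {sigma_finite_measure set mH -> \bar R}).
Local Notation k := (heat_trans h : R -> mH -> mH -> R).
Local Notation leb := (@lebesgue_measure R).

Let mkx t (y : mH) : measurable_fun setT (fun x : mH => k t x y).
Proof.
by apply: (measurable_heat_trans hh); [exact: measurable_cst|exact: measurable_id|exact: measurable_cst].
Qed.

Let k_mass t (y : mH) : 0 < t -> (\int[mu]_x (k t x y)%:E = 1)%E.
Proof. by move=> t0; have [C C0 mk] := heat_trans_markov hh; exact: (mk_mass_l mk). Qed.

Let k_mass_cst t (y : mH) c : 0 < t -> 0 <= c -> (\int[mu]_x (c * k t x y)%:E = c%:E)%E.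
Proof.
move=> t0 c0; under eq_integral do rewrite EFinM.
rewrite ge0_integralZl_EFin//; last 2 first.
- by move=> x _; rewrite lee_fin (heat_trans_ge0 hh).
- by apply/measurable_EFinP; exact: mkx.
by rewrite k_mass// mule1.
Qed.

Lemma heat_semigroupE t (f : H -> R) (eta : H) : 0 < t ->
  heat_semigroup h t f eta = \int[mu]_x (f x * k t x eta).
Proof.
move=> t0; rewrite /heat_semigroup gt_eqF//; apply: eq_Rintegral => x _.
by rewrite /heat_trans t0.
Qed.

Lemma heat_integrable t (f : mH -> R) M (eta : H) : 0 < t ->
  measurable_fun setT f -> (forall x, `|f x| <= M) ->
  mu.-integrable setT (EFin \o (fun x => f x * k t x eta)).
Proof.
move=> t0 mf fM; have M0 : 0 <= M by exact: le_trans (fM eta).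
apply: (@integrable_le _ _ _ mu setT _ (fun x => M * k t x eta)).
- exact: measurableT.
- by apply: measurable_funM => //; exact: mkx.
- by apply: measurable_funM; [exact: measurable_cst|exact: mkx].
- move=> x _; rewrite normrM (ger0_norm (heat_trans_ge0 hh _ _ _)).
  by apply: ler_wpM2r => //; exact: (heat_trans_ge0 hh).
- by rewrite k_mass_cst// ltry.
Qed.

Lemma heat_semigroup_dist t (f g : mH -> R) M c (eta : H) : 0 < t ->
  measurable_fun setT f -> measurable_fun setT g ->
  (forall x, `|f x| <= M) -> (forall x, `|g x| <= M) -> (forall x, `|f x - g x| <= c) ->
  `|\int[mu]_x (f x * k t x eta) - \int[mu]_x (g x * k t x eta)| <= c.
Proof.
move=> t0 mf mg fM gM fg; have c0 : 0 <= c by exact: le_trans (fg eta).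
apply: Rintegral_dist.
- exact: measurableT.
- exact: heat_integrable fM.
- exact: heat_integrable gM.
- rewrite -(k_mass_cst eta t0 c0); apply: ge0_le_integral.
  + exact: measurableT.
  + by move=> x _; rewrite lee_fin.
  + apply/measurable_EFinP; apply: measurableT_comp => //.
    by apply: measurable_funB; apply: measurable_funM => //; exact: mkx.
  + apply/measurable_EFinP; apply: measurable_funM; first exact: measurable_cst.
    exact: mkx.
  + move=> x _; rewrite lee_fin -mulrBl normrM (ger0_norm (heat_trans_ge0 hh _ _ _)).
    by apply: ler_wpM2r => //; exact: (heat_trans_ge0 hh).
Qed.

Let heat_path (G : mR * mH -> R) t (eta : H) (s : mR) : R :=
  \int[mu]_x (G (s, x) * k (t - s) x eta).

Let measurable_heat_path G t eta : measurable_fun setT G ->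
  measurable_fun setT (heat_path G t eta).
Proof.
move=> mG; apply: (@measurable_Rintegral _ _ _ mR mH mu
  (fun z => G z * k (t - z.1) z.2 eta)).
apply: measurable_funM => //; apply: (measurable_heat_trans hh).
- by apply: measurable_funB; [exact: measurable_cst|exact: measurable_fst].
- exact: measurable_snd.
- exact: measurable_cst.
Qed.

Lemma heat_semigroup_Rintegral (G : mR * mH -> R) t (eta : H) : measurable_fun setT G ->
  \int[leb]_(s in `[0, t]) heat_semigroup h (t - s) (fun x => G (s, x)) eta =
  \int[leb]_(s in `]0, t[) \int[mu]_x (G (s, x) * k (t - s) x eta).
Proof.
move=> mG.
have E s : s \in `]0, t[%classic ->
    heat_semigroup h (t - s) (fun x => G (s, x)) eta = heat_path G t eta s.
  rewrite inE/= in_itv/= => /andP[_ st]; rewrite heat_semigroupE// subr_gt0//.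
rewrite (@Rintegral_itv_ccoo R 0 t
    (fun s => heat_semigroup h (t - s) (fun x => G (s, x)) eta)); last first.
  apply: (eq_measurable_fun (heat_path G t eta)).
    by move=> s /E ->.
  by apply: measurable_funTS; exact: measurable_heat_path.
exact: eq_Rintegral.
Qed.

(** Integrating [exp (lam * s)] gains the factor [1 / lam], which a large [lam] makes small. [M]
    provides the integrability that real-valued integrals ask for. *)
Lemma duhamel_dist (t lam c M : R) (eta : H) (G1 G2 : mR * mH -> R) :
  0 < t -> 0 < lam -> 0 <= c ->
  measurable_fun setT G1 -> measurable_fun setT G2 ->
  (forall s x, 0 < s -> s < t -> `|G1 (s, x)| <= M) ->
  (forall s x, 0 < s -> s < t -> `|G2 (s, x)| <= M) ->
  (forall s x, 0 < s -> s < t -> `|G1 (s, x) - G2 (s, x)| <= c * expR (lam * s)) ->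
  `|\int[leb]_(s in `[0, t]) heat_semigroup h (t - s) (fun x => G1 (s, x)) eta -
    \int[leb]_(s in `[0, t]) heat_semigroup h (t - s) (fun x => G2 (s, x)) eta|
  <= c / lam * expR (lam * t).
Proof.
move=> t0 l0 c0 mG1 mG2 G1M G2M G12.
rewrite !heat_semigroup_Rintegral//.
have mitv : measurable (`]0, t[%classic : set mR) by exact: measurable_itv.
have M0 : 0 <= M.
  apply: le_trans (G1M (t / 2) (0 : H) _ _); rewrite ?divr_gt0//.
  by rewrite ltr_pdivrMr// ltr_pMr// ltr1n.
have mp (G : mR * mH -> R) : measurable_fun setT G -> measurable_fun `]0, t[%classic (heat_path G t eta).
  by move=> mG; apply: measurable_funTS; exact: measurable_heat_path.
have mGs (G : mR * mH -> R) s : measurable_fun setT G -> measurable_fun setT (fun x => G (s, x)).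
  by move=> mG; apply: (measurableT_comp mG); exact: measurable_pair1.
(* Comparison with the zero function turns the estimate of differences into a bound for a single
   heat path. *)
have z0 s : \int[mu]_x ((fun=> 0) x * k (t - s) x eta) = 0 :> R.
  rewrite (_ : (fun x => _) = fun=> 0); last by apply/funext => x; rewrite mul0r.
  by rewrite Rintegral_cst// mul0r.
have ip (G : mR * mH -> R) : measurable_fun setT G -> (forall s x, 0 < s -> s < t -> `|G (s, x)| <= M) ->
    leb.-integrable `]0, t[%classic (EFin \o heat_path G t eta).
  move=> mG GM; apply: (@integrable_le _ _ mR leb _ _ (fun=> M)) => //.
  - exact: mp.
  - move=> s /=; rewrite in_itv/= => /andP[s0 st].
    rewrite -[X in `|X|]subr0 -(z0 s).
    apply: (@heat_semigroup_dist _ (fun x => G (s, x)) (fun=> 0) M) => //.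
    + by rewrite subr_gt0.
    + exact: mGs.
    + by move=> x; exact: GM.
    + by move=> x; rewrite normr0.
    + by move=> x; rewrite subr0; exact: GM.
  - rewrite integral_cst//= lebesgue_measure_itv/= lte_fin t0.
    by rewrite -EFinB -EFinM ltry.
apply: Rintegral_dist => //; [exact: ip|exact: ip|].
apply: (@le_trans _ _ (\int[leb]_(s in `]0%R, t[) (c%:E * (expR (lam * s))%:E))%E).
  apply: ge0_le_integral => //.
  - apply/measurable_EFinP; apply: measurableT_comp => //.
    by apply: measurable_funB; exact: mp.
  - apply: emeasurable_funM => //; apply/measurable_EFinP; apply: measurable_funTS.
    by apply: measurableT_comp => //; exact: measurable_funM.
  - move=> s /=; rewrite in_itv/= => /andP[s0 st]; rewrite -EFinM lee_fin.
    apply: (@heat_semigroup_dist _ (fun x => G1 (s, x)) (fun x => G2 (s, x)) M).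
    + by rewrite subr_gt0.
    + exact: mGs.
    + exact: mGs.
    + by move=> x; exact: G1M.
    + by move=> x; exact: G2M.
    + by move=> x; exact: G12.
rewrite ge0_integralZl_EFin//; last first.
  apply/measurable_EFinP; apply: measurable_funTS.
  by apply: measurableT_comp => //; exact: measurable_funM.
rewrite mulrAC -mulrA EFinM; apply: lee_wpmul2l; first by rewrite lee_fin.
exact: integral_expR_le.
Qed.

Section memory_term.
Variables (gamma : R).
Hypotheses (gamma_gt0 : 0 < gamma) (gamma_lt1 : gamma < 1).

Definition real_memory (F : mR * mH -> R) (z : mR * mH) : R :=
  \int[leb]_(s in `[0, z.1]) ((z.1 - s) `^ (- gamma) * F (s, z.2)).

Lemma measurable_real_memory (F : mR * mH -> R) : measurable_fun setT F ->
  measurable_fun setT (real_memory F).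
Proof.
move=> mF.
have -> : real_memory F = fun z => \int[leb]_s
    (if (0 <= s) && (s <= z.1) then (z.1 - s) `^ (- gamma) * F (s, z.2) else 0).
  apply/funext => z; rewrite /real_memory Rintegral_mkcond; apply: eq_Rintegral => s _.
  rewrite patchE; have -> : (s \in `[0, z.1]%classic) = (0 <= s) && (s <= z.1) by
    apply/idP/idP; rewrite inE/= in_itv.
  by [].
apply: (@measurable_Rintegral _ _ _ (mR * mH)%type mR leb (fun w : (mR * mH) * mR =>
  if (0 <= w.2) && (w.2 <= w.1.1) then (w.1.1 - w.2) `^ (- gamma) * F (w.2, w.1.2) else 0)).
have m1 : measurable_fun [set: (mR * mH) * mR] (fun w => w.1.1).
  by apply: (measurableT_comp measurable_fst); exact: measurable_fst.
have m2 : measurable_fun [set: (mR * mH) * mR] (fun w => w.2) by exact: measurable_snd.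
apply: measurable_fun_ifT; last exact: measurable_cst.
  apply: measurable_and.
    by apply: measurable_fun_ler => //; exact: measurable_cst.
  exact: measurable_fun_ler.
apply: measurable_funM.
  apply: (measurableT_comp (measurable_powR _)); exact: measurable_funB.
apply: (measurableT_comp mF); apply: measurable_fun_pair; first exact: m2.
by apply: (measurableT_comp measurable_snd); exact: measurable_fst.
Qed.

Let memory_integrand (F : mR * mH -> R) s x : measurable_fun setT F ->
  measurable_fun setT (fun a : mR => (s - a) `^ (- gamma) * F (a, x)).
Proof.
move=> mF; apply: measurable_funM; first exact: measurable_powRN_translate.
by apply: (measurableT_comp mF); exact: measurable_pair2.
Qed.

(** The exponential weight is monotone, so its value at the upper end leaves the integral, and the
    memory weight contributes its mass. With [lam = 0] and [F2 = 0] it also bounds a single memory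
    term. *)
Lemma real_memory_dist (F1 F2 : mR * mH -> R) (M lam c s : R) (x : mH) : 0 < s -> 0 <= lam -> 0 <= c ->
  measurable_fun setT F1 -> measurable_fun setT F2 ->
  (forall (a : mR) (y : mH), 0 < a -> a < s -> `|F1 (a, y)| <= M) ->
  (forall (a : mR) (y : mH), 0 < a -> a < s -> `|F2 (a, y)| <= M) ->
  (forall (a : mR) (y : mH), 0 < a -> a < s -> `|F1 (a, y) - F2 (a, y)| <= c * expR (lam * a)) ->
  `|real_memory F1 (s, x) - real_memory F2 (s, x)| <=
    c * expR (lam * s) * (s `^ (1 - gamma) / (1 - gamma)).
Proof.
move=> s0 l0 c0 mF1 mF2 F1M F2M F12; rewrite /real_memory/=.
have mi F := @memory_integrand F s x.
rewrite (Rintegral_itv_ccoo (measurable_funTS (mi _ mF1))).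
rewrite (Rintegral_itv_ccoo (measurable_funTS (mi _ mF2))).
have g01 : 0 <= gamma < 1 by rewrite gamma_lt1 ltW.
have M0 : 0 <= M.
  apply: le_trans (F1M (s / 2) x _ _); rewrite ?divr_gt0//.
  by rewrite ltr_pdivrMr// ltr_pMr// ltr1n.
have wi c' : 0 <= c' -> (\int[leb]_(a in `]0%R, s[) (c' * (s - a) `^ (- gamma))%:E <=
    (c' * (s `^ (1 - gamma) / (1 - gamma)))%:E)%E.
  move=> c0'; under eq_integral do rewrite EFinM.
  rewrite ge0_integralZl_EFin//; last 2 first.
  - by move=> a _; rewrite lee_fin powR_ge0.
  - by apply/measurable_EFinP; apply: measurable_funTS; exact: measurable_powRN_translate.
  rewrite EFinM; apply: lee_wpmul2l; first by rewrite lee_fin.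
  exact: integral_powRN_translate.
have mw c' : measurable_fun setT (fun a : mR => c' * (s - a) `^ (- gamma)).
  by apply: measurable_funM; [exact: measurable_cst|exact: measurable_powRN_translate].
have ip (F : mR * mH -> R) : measurable_fun setT F ->
    (forall (a : mR) (y : mH), 0 < a -> a < s -> `|F (a, y)| <= M) ->
    leb.-integrable `]0, s[%classic (EFin \o (fun a => (s - a) `^ (- gamma) * F (a, x))).
  move=> mF FM.
  apply: (@integrable_le _ _ mR leb _ _ (fun a => M * (s - a) `^ (- gamma))).
  - exact: measurable_itv.
  - by apply: measurable_funTS; exact: mi.
  - by apply: measurable_funTS; exact: mw.
  - move=> a /=; rewrite in_itv/= => /andP[a0 sa].
    rewrite normrM ger0_norm ?powR_ge0// mulrC; apply: ler_wpM2r; first exact: powR_ge0.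
    exact: FM.
  - by apply: le_lt_trans (wi M M0) _; rewrite ltry.
apply: Rintegral_dist.
- exact: measurable_itv.
- exact: ip.
- exact: ip.
have E0 : 0 <= c * expR (lam * s) by rewrite mulr_ge0 ?expR_ge0.
apply: le_trans (wi _ E0); apply: ge0_le_integral.
- exact: measurable_itv.
- by move=> a _; rewrite lee_fin.
- apply/measurable_EFinP; apply: measurable_funTS; apply: measurableT_comp => //.
  by apply: measurable_funB; exact: mi.
- by apply/measurable_EFinP; apply: measurable_funTS; exact: mw.
- move=> a /=; rewrite in_itv/= => /andP[a0 sa]; rewrite lee_fin -mulrBr normrM.
  rewrite ger0_norm ?powR_ge0// mulrC; apply: ler_wpM2r; first exact: powR_ge0.
  apply: le_trans (F12 a x a0 sa) _; apply: ler_wpM2l => //.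
  by rewrite ler_expR; apply: ler_wpM2l => //; exact: ltW.
Qed.

End memory_term.

End uniqueness.

Section uniqueness_theorem.
Context {R : realType} {n : nat}.
Local Notation H := (heis R n).
Local Notation mH := ('rV[R]_n * 'rV[R]_n * measurableTypeR R)%type.
Local Notation mR := (measurableTypeR R).
Variables (h : R -> heis R n -> R) (hh : is_heat_kernel h).
Local Notation leb := (@lebesgue_measure R).
Implicit Types v w : R -> H -> R.

Lemma curve_sup_near v (t e : R) : continuous_curve `[0, +oo[%classic C0 sup_norm v -> 0 <= t -> 0 < e ->
  \forall s \near t, 0 <= s -> forall eta, `|v s eta - v t eta| <= e.
Proof.
move=> [_ cv] t0 e0; have : `[0, +oo[%classic t by rewrite /= in_itv/= andbT.
move=> /(cv t)/ereal_cvg0_near/(_ e e0); rewrite near_withinE; apply: filterS => s Hs s0 eta.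
have := Hs; rewrite /= in_itv/= andbT => /(_ s0).
rewrite gee0_abs ?sup_norm_ge0// => /sup_norm_le; exact.
Qed.

(** Compactness of [[0, T]]: near each time the curve is within 1 of a bounded function. *)
Lemma curve_bounded v (T : R) : continuous_curve `[0, +oo[%classic C0 sup_norm v ->
  exists2 B : R, 0 <= B & forall t eta, 0 <= t -> t <= T -> `|v t eta| <= B.
Proof.
move=> vc; have [vC _] := vc.
have := (compact_near_coveringP `[0, T]%classic).1 (@segment_compact R 0 T) nat \oo
  (fun (N : nat) (s : R) => 0 <= s -> forall eta, `|v s eta| <= N%:R) _.
case=> [t /=|N _ HN]; rewrite ?in_itv/=.
  move=> /andP[t0 _].
  have Dt : `[0, +oo[%classic t by rewrite /= in_itv/= andbT.
  have [M M0 HM] := C0_bounded (vC t Dt).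
  exists ([set s | 0 <= s -> forall eta, `|v s eta - v t eta| <= 1], [set N : nat | M + 1 <= N%:R]).
    split; first exact: curve_sup_near.
    exact: nbhs_infty_ger.
  move=> [s N] /= [Hs HN] s0 eta; apply: le_trans HN.
  rewrite -(subrK (v t eta) (v s eta)); apply: le_trans (ler_normD _ _) _.
  by rewrite addrC; apply: lerD => //; exact: Hs.
exists N%:R => // t eta t0 tT.
by apply: (HN N (leqnn N) t) => //=; rewrite in_itv/= t0.
Qed.

(** Freezing the curve at its initial value for negative times gives a function continuous in all
    real times, as [caratheodory_measurable] asks. *)
Definition clamped v (z : mR * mH) : R := v (Num.max 0 z.1) z.2.

Lemma clampedE v (s : R) (x : H) : 0 <= s -> clamped v (s, x) = v s x.
Proof. by move=> s0; rewrite /clamped/= max_r. Qed.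

Lemma measurable_clamped v : continuous_curve `[0, +oo[%classic C0 sup_norm v ->
  measurable_fun setT (clamped v).
Proof.
move=> vc; have [vC _] := vc.
have mx0 (t : R) : 0 <= Num.max 0 t by rewrite le_max lexx.
apply: caratheodory_measurable.
  move=> x t; apply/cvgrPdist_le => e e0; rewrite /clamped/=.
  have cmax : Num.max 0 s @[s --> t] --> Num.max 0 t.
    by apply: (@continuous_max R R (cst 0) id); [exact: cvg_cst|exact: cvg_id].
  move: cmax => /(_ _ (curve_sup_near vc (mx0 t) e0)) F.
  apply: (@filterS R (nbhs (t : R)) _ _ _ _ F) => s /= Hs.
  by rewrite distrC; apply: Hs.
move=> t; rewrite /clamped/=; apply: continuous_heis_measurable.
have Dt : `[0, +oo[%classic (Num.max 0 t) by rewrite /= in_itv/= andbT.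
by have [] := vC _ Dt.
Qed.

Variables (gamma p1 p2 : R) (u0 : H -> R).
Hypotheses (gamma_gt0 : 0 < gamma) (gamma_lt1 : gamma < 1).
Hypotheses (p1_gt1 : 1 < p1) (p2_gt1 : 1 < p2).

Let nl v (p : R) (z : mR * mH) : R := power_nl p (clamped v z).

Let measurable_nl v (p : R) : continuous_curve `[0, +oo[%classic C0 sup_norm v ->
  measurable_fun setT (nl v p).
Proof.
by move=> vc; exact: (measurableT_comp (measurable_power_nl p) (measurable_clamped vc)).
Qed.

Lemma mild_solutionE v (T t : R) (eta : H) : mild_solution h gamma p1 p2 u0 T v -> 0 <= t -> t <= T ->
  v t eta = heat_semigroup h t u0 eta +
    \int[leb]_(s in `[0, t]) heat_semigroup h (t - s)
      (fun x => real_memory gamma (nl v p1) (s, x)) eta +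
    \int[leb]_(s in `[0, t]) heat_semigroup h (t - s) (fun x => nl v p2 (s, x)) eta.
Proof.
move=> [_ vE] t0 tT.
have tD : t \in `[0, T] by rewrite in_itv/= t0.
apply: etrans (vE t eta tD) _.
have E1 : \int[leb]_(s in `[0, t]) heat_semigroup h (t - s)
      (fun xi => \int[leb]_(sigma in `[0, s])
         ((s - sigma) `^ (- gamma) * power_nl p1 (v sigma xi))) eta =
    \int[leb]_(s in `[0, t]) heat_semigroup h (t - s)
      (fun x => real_memory gamma (nl v p1) (s, x)) eta.
  apply: eq_Rintegral => s; rewrite inE/= in_itv/= => /andP[s0 _].
  congr (heat_semigroup h (t - s) _ eta); apply/funext => x.
  apply: eq_Rintegral => a; rewrite inE/= in_itv/= => /andP[a0 _].
  by rewrite /nl clampedE.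
have E2 : \int[leb]_(s in `[0, t]) heat_semigroup h (t - s)
      (fun xi => power_nl p2 (v s xi)) eta =
    \int[leb]_(s in `[0, t]) heat_semigroup h (t - s) (fun x => nl v p2 (s, x)) eta.
  apply: eq_Rintegral => s; rewrite inE/= in_itv/= => /andP[s0 _].
  by congr (heat_semigroup h (t - s) _ eta); apply/funext => x; rewrite /nl clampedE.
by rewrite E1 E2.
Qed.

Lemma mild_solution0 v w (eta : H) (T : R) : 0 <= T -> mild_solution h gamma p1 p2 u0 T v ->
  mild_solution h gamma p1 p2 u0 T w -> v 0 eta = w 0 eta.
Proof.
move=> T0 vm wm; rewrite (mild_solutionE eta vm (lexx 0) T0) (mild_solutionE eta wm (lexx 0) T0).
by rewrite set_itv1 !Rintegral_set1.
Qed.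

(** In the weight [exp (lam * t)] the choice of [lam] beats the Lipschitz constants of the
    nonlinearities on the common bound [B], so each pass through the equation halves the constant on
    all of [[0, T]] at once. *)
Lemma global_mild_unique v w :
  continuous_curve `[0, +oo[%classic C0 sup_norm v ->
  continuous_curve `[0, +oo[%classic C0 sup_norm w ->
  global_mild_solution h gamma p1 p2 u0 v -> global_mild_solution h gamma p1 p2 u0 w ->
  forall t eta, 0 <= t -> v t eta = w t eta.
Proof.
move=> vc wc vm wm T eta0 T0.
(* [T] may be 0, while the solutions are given on intervals of positive length. *)
have T10 : 0 < T + 1 by rewrite ltr_wpDl.
have {}vm := vm _ T10; have {}wm := wm _ T10.
have [B1 B10 vB1] := curve_bounded T vc; have [B2 B20 wB2] := curve_bounded T wc.
pose B := Num.max B1 B2.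
have vB t x : 0 <= t -> t <= T -> `|v t x| <= B.
  by move=> t0 tT; rewrite /B le_max vB1.
have wB t x : 0 <= t -> t <= T -> `|w t x| <= B.
  by move=> t0 tT; rewrite /B le_max wB2// orbT.
have B0 : 0 <= B by rewrite /B le_max B10.
have g10 : 0 < 1 - gamma by rewrite subr_gt0.
pose W := T `^ (1 - gamma) / (1 - gamma).
have W0 : 0 <= W by rewrite divr_ge0 ?powR_ge0// ltW.
pose L1 := p1 * B `^ (p1 - 1); pose L2 := p2 * B `^ (p2 - 1).
have L10 : 0 <= L1 by rewrite mulr_ge0 ?powR_ge0// (le_trans _ (ltW p1_gt1)).
have L20 : 0 <= L2 by rewrite mulr_ge0 ?powR_ge0// (le_trans _ (ltW p2_gt1)).
(* Twice the total Lipschitz constant, where [W] bounds the mass of the memory weight, plus 1 for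
   positivity. *)
pose lam := 2 * (L1 * W + L2) + 1.
have l0 : 0 < lam by rewrite ltr_wpDl// mulr_ge0// addr_ge0// mulr_ge0.
have sW s : 0 < s -> s < T -> s `^ (1 - gamma) / (1 - gamma) <= W.
  move=> s0 sT; apply: ler_wpM2r; first by rewrite invr_ge0 ltW.
  by apply: ge0_ler_powR; rewrite ?nnegrE// ltW.
have nlB u p s x : 1 < p -> (forall t y, 0 <= t -> t <= T -> `|u t y| <= B) ->
    0 < s -> s < T -> `|nl u p (s, x)| <= B `^ p.
  by move=> p_gt1 uB s0 sT; apply: power_nl_norm => //; rewrite clampedE ?uB// ltW.
have z0 (s : mR) (x : mH) : real_memory gamma (fun _ : mR * mH => 0) (s, x) = 0.
  rewrite /real_memory/=; under eq_Rintegral do rewrite mulr0.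
  rewrite Rintegral_cst ?mul0r//; exact: measurable_itv.
have memB u s x : continuous_curve `[0, +oo[%classic C0 sup_norm u ->
    (forall t y, 0 <= t -> t <= T -> `|u t y| <= B) ->
    0 < s -> s < T -> `|real_memory gamma (nl u p1) (s, x)| <= B `^ p1 * W.
  move=> uc uB s0 sT; rewrite -[X in `|X|]subr0 -(z0 s x).
  apply: le_trans (@real_memory_dist _ _ _ gamma_gt0 gamma_lt1 (nl u p1) (fun=> 0)
    (B `^ p1) 0 (B `^ p1) s x s0 (lexx 0) (powR_ge0 _ _) (measurable_nl p1 uc) _ _ _ _) _.
  - exact: measurable_cst.
  - by move=> a y a0 sa; apply: nlB => //; exact: lt_trans sT.
  - by move=> a y _ _; rewrite normr0 powR_ge0.
  - move=> a y a0 sa; rewrite subr0 mul0r expR0 mulr1.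
    by apply: nlB => //; exact: lt_trans sT.
  - by rewrite mul0r expR0 mulr1; apply: ler_wpM2l; [exact: powR_ge0|exact: sW].
have split (a a1 a2 b1 b2 x y : R) : `|a1 - b1| <= x -> `|a2 - b2| <= y ->
    `|a + a1 + a2 - (a + b1 + b2)| <= x + y.
  move=> ax by'; have -> : a + a1 + a2 - (a + b1 + b2) = (a1 - b1) + (a2 - b2) by ring.
  by apply: le_trans (ler_normD _ _) _; exact: lerD.
have claim j : forall t eta, 0 <= t -> t <= T ->
    `|v t eta - w t eta| <= 2 * B * 2^-1 ^+ j * expR (lam * t).
  elim: j => [|j IH] t eta t0 tT.
    rewrite expr0 mulr1; apply: (@le_trans _ _ (2 * B)).
      apply: le_trans (ler_normB _ _) _; rewrite mulr_natl mulr2n.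
      by apply: lerD; [exact: vB|exact: wB].
    rewrite ler_peMr ?mulr_ge0//; apply: (@le_trans _ _ (expR 0)); first by rewrite expR0.
    by rewrite ler_expR mulr_ge0// ltW.
  move: t0; rewrite le_eqVlt => /predU1P[<-|t0].
    rewrite (mild_solution0 eta (ltW T10) vm wm) subrr normr0.
    by rewrite !mulr_ge0 ?expR_ge0// exprn_ge0// invr_ge0.
  have tT1 : t <= T + 1 by apply: le_trans tT _; rewrite lerDl.
  rewrite (mild_solutionE eta vm (ltW t0) tT1) (mild_solutionE eta wm (ltW t0) tT1).
  set A := 2 * B * 2^-1 ^+ j.
  have A0 : 0 <= A by rewrite !mulr_ge0// exprn_ge0// invr_ge0.
  have st s : s < t -> s < T by move=> st; exact: lt_le_trans tT.
  have nld p s x : 1 < p -> 0 < s -> s < t ->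
      `|nl v p (s, x) - nl w p (s, x)| <= p * B `^ (p - 1) * A * expR (lam * s).
    move=> pgt1 s0 s_t; have sT := st _ s_t.
    have p0 : 0 <= p by rewrite (le_trans _ (ltW pgt1)).
    rewrite /nl !clampedE ?(ltW s0)//.
    apply: le_trans (power_nl_lipschitz pgt1 (vB _ _ (ltW s0) (ltW sT)) (wB _ _ (ltW s0) (ltW sT))) _.
    by rewrite -[leRHS]mulrA; apply: ler_wpM2l; [rewrite mulr_ge0 ?powR_ge0|apply: IH; exact: ltW].
  have D1 := @duhamel_dist _ _ h hh t lam (L1 * A * W) (B `^ p1 * W) eta
    (real_memory gamma (nl v p1)) (real_memory gamma (nl w p1)) t0 l0
    (mulr_ge0 (mulr_ge0 L10 A0) W0)
    (measurable_real_memory gamma (measurable_nl p1 vc))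
    (measurable_real_memory gamma (measurable_nl p1 wc))
    (fun s x s0 s_t => memB v s x vc vB s0 (st s s_t))
    (fun s x s0 s_t => memB w s x wc wB s0 (st s s_t)) _.
  have D2 := @duhamel_dist _ _ h hh t lam (L2 * A) (B `^ p2) eta
    (nl v p2) (nl w p2) t0 l0 (mulr_ge0 L20 A0)
    (measurable_nl p2 vc) (measurable_nl p2 wc)
    (fun s x s0 s_t => nlB v p2 s x p2_gt1 vB s0 (st s s_t))
    (fun s x s0 s_t => nlB w p2 s x p2_gt1 wB s0 (st s s_t))
    (fun s x s0 s_t => nld p2 s x p2_gt1 s0 s_t).
  apply: le_trans (split _ _ _ _ _ _ _ (D1 _) D2) _.
    move=> s x s0 s_t; have sT := st _ s_t.
    apply: le_trans (@real_memory_dist _ _ _ gamma_gt0 gamma_lt1 (nl v p1) (nl w p1)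
      (B `^ p1) lam (L1 * A) s x s0 (ltW l0) (mulr_ge0 L10 A0) (measurable_nl p1 vc)
      (measurable_nl p1 wc) _ _ _) _.
    - by move=> a y a0 sa; apply: nlB => //; exact: lt_trans sT.
    - by move=> a y a0 sa; apply: nlB => //; exact: lt_trans sT.
    - by move=> a y a0 sa; apply: nld => //; exact: lt_trans s_t.
    - rewrite [leRHS]mulrAC; apply: ler_wpM2l; last exact: sW.
      exact: (mulr_ge0 (mulr_ge0 L10 A0) (expR_ge0 _)).
  rewrite -mulrDl; apply: ler_wpM2r; first exact: expR_ge0.
  have -> : 2 * B * 2^-1 ^+ j.+1 = A / 2 by rewrite /A exprSr mulrA.
  rewrite -mulrDl ler_pdivrMr//.
  have -> : L1 * A * W + L2 * A = A * (L1 * W + L2) by ring.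
  have -> : A / 2 * lam = A * (L1 * W + L2 + 2^-1) by rewrite /lam; field.
  by apply: ler_wpM2l; [exact: A0|rewrite lerDl invr_ge0].
have [->|N0] := eqVneq (v T eta0) (w T eta0); first by [].
exfalso; have d0 : 0 < `|v T eta0 - w T eta0| by rewrite normr_gt0 subr_eq0.
pose Q := 2 * B * expR (lam * T).
have Q0 : 0 <= Q by rewrite !mulr_ge0 ?expR_ge0.
have : (2^-1 : R) ^+ j @[j --> \oo] --> (0 : R).
  by apply: cvg_expr; rewrite ger0_norm ?invr_ge0// invf_lt1// ltr1n.
have e0 : 0 < `|v T eta0 - w T eta0| / (Q + 1) by rewrite divr_gt0// ltr_wpDl.
move=> /cvgrPdist_lt/(_ _ e0)/filter_ex[j].
rewrite sub0r normrN ger0_norm ?exprn_ge0 ?invr_ge0// ltr_pdivlMr ?ltr_wpDl// => Hj.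
have := claim j T eta0 T0 (lexx T).
rewrite mulrAC -/Q leNgt => /negP; apply; apply: le_lt_trans Hj.
by rewrite mulrC; apply: ler_wpM2l; rewrite ?exprn_ge0 ?invr_ge0// lerDl.
Qed.

End uniqueness_theorem.

(** * The fixed point is a mild solution *)

Section mild_solution_of_fixed_point.
Context {R : realType} {n : nat}.
Local Notation H := (heis R n).
Local Notation mH := ('rV[R]_n * 'rV[R]_n * measurableTypeR R)%type.
Local Notation mR := (measurableTypeR R).
Variables (h : R -> heis R n -> R) (hh : is_heat_kernel h).
Local Notation mu := (haar : {sigma_finite_measure set mH -> \bar R}).
Local Notation k := (heat_trans h : R -> mH -> mH -> R).
Local Notation leb := (@lebesgue_measure R).

Lemma continuous_curve_subset (D D' : set R) (X : set (H -> R)) (N : (H -> R) -> \bar R)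
    (v : R -> H -> R) : D' `<=` D -> continuous_curve D X N v -> continuous_curve D' X N v.
Proof.
move=> DD [vX vc]; split => t D't; first exact/vX/DD.
apply: cvg_trans (vc t (DD _ D't)); apply: cvg_app => A /=.
change (within D (nbhs t) A -> within D' (nbhs t) A).
rewrite /within/=; apply: (@filterS R (nbhs t)) => s /= As D's.
exact: As (DD _ D's).
Qed.

Lemma heat_semigroup_real_heat t (f : H -> R) (eta : H) : 0 < t ->
  heat_semigroup h t f eta = real_heat mu k t f eta.
Proof.
move=> t0; rewrite heat_semigroupE//; congr fine.
by apply: eq_integral => x _; rewrite /= mulrC.
Qed.

(** The theorem measures the datum by its essential sup; under the integral against a nonnegative
    kernel of mass 1, an almost everywhere bound suffices. *)
Lemma heat_op_le_ess_sup t (f : H -> R) (e : R) (eta : H) : 0 <= e ->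
  measurable_fun [set: mH] f -> (forall x, 0 <= f x) -> (Lq_norm +oo f <= e%:E)%E ->
  (heat_op mu k t (EFin \o f) eta <= e%:E)%E.
Proof.
move=> e0 mf f0 fe; have [C C_gt0 mk] := heat_trans_markov hh.
have [t0|t0] := leP t 0; first by rewrite (heat_op_le0 mk)// lee_fin.
have ae_f : \forall x \ae mu, ((f x)%:E <= e%:E)%E.
  move: fe; rewrite /Lq_norm unlock /Lnorm; case: ifPn => [_|].
    move=> /ess_sup_inf.ess_supP; apply: filterS => x /=.
    by rewrite ger0_norm.
  (* In this branch the norm of order [+oo] is 0 by convention; the whole space is null, so every
     property holds almost everywhere. *)
  rewrite -leNgt => mu0 _; exists setT; split => //.
  by apply/eqP; rewrite eq_le mu0/=; exact: measure_ge0.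
have mkx : measurable_fun setT (fun x : mH => (k t x eta)%:E).
  apply/measurable_EFinP; apply: (mk_measurable mk);
    [exact: measurable_cst|exact: measurable_id|exact: measurable_cst].
rewrite -(heat_op_cst mk eta t0 e0); apply: ae_ge0_le_integral.
- exact: measurableT.
- by move=> x _; rewrite mule_ge0// lee_fin ?(mk_ge0 mk).
- by apply: emeasurable_funM => //; exact/measurable_EFinP.
- by move=> x _; rewrite mule_ge0// lee_fin ?(mk_ge0 mk).
- by apply: emeasurable_funM => //; exact: measurable_cst.
- apply: (@filterS mH (almost_everywhere mu) _ _ _ _ ae_f) => x fx _; apply: lee_wpmul2l; last exact: fx.
  by rewrite lee_fin (mk_ge0 mk).
Qed.

Variables (gamma p1 p2 beta r delta : R).
Hypotheses (gamma_gt0 : 0 < gamma) (gamma_lt1 : gamma < 1).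
Hypotheses (p1_gt1 : 1 < p1) (p2_gt1 : 1 < p2) (delta_gt0 : 0 < delta).
Variables (u0 : H -> R) (u : mR * mH -> \bar R).
Hypotheses (u0C : C0 u0) (u00 : forall eta, 0 <= u0 eta).
Hypotheses (us : small_solution mu beta r delta u)
  (ufix : forall z, u z = mild_map mu k gamma p1 p2 (EFin \o u0) u z).
Local Notation v := (solution_curve u0 u).

Let um : measurable_fun setT u. Proof. by have [] := us. Qed.
Let u_ge0 z : (0 <= u z)%E. Proof. by have [_ h0 _ _ _] := us; exact: h0. Qed.

Let uE s x : 0 < s -> (v s x)%:E = u (s, x).
Proof.
move=> s0; rewrite /solution_curve s0 fineK// ge0_fin_numE//.
have [_ _ _ ud _] := us; apply: le_lt_trans (ud _) _; exact: ltry.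
Qed.

Let v_ge0 s x : 0 <= v s x.
Proof. by rewrite /solution_curve; case: ifP => // _; exact: fine_ge0. Qed.

Let powerE (p s : R) x : 1 < p -> 0 < s -> (power_nl p (v s x))%:E = (u (s, x) `^ p)%E.
Proof. by move=> pgt1 s0; rewrite power_nl_ge0// -poweR_EFin uE. Qed.

Local Notation mem := (memory gamma (fun w => u w `^ p1)%E).

Let mpow (p : R) : measurable_fun setT (fun w => u w `^ p)%E.
Proof. exact: (measurableT_comp (measurable_poweR p) um). Qed.

Let pow_ge0 (p : R) w : (0 <= u w `^ p)%E. Proof. exact: poweR_ge0. Qed.

Let mem_ge0 w : (0 <= mem w)%E. Proof. exact: memory_ge0. Qed.

Let mem_meas : measurable_fun setT mem. Proof. exact: measurable_memory. Qed.

(** The sum is finite because [u] is bounded; hence each nonnegative term is finite and [fine] is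
    additive. *)
Let mild_fin t x (a b c : \bar R) : u (t, x) = (a + b + c)%E ->
  (0 <= a)%E -> (0 <= b)%E -> (0 <= c)%E ->
  fine (u (t, x)) = fine a + fine b + fine c.
Proof.
move=> E a0 b0 c0; have : (a + b + c < +oo)%E.
  by rewrite -E; have [_ _ _ ud _] := us; apply: le_lt_trans (ud _) _; exact: ltry.
rewrite E; case: a b c a0 b0 c0 {E} => [a| |] [b| |] [c| |]//=.
Qed.

Let duhamel_Rintegral (F : mR * mH -> \bar R) t M (eta : H) :
  measurable_fun setT F -> (forall z, 0 <= F z)%E -> past_null F -> 0 <= M ->
  (forall (s : R) x, s <= t -> (F (s, x) <= M%:E)%E) ->
  \int[leb]_(s in `[0, t]) heat_semigroup h (t - s) (fun x => fine (F (s, x))) eta =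
  fine (duhamel mu k F (t, eta)).
Proof.
move=> mF F0 F_null M0 FM; have [C C_gt0 mk] := heat_trans_markov hh.
rewrite (@heat_semigroup_Rintegral _ _ _ hh (fun z => fine (F z))); last first.
  exact: (measurableT_comp (@fine_measurable R setT measurableT) mF).
have -> : duhamel mu k F (t, eta) =
    (\int[leb]_(s in `]0%R, t[) heat_op mu k (t - s) (fun x => F (s, x)) eta)%E.
  exact: (duhamelE mk F_null t eta).
congr fine; apply: eq_integral => s; rewrite inE/= in_itv/= => /andP[s0 st].
have [Fb FE] := @fine_bounded_nonneg _ _ (fun x => F (s, x)) M (measurable_slice mF s)
  (fun x => F0 (s, x)) (fun x => FM s x (ltW st)).
have -> : heat_op mu k (t - s) (fun x => F (s, x)) eta =
    heat_op mu k (t - s) (EFin \o (fun x => fine (F (s, x)))) eta.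
  by apply: eq_integral => x _; rewrite /= FE.
rewrite -(real_heatE mk)//; congr EFin; congr fine.
by apply: eq_integral => x _; rewrite /= mulrC.
Qed.

Let memory_Rintegral s (x : H) : 0 <= s ->
  \int[leb]_(a in `[0, s]) ((s - a) `^ (- gamma) * power_nl p1 (v a x)) = fine (mem (s, x)).
Proof.
have mn : past_null mem := memory_null (power_null p1_gt1 us) gamma.
rewrite le_eqVlt => /predU1P[<-|s0].
  by rewrite set_itv1 Rintegral_set1 mn.
pose f (a : mR) := fine (((s - a) `^ (- gamma))%:E * (u (a, x) `^ p1))%E.
have fE a : 0 < a -> (s - a) `^ (- gamma) * power_nl p1 (v a x) = f a.
  by move=> a0; rewrite /f -powerE.
have mf : measurable_fun setT f.
  apply: (measurableT_comp (@fine_measurable R setT measurableT)).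
  apply: emeasurable_funM; last exact: (measurable_path (mpow p1)).
  by apply/measurable_EFinP; exact: measurable_powRN_translate.
rewrite (@Rintegral_itv_ccoo R 0 s); last first.
  apply: (eq_measurable_fun f); last exact: measurable_funTS.
  by move=> a; rewrite inE/= in_itv/= => /andP[a0 _]; rewrite fE.
rewrite (memoryE (power_null p1_gt1 us)).
congr fine; apply: eq_integral => a; rewrite inE/= in_itv/= => /andP[a0 _].
by rewrite EFinM powerE.
Qed.

Lemma fixed_point_mild : continuous_curve `[0, +oo[%classic C0 sup_norm v ->
  global_mild_solution h gamma p1 p2 u0 v.
Proof.
move=> vc T T0; split.
  by apply: continuous_curve_subset vc => t /=; rewrite !in_itv/= => /andP[->].
have [C C_gt0 mk] := heat_trans_markov hh.
have u0b := C0_bounded_nonneg u0C u00.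
move=> t eta; rewrite in_itv/= => /andP[t0 _].
have I1 : \int[leb]_(s in `[0, t]) heat_semigroup h (t - s)
      (fun xi => \int[leb]_(sigma in `[0, s])
         ((s - sigma) `^ (- gamma) * power_nl p1 (v sigma xi))) eta =
    fine (duhamel mu k mem (t, eta)).
  have [M M0 HM] := source_bound gamma_gt0 gamma_lt1 p1_gt1 p2_gt1 delta_gt0 us t.
  rewrite -(@duhamel_Rintegral mem t M eta mem_meas mem_ge0
    (memory_null (power_null p1_gt1 us) gamma) (ltW M0)); last first.
    by move=> s x st; apply: le_trans (HM s x st); rewrite /source leeDl.
  apply: eq_Rintegral => s; rewrite inE/= in_itv/= => /andP[s0 _].
  congr (heat_semigroup h (t - s) _ eta); apply/funext => x.
  exact: memory_Rintegral.
have I2 : \int[leb]_(s in `[0, t]) heat_semigroup h (t - s)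
      (fun xi => power_nl p2 (v s xi)) eta =
    fine (duhamel mu k (fun w => u w `^ p2)%E (t, eta)).
  rewrite -(@duhamel_Rintegral _ t (delta `^ p2) eta (mpow p2) (pow_ge0 p2)
    (power_null p2_gt1 us) (powR_ge0 _ _)); last first.
    move=> s x _; rewrite -poweR_EFin; apply: poweR_le => //.
      by rewrite (le_trans _ (ltW p2_gt1)).
    by have [_ _ _ ud _] := us; exact: ud.
  have mG : measurable_fun setT (fun z : mR * mH => power_nl p2 (clamped v z)).
    exact: (measurableT_comp (measurable_power_nl p2) (measurable_clamped vc)).
  have mF : measurable_fun setT (fun z : mR * mH => fine (u z `^ p2)%E).
    exact: (measurableT_comp (@fine_measurable R setT measurableT) (mpow p2)).
  (* At [s = 0] the curve is the datum while [u] is 0, so the integrands are only compared on the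
     open interval. [clamped] supplies the measurability under which the endpoints are dropped. *)
  transitivity (\int[leb]_(s in `[0, t]) heat_semigroup h (t - s)
      (fun xi => power_nl p2 (clamped v (s, xi))) eta).
    apply: eq_Rintegral => s; rewrite inE/= in_itv/= => /andP[s0 _].
    by congr (heat_semigroup h (t - s) _ eta); apply/funext => x; rewrite clampedE.
  rewrite (heat_semigroup_Rintegral hh t eta mG) (heat_semigroup_Rintegral hh t eta mF).
  apply: eq_Rintegral => s; rewrite inE/= in_itv/= => /andP[s0 _].
  apply: eq_Rintegral => x _; rewrite clampedE ?(ltW s0)//.
  by rewrite -(powerE _ p2_gt1 s0).
(* At time 0 both Duhamel terms vanish and [heat_semigroup] is the identity, which matches the
   initial value in [solution_curve]. *)
rewrite I1 I2; move: t0; rewrite le_eqVlt => /predU1P[<-|t0].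
  rewrite (duhamel_null mk (memory_null (power_null p1_gt1 us) gamma))//.
  rewrite (duhamel_null mk (power_null p2_gt1 us))// !addr0.
  by rewrite /heat_semigroup eqxx /solution_curve ltxx.
apply: etrans (_ : _ = fine (heat_op mu k t (EFin \o u0) eta) + fine (duhamel mu k mem (t, eta)) +
  fine (duhamel mu k (fun w => u w `^ p2)%E (t, eta))) _.
  rewrite /solution_curve t0; apply: mild_fin; first exact: ufix.
  - by apply: (heat_op_ge0 mk) => x; rewrite lee_fin.
  - exact: (duhamel_ge0 mk).
  - exact: (duhamel_ge0 mk).
by rewrite heat_semigroup_real_heat.
Qed.

End mild_solution_of_fixed_point.

Theorem theorem1p2 (R : realType) (n : nat) (n_ge1 : (1 <= n)%N)
    (h : R -> heis R n -> R) (h_heat : is_heat_kernel h)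
    (gamma p1 p2 : R) (gamma_gt0 : 0 < gamma) (gamma_lt1 : gamma < 1)
    (p1_gt1 : 1 < p1) (p2_gt1 : 1 < p2)
    (p1_gt : p1_star n gamma < p1) (p2_gt : p2_star2 n gamma < p2) :
  exists2 eps0 : R, 0 < eps0 &
    forall u0 : heis R n -> R,
      (forall eta, 0 <= u0 eta) ->
      C0 u0 -> Lq (q_sc n gamma p1 p2) u0 ->
      (Lq_norm +oo%E u0 <= eps0%:E)%E ->
      (Lq_norm (q_sc n gamma p1 p2)%:E u0 <= eps0%:E)%E ->
      exists u : R -> heis R n -> R,
        [/\ global_curve (q_sc n gamma p1 p2) u,
            global_mild_solution h gamma p1 p2 u0 u &
            forall v : R -> heis R n -> R,
              global_curve (q_sc n gamma p1 p2) v ->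
              global_mild_solution h gamma p1 p2 u0 v ->
              forall (t : R) eta, 0 <= t -> v t eta = u t eta].
Proof.
have [e1 [e2 [alpha [beta [r ce]]]]] :=
  critical_exponents_exist n_ge1 gamma_gt0 gamma_lt1 p1_gt1 p2_gt1 p1_gt p2_gt.
set q := q_sc n gamma p1 p2 in ce *.
have [C C_gt0 mk] := heat_trans_markov h_heat.
have dim_gt0 : 0 < n.+1%:R :> R by rewrite ltr0n.
have q_ge1 := ce_q_ge1 ce.
have q_gt0 : 0 < q by exact: lt_le_trans q_ge1.
have [eps eps_gt0 existence] := mild_existence mk C_gt0 dim_gt0 gamma_gt0 gamma_lt1
  (ce_e1_gt1 ce) (ce_e1_p1 ce) (ce_e2_gt1 ce) (ce_e2_p2 ce) (ce_e2_e1 ce)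
  (ce_alpha1 ce) (ce_alpha2 ce) (ce_r_ge ce) (ce_dim_r ce) q_ge1 (ce_dim_q ce)
  (ce_q_r ce) (ce_r_q1 ce) (ce_r_q2 ce) (ce_beta_gt0 ce) (ce_beta_e1 ce) (ce_beta_gamma ce).
exists eps => // u0 u00 u0C u0q u0_sup u0_q.
have [mu0 _ _] := C0_bounded_nonneg u0C u00.
have mu0' := (measurable_EFinP _ _).2 mu0.
have u0E : (\int[haar]_x (`|u0 x| `^ q)%:E = \int[haar]_x (u0 x `^ q)%:E)%E.
  by apply: eq_integral => x _; rewrite ger0_norm.
have u0_fin : (\int[haar]_x (u0 x `^ q)%:E < +oo)%E.
  by rewrite -u0E; exact: ((LqP _ q_gt0).1 u0q).2.
have u0_Lbound : Lbound haar q (EFin \o u0) eps.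
  have := Lq_norm_integral q_gt0 u0_q; rewrite u0E; apply: le_trans.
  by rewrite le_eqVlt; apply/orP; left; apply/eqP; apply: eq_integral => x _;
    rewrite -poweR_EFin.
have [delta [c [u [delta_gt0 c_gt0 us ufix uq]]]] := existence (EFin \o u0) mu0'
  (fun x => u00 x) u0_Lbound
  (fun t x => heat_op_le_ess_sup h_heat t x (ltW eps_gt0) mu0 u00 u0_sup).
have curve := solution_curve_global h_heat gamma_gt0 gamma_lt1 p1_gt1 p2_gt1 q_ge1
  delta_gt0 c_gt0 u0C u00 u0_fin us ufix uq.
have mild := fixed_point_mild h_heat gamma_gt0 gamma_lt1 p1_gt1 p2_gt1 delta_gt0
  u0C u00 us ufix curve.1.
exists (solution_curve u0 u); split => // v vc vm t eta t0.
exact: (global_mild_unique h_heat gamma_gt0 gamma_lt1 p1_gt1 p2_gt1 vc.1 curve.1 vm mild eta t0).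
Qed.
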